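(* Let $\Omega\subset\mathbb{C}^n$ be a P-hyperconvex domain and let $u$ be a plurisubharmonic function on $\Omega$. For every relatively compact set $E \Subset \Omega$, there is a sequence $\{u_j\}$ of functions, each smooth and plurisubharmonic in a neighborhood of $\overline{\Omega}$ (which may depend on $j$), such that $u_j(z) \searrow u(z)$ as $j\to\infty$ (that is, $u_j(z)$ decreases to $u(z)$) for every $z \in E$. Moreover, if $u$ is bounded from above, one can choose $E=\Omega$, i.e. there is such a sequence with $u_j(z)\searrow u(z)$ for every $z\in\Omega$.
   Context: A domain is a connected open set. Plurisubharmonic and upper semicontinuous functions take values in $[-\infty,\infty)$. For a compact set $X\subset\mathbb{C}^n$: - $\mathcal{PSH}^o(X)$ is the set of functions $u$ on $X$ for which there exist an open set $U\supset X$ and a function $\tilde u$, plurisubharmonic and continuous on $U$, with $\tilde u|_X=u$. - For $z\in X$, the set $\mathcal{J}_z(X)$ of Jensen measures for $z$ is the set of all (regular Borel) probability measures $\mu$ on $X$ such that $u(z)\le\int u\,d\mu$ for all $u\in\mathcal{PSH}^o(X)$. - $\mathcal{PSH}(X)$, the set of plurisubharmonic functions on the compact set $X$, is the set of all upper semicontinuous functions $u$ on $X$ such that $u(z)\le\int u\,d\mu$ for every $z\in X$ and every $\mu\in\mathcal{J}_z(X)$. A bounded domain $\Omega\subset\mathbb{C}^n$ is called P-hyperconvex if there is a non-constant function $\phi\in\mathcal{PSH}(\overline{\Omega})\cap C(\overline{\Omega})$ such that $\phi(z)=0$ for all $z\in\partial\Omega$. *)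

(* Defs.v *)
From HB Require Import structures.
From mathcomp Require Import all_boot all_order all_algebra.
From mathcomp Require Import complex.
From mathcomp Require Import all_classical all_reals all_analysis.
Import Order.TTheory GRing.Theory Num.Theory.
Import numFieldNormedType.Exports.

Set Implicit Arguments.
Unset Strict Implicit.
Unset Printing Implicit Defensive.

Local Open Scope classical_set_scope.
Local Open Scope ring_scope.

(* R[i] carries no topology by itself; presented as a numClosedFieldType it
   inherits the normed topology that MathComp-Analysis puts on every
   numFieldType, and 'rV[cplx R]_n the product topology (sup norm). *)
Definition cplx (R : realType) : numClosedFieldType := complex R.

Notation Cn R n := ('rV[cplx R]_n).

Definition cplx_of_real (R : realType) (t : R) : cplx R := (t%:C)%C.

Definition cis (R : realType) (t : R) : cplx R := (cos t +i* sin t)%C.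

(* Upper semicontinuity on A, relative to A, with values in [-oo, +oo[.
   Only the values of f on A matter: points outside A are isolated in
   the topology of subspace A. *)
Definition usc_on (T : topologicalType) (R : realType) (A : set T)
    (f : T -> \bar R) : Prop :=
  (forall x, A x -> (f x < +oo)%E) /\
  lower_semicontinuous ((fun x => - f x)%E : subspace A -> \bar R).

Definition circle_mean (R : realType) (v : cplx R -> \bar R) (c : cplx R)
    (r : R) : \bar R :=
  (((2 * pi)^-1)%:E *
   \int[lebesgue_measure]_(t in `[0%R, (2 * pi)%R]%classic)
      v (c + cplx_of_real r * cis t)%R)%E.

(* The function identically -oo counts as subharmonic. *)
Definition subharmonic (R : realType) (D : set (cplx R))
    (v : cplx R -> \bar R) : Prop :=
  usc_on D v /\
  forall (c : cplx R) (r : R), 0 < r ->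
    [set w : cplx R | `|w - c| <= cplx_of_real r] `<=` D ->
    (v c <= circle_mean v c r)%E.

Definition psh (R : realType) (n : nat) (U : set (Cn R n))
    (u : Cn R n -> \bar R) : Prop :=
  usc_on U u /\
  forall a b : Cn R n,
    subharmonic [set w : cplx R | U (a + w *: b)]
                (fun w : cplx R => u (a + w *: b)).

(* PSH^o(X) *)
Definition psh_cont_nbhd (R : realType) (n : nat) (X : set (Cn R n))
    (u : Cn R n -> R) : Prop :=
  exists (U : set (Cn R n)) (v : Cn R n -> R),
    [/\ open U, X `<=` U, psh U (EFin \o v), {within U, continuous v}
      & forall z, X z -> v z = u z].

Notation borelCn R n := (g_sigma_algebraType (@open (Cn R n))).

(* Jensen measures for z, represented as Borel probability measures on the
   whole space carried by X. Regularity is automatic: every finite Borel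
   measure on C^n is regular. *)
Definition jensen_measure (R : realType) (n : nat) (X : set (Cn R n))
    (z : Cn R n) (mu : probability (borelCn R n) R) : Prop :=
  mu X = 1%E /\
  forall u : Cn R n -> R, psh_cont_nbhd X u ->
    ((u z)%:E <= \int[mu]_(x in X) (u x)%:E)%E.

(* PSH(X) *)
Definition psh_compact (R : realType) (n : nat) (X : set (Cn R n))
    (u : Cn R n -> \bar R) : Prop :=
  usc_on X u /\
  forall (z : Cn R n) (mu : probability (borelCn R n) R),
    X z -> jensen_measure X z mu -> (u z <= \int[mu]_(x in X) u x)%E.

Definition bounded_domain (R : realType) (n : nat) (Omega : set (Cn R n)) :
    Prop :=
  [/\ open Omega, Omega !=set0, connected Omega & bounded_set Omega].

Definition topological_boundary (T : topologicalType) (A : set T) : set T :=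
  closure A `\` interior A.

Definition P_hyperconvex (R : realType) (n : nat) (Omega : set (Cn R n)) :
    Prop :=
  bounded_domain Omega /\
  exists phi : Cn R n -> R,
    [/\ psh_compact (closure Omega) (EFin \o phi),
        {within closure Omega, continuous phi},
        ~ (exists c : R, forall z, closure Omega z -> phi z = c)
      & forall z, topological_boundary Omega z -> phi z = 0].

(* Derivative of f along the real line through z in the direction v; the
   directions v and 'i *: v together give all real partial derivatives. *)
Definition dirD (R : realType) (n : nat) (v : Cn R n) (f : Cn R n -> R)
    (z : Cn R n) : R :=
  derive1 (fun t : R => f (z + cplx_of_real t *: v)) 0.

Definition iter_dirD (R : realType) (n : nat) (s : seq (Cn R n))
    (f : Cn R n -> R) : Cn R n -> R :=
  foldr (@dirD R n) f s.

(* C^oo on the open set U, in the real sense: iterated directional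
   derivatives of all orders exist and are continuous at each point of U. *)
Definition smooth_on (R : realType) (n : nat) (U : set (Cn R n))
    (f : Cn R n -> R) : Prop :=
  forall (s : seq (Cn R n)) (z : Cn R n), U z ->
    {for z, continuous (iter_dirD s f)} /\
    forall v : Cn R n,
      derivable (fun t : R => iter_dirD s f (z + cplx_of_real t *: v)) 0 1.

Definition smooth_psh_near (R : realType) (n : nat) (K : set (Cn R n))
    (f : Cn R n -> R) : Prop :=
  exists V : set (Cn R n),
    [/\ open V, K `<=` V, smooth_on V f & psh V (EFin \o f)].

Definition decreases_to (R : realType) (T : Type) (E : set T)
    (us : nat -> T -> R) (u : T -> \bar R) : Prop :=
  forall z, E z ->
    nonincreasing_seq (fun j => us j z) /\
    (fun j => (us j z)%:E) @ \oo --> u z.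

Definition relatively_compact_in (T : topologicalType) (E A : set T) : Prop :=
  compact (closure E) /\ closure E `<=` A.

(* Main.v *)
Require Import Defs.
From HB Require Import structures.
From mathcomp Require Import all_boot all_order all_algebra.
From mathcomp Require Import complex.
From mathcomp Require Import all_classical all_reals all_analysis.
From mathcomp Require Import measurable_realfun.
From mathcomp Require Import ring lra.
Import Order.TTheory GRing.Theory Num.Theory.
Import numFieldNormedType.Exports.

Set Implicit Arguments.
Unset Strict Implicit.
Unset Printing Implicit Defensive.

Local Open Scope classical_set_scope.
Local Open Scope ring_scope.

(** Write X for the closure of Omega and phi for the function given by
    P-hyperconvexity. A smooth approximant of u near X is obtained by gluing:
    near a compact subset of Omega, a regularization of u; near the boundary,
    a competitor psi that is plurisubharmonic in a neighbourhood of X, larger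
    than the regularization where the two meet and smaller than a prescribed
    majorant of u on the set where the approximation is wanted. The maximum of
    the two, then smoothed, is plurisubharmonic near X. The competitor is
    A phi + B for a large constant A: phi is negative in Omega and vanishes on
    the boundary (max_principle), so that multiplying by A creates any
    prescribed drop between the boundary and a compact subset of Omega.

    The obstacle is that phi is only plurisubharmonic on the compact set X, in
    the sense of Jensen measures. Edwards' theorem (edwards) removes it: on X,
    phi is a uniform limit of functions that are continuous and plurisubharmonic
    near X. At a point z, the supremum of v z over such functions v <= phi is
    the value at phi of a superlinear functional of phi; a linear functional
    above it that agrees with it at phi exists by the Hahn-Banach theorem
    (hahn_banach), is integration against a probability by the Riesz theorem
    (functional_measure), and this probability is a Jensen measure for z. So
    phi z is at most that supremum, and compactness of X makes the
    approximation uniform by means of finite maxima.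

    Regularization rests on averaging operators: monotone operators that
    commute with circle averages. They preserve submean inequalities on short
    circles, and these imply plurisubharmonicity (local_submean). Averages over
    two-dimensional families of circles give continuous functions above u
    (psh_regularize); convolutions along a real basis of C^n give smooth ones
    (smoothing).

    Together (smooth_psh_squeeze), these yield, for every continuous g > u, a
    smooth plurisubharmonic w near X with u < w and, on the set of interest,
    w < g. As u is a decreasing limit of continuous functions G j on compact
    sets (usc_approx), choosing successively w_(j+1) < min (w_j, G j) proves
    both claims: compact_approx works with a compact sublevel set of phi, and
    bounded_approx with all of X, on whose boundary u is given a constant value
    above its supremum. *)

(** * Real norms on C and C^n *)

Section Geometry.
Context {R : realType} {n : nat}.
Implicit Types (z w b : Cn R n) (a : cplx R) (r e : R).

Local Notation rl := (@cplx_of_real R).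

Lemma rl_le r e : (rl r <= rl e) = (r <= e).
Proof. exact: lecR. Qed.
Lemma rl_lt r e : (rl r < rl e) = (r < e).
Proof. exact: ltcR. Qed.
Lemma rlI : injective rl.
Proof. by move=> x y []. Qed.
Lemma rl0 : rl 0 = 0. Proof. by []. Qed.
Lemma rl1 : rl 1 = 1. Proof. by []. Qed.
Lemma rlD r e : rl (r + e) = rl r + rl e.
Proof. exact: (rmorphD (real_complex R)). Qed.
Lemma rlB r e : rl (r - e) = rl r - rl e.
Proof. exact: (rmorphB (real_complex R)). Qed.
Lemma rlM r e : rl (r * e) = rl r * rl e.
Proof. exact: (rmorphM (real_complex R)). Qed.
Lemma rlV r : rl (r^-1) = (rl r)^-1.
Proof. exact: (fmorphV (real_complex R)). Qed.

(** The norm of C takes its values in C, which is only partially ordered;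
    suprema, infima and derivatives need a real number. *)
Definition modc a : R := complex.Re (`|a| : complex R).
Lemma modcE a : `|a| = rl (modc a).
Proof. by rewrite /modc; case: a => x y; rewrite normc_def. Qed.

Lemma modc_sqr a : modc a ^+ 2 = complex.Re (a : complex R) ^+ 2 + complex.Im (a : complex R) ^+ 2.
Proof.
rewrite /modc; case: a => x y; rewrite normc_def /= sqr_sqrtr //.
by rewrite addr_ge0 // sqr_ge0.
Qed.
Lemma modc_ge0 a : 0 <= modc a.
Proof. by rewrite -rl_le rl0 -modcE normr_ge0. Qed.
Lemma modcM a1 a2 : modc (a1 * a2) = modc a1 * modc a2.
Proof. by apply: rlI; rewrite -[LHS]modcE normrM !modcE -rlM. Qed.
Lemma modcD a1 a2 : modc (a1 + a2) <= modc a1 + modc a2.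
Proof. by rewrite -rl_le rlD -!modcE ler_normD. Qed.
Lemma modc_rl r : modc (rl r) = `|r|.
Proof. by rewrite /modc normc_def /= expr0n /= addr0 sqrtr_sqr. Qed.
Lemma modc_cis r : modc (cis r) = 1.
Proof. by rewrite /modc normc_def /= cos2Dsin2 sqrtr1. Qed.
Lemma modc_i : modc 'i = 1.
Proof. by rewrite /modc normc_def /= expr0n /= expr1n add0r sqrtr1. Qed.
Lemma modc_Re a : `|complex.Re (a : complex R)| <= modc a.
Proof.
rewrite -(ler_pXn2r (ltn0Sn 1)) ?nnegrE ?modc_ge0 // modc_sqr.
by rewrite real_normK ?num_real // lerDl sqr_ge0.
Qed.
Lemma modc_Im a : `|complex.Im (a : complex R)| <= modc a.
Proof.
rewrite -(ler_pXn2r (ltn0Sn 1)) ?nnegrE ?modc_ge0 // modc_sqr.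
by rewrite real_normK ?num_real // lerDr sqr_ge0.
Qed.

Lemma cplx_pos (e : cplx R) : 0 < e -> e = rl (complex.Re (e : complex R)) /\ 0 < complex.Re (e : complex R).
Proof.
move=> e0; have := modcE e; rewrite (gtr0_norm e0) => ee.
have er : complex.Re (e : complex R) = modc e by rewrite [in LHS]ee.
by rewrite er; split => //; rewrite -rl_lt -ee.
Qed.

Definition nrm z : R := complex.Re (`|z| : complex R).
Lemma nrmE z : `|z| = rl (nrm z).
Proof.
rewrite /nrm; have : 0 <= `|z| by exact: normr_ge0.
by case: `|z| => x y; rewrite lecE /= => /andP[/eqP -> _].
Qed.
Lemma nrm_ge0 z : 0 <= nrm z.
Proof. by rewrite -rl_le rl0 -nrmE normr_ge0. Qed.
Lemma nrm0 : nrm 0 = 0.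
Proof. by apply: rlI; rewrite -[LHS]nrmE normr0. Qed.
Lemma nrmN z : nrm (- z) = nrm z.
Proof. by rewrite /nrm normrN. Qed.
Lemma nrmD z w : nrm (z + w) <= nrm z + nrm w.
Proof. by rewrite -rl_le rlD -!nrmE ler_normD. Qed.
Lemma nrmZ a z : nrm (a *: z) = modc a * nrm z.
Proof. by apply: rlI; rewrite -[LHS]nrmE normrZ modcE nrmE -rlM. Qed.
Lemma nrmB z w : nrm (z - w) = nrm (w - z).
Proof. by rewrite -nrmN opprB. Qed.
Lemma nrm_tri z w x : nrm (z - w) <= nrm (z - x) + nrm (x - w).
Proof. by rewrite -(subrKA x) nrmD. Qed.
Lemma nrm_coord z i : modc (z ord0 i) <= nrm z.
Proof.
rewrite -rl_le -modcE -nrmE [leRHS]/Num.norm /= mx_normE.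
rewrite -[leLHS]nngE num_le.
exact: (le_bigmax _ (fun i : 'I_1 * 'I_n => `|z i.1 i.2|%:nng) (ord0, i)).
Qed.
Lemma nrm_le z r : 0 <= r -> (forall i, modc (z ord0 i) <= r) -> nrm z <= r.
Proof.
move=> r0 h; rewrite -rl_le -nrmE [leLHS]/Num.norm /= mx_normE.
have r0' : 0 <= rl r by rewrite -rl0 rl_le.
rewrite -[rl r]/((NngNum r0')%:num) num_le; apply/bigmax_leP; split => //= i _.
by rewrite -num_le /= modcE rl_le; case: i => i j /=; rewrite ord1 h.
Qed.

Lemma nbhs_nrm z (A : set (Cn R n)) :
  nbhs z A <-> exists2 e : R, 0 < e & forall w, nrm (w - z) < e -> A w.
Proof.
split.
  move=> /nbhs_ballP [e /= /cplx_pos [ee e0] h]; exists (complex.Re (e : complex R)) => // w hw; apply: h.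
  by rewrite mx_norm_ball /= /ball_ distrC nrmE ee rl_lt.
move=> [e e0 h]; apply/nbhs_ballP; exists (rl e); first by rewrite /= -rl0 rl_lt.
by move=> w; rewrite mx_norm_ball /= /ball_ distrC nrmE rl_lt => /h.
Qed.

Lemma nbhs_modc a (A : set (cplx R)) :
  nbhs a A <-> exists2 e : R, 0 < e & forall w : cplx R, modc (w - a) < e -> A w.
Proof.
split.
  move=> /nbhs_ballP [e /= /cplx_pos [ee e0] h]; exists (complex.Re (e : complex R)) => // w hw; apply: h.
  by rewrite /ball /= distrC modcE ee rl_lt.
move=> [e e0 h]; apply/nbhs_ballP; exists (rl e); first by rewrite /= -rl0 rl_lt.
by move=> w; rewrite /ball /= distrC modcE rl_lt => /h.
Qed.

Lemma open_nrm (U : set (Cn R n)) : open U ->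
  forall z, U z -> exists2 e : R, 0 < e & forall w, nrm (w - z) < e -> U w.
Proof. by rewrite openE => oU z /oU /nbhs_nrm. Qed.

Lemma cvg_nrmP (f : Cn R n -> R) z :
  {for z, continuous f} <-> forall e, 0 < e -> exists2 d : R, 0 < d &
    forall w, nrm (w - z) < d -> `|f w - f z| < e.
Proof.
split=> [h e e0|h A /nbhs_ballP [e e0 hA]].
  have /nbhs_nrm [d d0 hd] := h _ (nbhsx_ballx (f z) e e0).
  by exists d => // w /hd; rewrite /ball /= distrC.
have [d d0 hd] := h _ e0; apply/nbhs_nrm; exists d => // w /hd hw.
by apply: hA; rewrite /ball /= distrC.
Qed.

Lemma continuous_rl : continuous rl.
Proof.
move=> x A /nbhs_modc [e e0 h]; apply/nbhs_ballP; exists e => // y.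
by rewrite /ball /= distrC => hy; apply: h; rewrite -rlB modc_rl.
Qed.

Lemma cisE r : cis r = rl (cos r) + 'i * rl (sin r).
Proof.
by apply/eqP; rewrite eq_complex /=; apply/andP; split; apply/eqP; ring.
Qed.
Lemma cplxE a : a = rl (complex.Re (a : complex R)) + 'i * rl (complex.Im (a : complex R)).
Proof.
by case: a => x y; apply/eqP; rewrite eq_complex /=; apply/andP; split; apply/eqP; ring.
Qed.

Lemma continuous_cis : continuous (@cis R).
Proof.
move=> x; rewrite (_ : @cis R = fun r => rl (cos r) + 'i * rl (sin r)); last first.
  by apply/funext => r; rewrite cisE.
apply: cvgD.
  by apply: continuous_comp; [exact: continuous_cos|exact: continuous_rl].
apply: cvgM; first exact: cvg_cst.
by apply: continuous_comp; [exact: continuous_sin|exact: continuous_rl].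
Qed.

Lemma cisD r e : cis (r + e) = cis r * cis e.
Proof.
apply/eqP; rewrite eq_complex /= cosD sinD; apply/andP; split => //.
by apply/eqP; ring.
Qed.
Lemma cis0 : @cis R 0 = 1.
Proof. by rewrite /cis cos0 sin0. Qed.
Lemma cis2pi : @cis R (2 * pi) = 1.
Proof.
by rewrite mulrC mulr_natr /cis -[pi *+ 2]add0r cosD2pi sinD2pi cos0 sin0.
Qed.
Lemma sqr_norm_le1 r : (`|r| <= 1) = (r ^+ 2 <= 1).
Proof.
by rewrite -(ler_pXn2r (ltn0Sn 1)) ?nnegrE // expr1n real_normK ?num_real.
Qed.
Lemma polar a : exists t, a = rl (modc a) * cis t.
Proof.
set m := modc a; have [m0|m0] := eqVneq m 0.
  by exists 0; rewrite m0 rl0 mul0r; apply/eqP; rewrite -normr_eq0 modcE -/m m0.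
pose c := complex.Re (a : complex R) / m; pose d := complex.Im (a : complex R) / m.
have cd : 1 - c ^+ 2 = d ^+ 2.
  by rewrite /c /d !expr_div_n /m modc_sqr; field; rewrite -modc_sqr sqrf_eq0.
have c1 : -1 <= c <= 1.
  by rewrite -ler_norml sqr_norm_le1 -subr_ge0 cd sqr_ge0.
have sc : sin (acos c) = `|d| by rewrite sin_acos // cd sqrtr_sqr.
have cc : cos (acos c) = c by rewrite acosK // in_itv.
have ac : a = rl m * rl c + rl m * ('i * rl d).
  by rewrite mulrCA -!rlM /c /d ![m * _]mulrC !divfK // -cplxE.
have [d0|d0] := lerP 0 d.
  by exists (acos c); rewrite cisE cc sc ger0_norm // mulrDr.
by exists (- acos c); rewrite cisE cosN sinN cc sc ltr0_norm // opprK mulrDr.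
Qed.

Lemma bounded_nrm (A : set (Cn R n)) : bounded_set A -> exists m : R, forall z, A z -> nrm z <= m.
Proof.
move=> [M [Mreal bM]]; exists (complex.Re (M : complex R) + 1) => z Az.
rewrite -rl_le -nrmE; apply: bM => //; move: Mreal; rewrite realE; case: (M) => x y.
by rewrite !lecE ltcE /= => /orP[/andP[/eqP<- _]|/andP[/eqP<- _]]; rewrite eqxx /= ltrDl.
Qed.

(** A real bound on the norm confines every coordinate to the image of a
    square of R^2 under (x, y) |-> x + i y, which is compact; a product of
    compact sets is compact. *)
Lemma Cn_compact (A : set (Cn R n)) (m : R) : (forall z, A z -> nrm z <= m) -> closed A -> compact A.
Proof.
move=> bA Acl.
pose D : set (cplx R) := (fun p : R * R => rl p.1 + 'i * rl p.2) @`
  (`[- m, m]%classic `*` `[- m, m]%classic).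
have cD : compact D.
  apply: continuous_compact; last by apply: compact_setX; exact: segment_compact.
  apply: continuous_subspaceT => x; apply: cvgD.
    by apply: (continuous_comp (f := fst)); [exact: cvg_fst|exact: continuous_rl].
  apply: cvgM; first exact: cvg_cst.
  by apply: (continuous_comp (f := snd)); [exact: cvg_snd|exact: continuous_rl].
apply: (@subclosed_compact _ A) Acl (@rV_compact _ _ (fun=> D) (fun=> cD)) _.
move=> z Az i /=; exists (complex.Re (z ord0 i : complex R), complex.Im (z ord0 i : complex R)).
  split; rewrite /= in_itv /= -ler_norml.
    exact: le_trans (modc_Re _) (le_trans (nrm_coord _ _) (bA _ Az)).
  exact: le_trans (modc_Im _) (le_trans (nrm_coord _ _) (bA _ Az)).
by rewrite [RHS]cplxE.
Qed.

End Geometry.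

(** * Means over a full turn *)

Lemma continuous_pair (X Y Z : topologicalType) (f : X -> Y) (g : X -> Z) :
  continuous f -> continuous g -> continuous (fun x => (f x, g x)).
Proof. by move=> cf cg x; apply: (cvg_pair (cf x) (cg x)). Qed.

Lemma continuous_comp' (X Y Z : topologicalType) (g : Y -> Z) (f : X -> Y) :
  continuous f -> continuous g -> continuous (fun x => g (f x)).
Proof. by move=> cf cg x; apply: (continuous_comp (cf x) (cg (f x))). Qed.

Lemma continuous_minr (R : realType) (X : topologicalType) (f g : X -> R) :
  continuous f -> continuous g -> continuous (fun x => Num.min (f x) (g x)).
Proof. by move=> cf cg x; apply: continuous_min; [exact: cf|exact: cg]. Qed.

Lemma continuous_maxr (R : realType) (X : topologicalType) (f g : X -> R) :
  continuous f -> continuous g -> continuous (fun x => Num.max (f x) (g x)).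
Proof. by move=> cf cg x; apply: continuous_max; [exact: cf|exact: cg]. Qed.

Lemma continuous_addr (R : realType) (X : topologicalType) (f g : X -> R) :
  continuous f -> continuous g -> continuous (fun x => f x + g x).
Proof. by move=> cf cg x; apply: cvgD; [exact: cf|exact: cg]. Qed.

Lemma continuous_mulr (R : realType) (X : topologicalType) (f g : X -> R) :
  continuous f -> continuous g -> continuous (fun x => f x * g x).
Proof. by move=> cf cg x; apply: cvgM; [exact: cf|exact: cg]. Qed.

Section Mean.
Context {R : realType}.
Implicit Types (h g : R -> R) (a e M : R).
Local Notation mu := (@lebesgue_measure R).
Local Notation turn := `[0%R, (2 * (pi : R))%R]%classic.

Definition mean h : R := (2 * pi)^-1 * \int[mu]_(t in turn) h t.

Lemma tau_gt0 : 0 < 2 * pi :> R.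
Proof. by rewrite mulr_gt0 // pi_gt0. Qed.

Lemma mu_turn : mu turn = (2 * pi)%:E.
Proof. by rewrite lebesgue_measure_itv /= lte_fin tau_gt0 sube0. Qed.

Lemma cont_int h : continuous h -> mu.-integrable turn (EFin \o h).
Proof.
move=> ch; apply: continuous_compact_integrable; first exact: segment_compact.
exact: continuous_subspaceT.
Qed.

Lemma mean_cst c : mean (fun=> c) = c.
Proof.
rewrite /mean Rintegral_cst //= mu_turn /= mulrCA mulVf ?mulr1 //.
by rewrite gt_eqF // tau_gt0.
Qed.

Lemma meanD h g : continuous h -> continuous g ->
  mean (fun t => h t + g t) = mean h + mean g.
Proof.
move=> ch cg; rewrite /mean (RintegralD _ (cont_int ch) (cont_int cg)) ?mulrDr //.
Qed.

Lemma meanZ c h : continuous h -> mean (fun t => c * h t) = c * mean h.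
Proof. by move=> ch; rewrite /mean (RintegralZl _ _ (cont_int ch)) // mulrCA. Qed.

Lemma meanB h g : continuous h -> continuous g ->
  mean (fun t => h t - g t) = mean h - mean g.
Proof.
by move=> ch cg; rewrite /mean (RintegralB _ (cont_int ch) (cont_int cg)) ?mulrBr.
Qed.

Lemma mean_ext h g : (forall t : R, 0 <= t <= 2 * pi -> h t = g t) -> mean h = mean g.
Proof.
move=> hg; rewrite /mean; congr (_ * _); apply: eq_Rintegral => t.
by rewrite inE /= in_itv /= => /hg.
Qed.

Lemma mean_le h g : continuous h -> continuous g ->
  (forall t : R, 0 <= t <= 2 * pi -> h t <= g t) -> mean h <= mean g.
Proof.
move=> ch cg hg; rewrite ler_pM2l ?invr_gt0 ?tau_gt0 //.
apply: (le_Rintegral _ (cont_int ch) (cont_int cg)) => // t; rewrite /= in_itv; exact: hg.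
Qed.

Lemma mean_norm h M : continuous h ->
  (forall t : R, 0 <= t <= 2 * pi -> `|h t| <= M) -> `|mean h| <= M.
Proof.
move=> ch hM; rewrite ler_norml -{1}(mean_cst (- M)) -{2}(mean_cst M).
by apply/andP; split; apply: mean_le => //; try exact: cst_continuous;
  move=> t /hM; rewrite ler_norml => /andP[].
Qed.

Lemma mean_dist h g e : continuous h -> continuous g ->
  (forall t : R, 0 <= t <= 2 * pi -> `|h t - g t| <= e) -> `|mean h - mean g| <= e.
Proof.
move=> ch cg hg; rewrite -meanB //; apply: mean_norm => //.
by move=> t; apply: cvgB; [exact: ch|exact: cg].
Qed.

Lemma mean_sum (I : Type) (r : seq I) (F : I -> R -> R) :
  (forall i, continuous (F i)) ->
  mean (fun t => \sum_(i <- r) F i t) = \sum_(i <- r) mean (F i)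
  /\ continuous (fun t => \sum_(i <- r) F i t).
Proof.
move=> cF; elim: r => [|i r [IH ch]].
  by under eq_fun do rewrite big_nil; rewrite mean_cst big_nil; split => //; exact: cst_continuous.
under eq_fun do rewrite big_cons; rewrite big_cons meanD ?IH //; split => //.
by move=> t; apply: cvgD; [exact: cF|exact: ch].
Qed.

Lemma circle_meanE (v : cplx R -> R) (c : cplx R) (r : R) :
  continuous (fun t => v (c + cplx_of_real r * cis t)) ->
  circle_mean (EFin \o v) c r = (mean (fun t => v (c + cplx_of_real r * cis t)))%:E.
Proof.
move=> ch; rewrite /circle_mean /mean EFinM; congr (_ * _)%E.
rewrite /Rintegral fineK //; apply: integrable_fin_num => //; exact: cont_int.
Qed.

(** Near x, compactness of [0, 2 pi] makes the continuity of H in its first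
    variable uniform in the second. *)
Lemma mean_continuous (X : topologicalType) (H : X -> R -> R) :
  continuous (fun p : X * R => H p.1 p.2) -> continuous (fun x => mean (H x)).
Proof.
move=> cH x.
have cHx y : continuous (H y).
  move=> t; apply: (@continuous_comp _ _ _ (fun t => (y, t)) (fun p : X * R => H p.1 p.2)).
    by apply: continuous_pair; [exact: cst_continuous|move=> ?; exact: cvg_id].
  exact: cH.
apply/cvgrPdist_le => e e0.
have : \forall y \near x, turn `<=` (fun t => `|H x t - H y t| <= e).
  have /compact_near_coveringP := @segment_compact R 0 (2 * pi).
  apply => t _.
  have e2 : 0 < e / 2 by rewrite divr_gt0.
  have c1 := cH (x, t); move/cvgrPdist_le: c1 => /(_ _ e2) [[A B] /= [nA nB] AB].
  exists (B, A) => //= -[s y] /= [Bs Ay].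
  have h1 := AB (x, s) (conj (nbhs_singleton nA) Bs).
  have h2 := AB (y, s) (conj Ay Bs); rewrite /= in h1 h2.
  rewrite -(subrKA (H x t)) (le_trans (ler_normD _ _)) // [leRHS](splitr e).
  by rewrite lerD // distrC.
apply: filterS => y Hy; apply: mean_dist => // t ht; apply: Hy.
Qed.

(** The point s' need not lie in [0, 2 pi]: difference quotients at the
    endpoint 0 use values on both sides. *)
Lemma unif_cont2 (H : R -> R -> R) e :
  continuous (fun p : R * R => H p.1 p.2) -> 0 < e ->
  exists2 d : R, 0 < d & forall s s' t : R, 0 <= s <= 2 * pi -> 0 <= t <= 2 * pi ->
    `|s - s'| <= d -> `|H s t - H s' t| <= e.
Proof.
move=> cH e0.
have cK : compact (turn `*` turn).
  by apply: compact_setX; exact: (@segment_compact R).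
have : \forall d \near (0 : R)^'+, (turn `*` turn) `<=`
    (fun p => forall s', `|p.1 - s'| <= d -> `|H p.1 p.2 - H s' p.2| <= e).
  move/compact_near_coveringP: cK; apply => -[s t] _.
  have e2 : 0 < e / 2 by rewrite divr_gt0.
  have := cH (s, t) => /cvgrPdist_le /(_ _ e2) /nbhs_ballP [r /= r0 hr].
  exists (ball (s, t) (r / 2), [set d | 0 < d < r / 2]).
    split; first by apply: nbhsx_ballx; rewrite divr_gt0.
    near=> d => /=; apply/andP; split; near: d.
      exact: nbhs_right_gt.
    by apply: nbhs_right_lt; rewrite divr_gt0.
  move=> [[x y] d] /= [[bx by'] /andP[d0 dr]] s' hs'; rewrite /ball /= in bx by'.
  have h1 : `|H s t - H x y| <= e / 2.
    by apply: (hr (x, y)); split; rewrite /ball /=;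
      [apply: lt_trans bx _|apply: lt_trans by' _]; lra.
  have h2 : `|H s t - H s' y| <= e / 2.
    apply: (hr (s', y)); split; rewrite /ball /=.
      rewrite -(subrKA x); apply: le_lt_trans (ler_normD _ _) _.
      by rewrite (splitr r) ltrD // (le_lt_trans hs').
    by apply: lt_trans by' _; lra.
  rewrite -(subrKA (H s t)) (le_trans (ler_normD _ _)) // [leRHS](splitr e).
  by rewrite lerD // distrC.
move=> H1; have [d [d0 hd]] : exists d : R, 0 < d /\ (turn `*` turn) `<=`
    (fun p => forall s', `|p.1 - s'| <= d -> `|H p.1 p.2 - H s' p.2| <= e).
  apply: (@filter_ex _ ((0:R)^'+)); near=> d; split; near: d; last exact: H1.
  exact: nbhs_right_gt.
exists d => // s s' t hs ht; apply: (hd (s, t)).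
by split; rewrite /= in_itv.
Unshelve. all: by end_near.
Qed.

Definition ramp (x : R) : R := Num.min 1 (Num.max 0 x).
Lemma ramp_continuous : continuous ramp.
Proof.
move=> x; apply: continuous_min; first exact: cvg_cst.
by apply: continuous_max; [exact: cvg_cst|exact: cvg_id].
Qed.
Lemma ramp_le x y : x <= y -> ramp x <= ramp y.
Proof. by rewrite /ramp; move=> ?; rewrite /Num.min /Num.max; do ! case: ifP; lra. Qed.
Lemma ramp0 x : x <= 0 -> ramp x = 0.
Proof. by rewrite /ramp /Num.min /Num.max; do ! case: ifP; lra. Qed.
Lemma ramp1 x : 1 <= x -> ramp x = 1.
Proof. by rewrite /ramp /Num.min /Num.max; do ! case: ifP; lra. Qed.

(** The means of a partition of unity, made of differences of shifted ramps,
    are the weights of a convex combination of values of h that is as close to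
    the mean of h as h oscillates at scale d. Weights and nodes do not depend
    on h, which is what the exchange of two means uses. *)
Lemma quadrature (d : R) : 0 < d -> exists N : nat, exists p : nat -> R, exists s : nat -> R,
  [/\ forall i, 0 <= p i, \sum_(i < N) p i = 1, forall i : 'I_N, 0 <= s i <= 2 * pi &
   forall h e, continuous h ->
     (forall x y : R, 0 <= x <= 2 * pi -> 0 <= y <= 2 * pi -> `|x - y| <= d -> `|h x - h y| <= e) ->
     `|mean h - \sum_(i < N) p i * h (s i)| <= e].
Proof.
move=> d0.
have [N [N0 hN]] : exists N : nat, (0 < N)%N /\ 2 * pi / N%:R <= d.
  have /archi_boundP h : 0 <= 2 * pi / d by rewrite divr_ge0 // ltW // tau_gt0.
  set N := Num.bound _ in h; exists N.
  have N0 : 0 < (N%:R : R) by apply: le_lt_trans h; rewrite divr_ge0 // ltW // tau_gt0.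
  split; first by rewrite -(ltr0n R).
  by rewrite ler_pdivrMr // -ler_pdivrMl // mulrC ltW.
have N0' : 0 < (N%:R : R) by rewrite ltr0n.
pose q : R := 2 * pi / N%:R.
have q0 : 0 < q by rewrite divr_gt0 // tau_gt0.
pose psi (i : nat) (x : R) := ramp (x / q - i%:R + 1) - ramp (x / q - i%:R).
have cpsi i : continuous (psi i).
  have c1 : continuous (fun x : R => x / q - i%:R).
    by move=> x; apply: cvgB; [apply: cvgM; [exact: cvg_id|exact: cvg_cst]|exact: cvg_cst].
  have c2 : continuous (fun x : R => x / q - i%:R + 1).
    by move=> x; apply: cvgD; [exact: c1|exact: cvg_cst].
  have r1 := continuous_comp' c1 ramp_continuous.
  have r2 := continuous_comp' c2 ramp_continuous.
  by move=> x; apply: cvgB; [exact: r2|exact: r1].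
have psi0 i x : 0 <= psi i x by rewrite subr_ge0 ramp_le // lerDl.
have sum1 x : 0 <= x <= 2 * pi -> \sum_(i < N.+1) psi i x = 1.
  move=> /andP[x0 x1].
  have -> : \sum_(i < N.+1) psi i x = ramp (x / q + 1) - ramp (x / q - N%:R).
    rewrite -(big_mkord xpredT (psi ^~ x)).
    have psiE i : psi i x = - ramp (x / q - i.+1%:R + 1) - - ramp (x / q - i%:R + 1).
      by rewrite /psi -natr1 opprK addrC; congr (- ramp _ + _); ring.
    rewrite (eq_bigr _ (fun i _ => psiE i)).
    rewrite (telescope_sumr (fun i : nat => - ramp (x / q - i%:R + 1)) (leq0n N.+1)).
    by rewrite opprK subr0 addrC -natr1; congr (_ - ramp _); ring.
  rewrite ramp1 ?ramp0 ?subr0 //.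
    by rewrite subr_le0 ler_pdivrMr // /q mulrC divfK // gt_eqF.
  by rewrite lerDr divr_ge0 // ltW.
exists N.+1, (fun i => mean (psi i)), (fun i => i%:R * q); split.
- by move=> i; rewrite -(mean_cst 0); apply: mean_le => //; exact: cst_continuous.
- have [<- _] := mean_sum (index_enum 'I_N.+1) (fun i : 'I_N.+1 => cpsi i).
  by rewrite -[RHS](mean_cst 1); apply: mean_ext => t /sum1.
- move=> i; apply/andP; split; first by rewrite mulr_ge0 // ltW.
  by rewrite /q mulrCA -[leRHS]mulr1 ler_pM2l ?tau_gt0 // ler_pdivrMr // mul1r ler_nat -ltnS.
move=> h e ch he.
have cF (i : 'I_N.+1) : continuous (fun x => psi i x * h (i%:R * q)).
  by move=> x; apply: cvgM; [exact: cpsi|exact: cvg_cst].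
have [E cS] := mean_sum (index_enum 'I_N.+1) cF.
have -> : \sum_(i < N.+1) mean (psi i) * h (i%:R * q) = mean (fun x => \sum_(i < N.+1) psi i x * h (i%:R * q)).
  rewrite E; apply: eq_bigr => i _; rewrite mulrC -meanZ //.
  by congr mean; apply/funext => x; rewrite mulrC.
apply: mean_dist => // x hx.
rewrite -[h x]mul1r -[in X in X * _](sum1 _ hx) mulr_suml -sumrB.
apply: le_trans (ler_norm_sum _ _ _) _.
rewrite -[e]mul1r -[in X in X * _](sum1 _ hx) mulr_suml; apply: ler_sum => i _.
rewrite -mulrBr normrM (ger0_norm (psi0 _ _)).
have [->|psi_n0] := eqVneq (psi i x) 0; first by rewrite !mul0r.
rewrite ler_wpM2l //; apply: he => //.
  apply/andP; split; first by rewrite mulr_ge0 // ltW.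
  by rewrite /q mulrCA -[leRHS]mulr1 ler_pM2l ?tau_gt0 // ler_pdivrMr // mul1r ler_nat -ltnS.
have xi : `|x / q - i%:R| <= 1.
  rewrite leNgt; apply/negP => hgt; move/negP: psi_n0; apply; apply/eqP.
  rewrite /psi; have [] := lerP 0 (x / q - i%:R) => h0.
    by move: hgt; rewrite ger0_norm // => hgt; rewrite !ramp1 ?subrr //; lra.
  by move: hgt; rewrite ltr0_norm // => hgt; rewrite !ramp0 ?subrr //; lra.
apply: le_trans hN; rewrite -/q.
rewrite -[x in `|x - _|](@divfK _ q) ?gt_eqF // -mulrBl normrM (gtr0_norm q0).
by rewrite -[leRHS]mul1r ler_pM2r.
Qed.

(** Replace the mean in s by a quadrature formula, uniformly in t: a finite
    sum commutes with the mean in t. *)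
Lemma mean_swap (H : R -> R -> R) : continuous (fun p : R * R => H p.1 p.2) ->
  mean (fun s => mean (fun t => H s t)) = mean (fun t => mean (fun s => H s t)).
Proof.
move=> cH.
have cH' : continuous (fun p : R * R => H p.2 p.1).
  move=> p; apply: (@continuous_comp _ _ _ (fun p : R * R => (p.2, p.1)) (fun p : R * R => H p.1 p.2)); last exact: cH.
  by apply: continuous_pair => q; [exact: cvg_snd|exact: cvg_fst].
have c1 := mean_continuous cH.
have c2 : continuous (fun t => mean (fun s => H s t)) := @mean_continuous _ (fun t s => H s t) cH'.
have cl s : continuous (H s).
  move=> t; apply: (@continuous_comp _ _ _ (fun t => (s, t)) (fun p : R * R => H p.1 p.2)); last exact: cH.
  by apply: continuous_pair; [exact: cst_continuous|move=> ?; exact: cvg_id].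
have cr t : continuous (H ^~ t).
  move=> s; apply: (@continuous_comp _ _ _ (fun s => (s, t)) (fun p : R * R => H p.1 p.2)); last exact: cH.
  by apply: continuous_pair; [move=> ?; exact: cvg_id|exact: cst_continuous].
apply/eqP; rewrite -subr_eq0 -normr_le0; apply/ler_addgt0Pr => e e0; rewrite add0r.
have e2 : 0 < e / 2 by rewrite divr_gt0.
have [d d0 hd] := unif_cont2 cH e2.
have [N [p [s [p0 p1 hs hq]]]] := quadrature d0.
have a1 := hq _ (e / 2) c1 _.
have a2 t ht := hq _ (e / 2) (cr t) (fun x y hx hy => @hd x y t hx ht).
have cF (i : 'I_N) : continuous (fun t => p i * H (s i) t).
  by move=> x; apply: cvgM; [exact: cvg_cst|exact: cl].
have [E cS] := mean_sum (index_enum 'I_N) cF.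
have a3 : `|mean (fun t => mean (fun s => H s t)) - mean (fun t => \sum_(i < N) p i * H (s i) t)| <= e / 2.
  by apply: mean_dist => // t ht; apply: a2.
rewrite E in a3.
have E2 : \sum_(i < N) mean (fun t => p i * H (s i) t) = \sum_(i < N) p i * mean (H (s i)).
  by apply: eq_bigr => i _; rewrite meanZ.
rewrite E2 in a3.
rewrite -(subrKA (\sum_(i < N) p i * mean (H (s i)))) (le_trans (ler_normD _ _)) //.
rewrite [leRHS](splitr e) lerD //; last by rewrite distrC.
apply: a1 => x y hx hy xy; apply: mean_dist => // t ht; exact: hd.
Qed.

End Mean.

Section Shift.
Context {R : realType}.
Implicit Types (h P : R -> R) (a M N : R).
Local Notation mu := (@lebesgue_measure R).

(** Continuous functions are integrated through primitives on a large open
    interval, so that all shifted intervals of integration stay in its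
    interior. *)
Lemma primitive h N : 0 < N -> continuous h ->
  exists P : R -> R, forall x : R, - N < x < N -> is_derive x 1 P (h x).
Proof.
move=> N0 ch; exists (fun x => \int[mu]_(t in `[- N, x]) h t) => x /andP[x1 x2].
have ih : mu.-integrable `[- N, N] (EFin \o h).
  apply: continuous_compact_integrable; first exact: segment_compact.
  exact: continuous_subspaceT.
have [D E] := continuous_FTC1 (a := BLeft (- N)) x2 ih x1 (ch x).
by apply: (DeriveDef D); rewrite -derive1E.
Qed.

Lemma is_derive_MVT h P (x y a b : R) :
  (forall z : R, a < z < b -> is_derive z 1 P (h z)) -> a < x < b -> a < y < b ->
  exists2 c : R, `|c - x| <= `|y - x| & P y - P x = h c * (y - x).
Proof.
move=> dP; suff H x' y' : x' <= y' -> a < x' < b -> a < y' < b -> exists2 c : R,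
    x' <= c <= y' & P y' - P x' = h c * (y' - x').
  move=> hx hy; have [xy|/ltW yx] := lerP x y.
    have [c /andP[c1 c2] E] := H _ _ xy hx hy; exists c => //.
    by rewrite !ger0_norm ?subr_ge0 ?lerB.
  have [c /andP[c1 c2] E] := H _ _ yx hy hx; exists c.
    by rewrite [`|c - x|]ler0_norm ?[`|y - x|]ler0_norm ?subr_le0 //; lra.
  by rewrite -opprB E -mulrN opprB.
move=> xy /andP[x1 x2] /andP[y1 y2].
have dP' z : z \in `]x', y'[ -> is_derive z 1 P (h z).
  by rewrite in_itv /= => /andP[? ?]; apply: dP; lra.
have [|c] := MVT_segment xy dP'.
  apply: derivable_within_continuous => z; rewrite in_itv /= => /andP[? ?].
  by apply: (@ex_derive _ _ _ _ _ _ _ (dP z _)); lra.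
by rewrite in_itv /= => c1 E; exists c.
Qed.

Lemma mean_shiftE h P N a : continuous h ->
  (forall z : R, - N < z < N -> is_derive z 1 P (h z)) -> - N < a -> a + 2 * pi < N ->
  mean (fun t => h (t + a)) = (2 * pi)^-1 * (P (a + 2 * pi) - P a).
Proof.
move=> ch dP a1 a2; rewrite /mean; congr (_ * _).
have dPa (z : R) : 0 <= z <= 2 * pi -> is_derive z 1 (fun t => P (t + a)) (h (z + a)).
  move=> /andP[z0 z1].
  have d1 : is_derive (z + a) 1 P (h (z + a)) by apply: dP; lra.
  have d2 : is_derive z 1 (fun t => t + a) (1 : R) by apply: is_derive_eq; rewrite addr0.
  have := @is_derive1_comp R P (fun t => t + a) z _ _ d1 d2.
  by rewrite mulr1.
have cont (z : R) : 0 <= z <= 2 * pi -> {for z, continuous (fun t => P (t + a))}.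
  move=> /dPa hz; apply: differentiable_continuous; apply/derivable1_diffP.
  exact: (@ex_derive _ _ _ _ _ _ _ hz).
rewrite /Rintegral (@continuous_FTC2 R (fun t => h (t + a)) (fun t => P (t + a)) 0 (2 * pi)).
- by rewrite add0r (addrC a).
- exact: tau_gt0.
- apply: continuous_subspaceT => t.
  apply: (@continuous_comp _ _ _ (fun t => t + a) h); last exact: ch.
  by apply: cvgD; [exact: cvg_id|exact: cvg_cst].
- split.
  + move=> z; rewrite in_itv /= => /andP[? ?].
    by apply: (@ex_derive _ _ _ _ _ _ _ (dPa z _)); lra.
  + by apply: cvg_at_right_filter; apply: cont; rewrite lexx ltW // tau_gt0.
  + by apply: cvg_at_left_filter; apply: cont; rewrite lexx ltW // tau_gt0.
- move=> z; rewrite in_itv /= => /andP[? ?].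
  rewrite derive1E; apply: (@derive_val _ _ _ _ _ _ _ (dPa z _)); lra.
Qed.

Lemma mean_gt0 h (s : R) : continuous h -> (forall t, 0 <= h t) -> 0 < s < 2 * pi -> 0 < h s ->
  0 < mean h.
Proof.
move=> ch h0 /andP[s0 s1] hs.
have : nbhs s (h @^-1` [set y | 0 < y]) by apply: ch; exact: lt_nbhsr.
move=> /nbhs_ballP[e /= e0 he].
pose d := Num.min (e / 2) ((2 * pi - s) / 2).
have d0 : 0 < d by rewrite lt_min !divr_gt0 // subr_gt0.
have de : d <= e / 2 by rewrite ge_min lexx.
have ds : d <= (2 * pi - s) / 2 by rewrite ge_min lexx orbT.
pose N : R := 2 * pi + 1; have N0 : 0 < N by rewrite /N; lra.
have [P dP] := primitive N0 ch.
have -> : mean h = (2 * pi)^-1 * (P (0 + 2 * pi) - P 0).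
  by rewrite -(mean_shiftE ch dP) ?/N; [apply: mean_ext => t _; rewrite addr0|lra|lra].
rewrite mulr_gt0 ?invr_gt0 ?tau_gt0 //.
have [||a _ Ea] := @is_derive_MVT h P 0 s _ _ dP; [by rewrite /N; lra|by rewrite /N; lra|].
have [||b hb Eb] := @is_derive_MVT h P s (s + d) _ _ dP; [by rewrite /N; lra|by rewrite /N; lra|].
have [||c _ Ec] := @is_derive_MVT h P (s + d) (0 + 2 * pi) _ _ dP; [by rewrite /N; lra|by rewrite /N; lra|].
have hb0 : 0 < h b.
  apply: he; rewrite /ball /= distrC; apply: le_lt_trans hb _.
  by rewrite addrAC subrr add0r gtr0_norm //; lra.
have := h0 a; have := h0 c; nra.
Qed.

(** Shifting h by a changes its integral only near the two ends of [0, 2 pi],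
    by at most M |a| each; dividing by 2 pi absorbs the factor 2. This gain is
    the source of the Lipschitz bounds for averages below. *)
Lemma mean_shift_lip h M a : continuous h -> (forall t, `|h t| <= M) ->
  `|mean (fun t => h (t + a)) - mean h| <= M * `|a|.
Proof.
move=> ch hM; have p0 := @tau_gt0 R.
pose N := 2 * pi + `|a| + 1; have N0 : 0 < N by rewrite /N; have := normr_ge0 a; lra.
have [P dP] := primitive N0 ch.
have aN := ler_norm a; have aN' := ler_norm (- a); rewrite normrN in aN'.
have E0 : mean h = (2 * pi)^-1 * (P (0 + 2 * pi) - P 0).
  by rewrite -(mean_shiftE ch dP) ?/N; [congr mean; apply/funext => t; rewrite addr0|lra|lra].
rewrite (mean_shiftE ch dP) ?E0 /N; [|lra|lra].
have M0 : 0 <= M by exact: le_trans (normr_ge0 _) (hM 0).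
have [||c _ Ec] := @is_derive_MVT h P 0 a _ _ dP; [by rewrite /N; lra|by rewrite /N; lra|].
have [||d _ Ed] := @is_derive_MVT h P (0 + 2 * pi) (a + 2 * pi) _ _ dP;
  [by rewrite /N; lra|by rewrite /N; lra|].
have -> : (2 * pi)^-1 * (P (a + 2 * pi) - P a) - (2 * pi)^-1 * (P (0 + 2 * pi) - P 0)
  = (2 * pi)^-1 * ((P (a + 2 * pi) - P (0 + 2 * pi)) - (P a - P 0)) by ring.
rewrite Ec Ed (_ : _ - _ = (h d - h c) * a); last by ring.
have i0 : 0 < (2 * pi : R)^-1 by rewrite invr_gt0.
rewrite normrM (gtr0_norm i0) ler_pdivrMl // normrM mulrA ler_wpM2r //.
apply: le_trans (ler_normB _ _) _; apply: le_trans (lerD (hM _) (hM _)) _.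
have := pi_ge2 R; nra.
Qed.

Lemma mean_shift_periodic h a : continuous h -> (forall t, h (t + 2 * pi) = h t) ->
  mean (fun t => h (t + a)) = mean h.
Proof.
move=> ch hp; have p0 := @tau_gt0 R.
pose N := 4 * pi + `|a| + 1; have N0 : 0 < N by rewrite /N; have := normr_ge0 a; lra.
have [P dP] := primitive N0 ch.
have aN := ler_norm a; have aN' := ler_norm (- a); rewrite normrN in aN'.
have E0 : mean h = (2 * pi)^-1 * (P (0 + 2 * pi) - P 0).
  by rewrite -(mean_shiftE ch dP) ?/N; [congr mean; apply/funext => t; rewrite addr0|lra|lra].
rewrite (mean_shiftE ch dP) ?E0 /N; [|lra|lra]; congr (_ * _).
pose L : R := `|a| + 1.
have dD (z : R) : - L < z < L -> is_derive z 1 (fun t => P (t + 2 * pi) - P t) (0 : R).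
  rewrite /L => hz.
  have d1 : is_derive (z + 2 * pi) 1 P (h (z + 2 * pi)) by apply: dP; rewrite /N; lra.
  have d2 : is_derive z 1 (fun t => t + 2 * pi) (1 : R) by apply: is_derive_eq; rewrite addr0.
  have d3 : is_derive z 1 P (h z) by apply: dP; rewrite /N; lra.
  have d4 := @is_derive1_comp R P (fun t => t + 2 * pi) z _ _ d1 d2.
  by apply: is_derive_eq; rewrite mulr1 hp subrr.
have [||c _] := @is_derive_MVT (fun=> 0) (fun t => P (t + 2 * pi) - P t) 0 a _ _ dD;
  [by rewrite /L; lra|by rewrite /L; lra|].
by move/eqP; rewrite mul0r subr_eq0 => /eqP.
Qed.

(** The support (1, 2) lies at distance at least 1 from both ends of [0, 2
    pi], so that the shift moves it without losing any of it. *)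
Lemma mean_shift_supp h a : continuous h -> (forall t, ~~ (1 < t < 2) -> h t = 0) ->
  `|a| < 1 -> mean (fun t => h (t + a)) = mean h.
Proof.
move=> ch hs a1; have p0 := @tau_gt0 R; have p2 := pi_ge2 R.
pose N : R := 2 * pi + 2; have N0 : 0 < N by rewrite /N; lra.
have [P dP] := primitive N0 ch.
have aN := ler_norm a; have aN' := ler_norm (- a); rewrite normrN in aN'.
have E0 : mean h = (2 * pi)^-1 * (P (0 + 2 * pi) - P 0).
  by rewrite -(mean_shiftE ch dP) ?/N; [congr mean; apply/funext => t; rewrite addr0|lra|lra].
rewrite (mean_shiftE ch dP) ?E0 /N; [|lra|lra]; congr (_ * _).
have [||c hc1 Ec] := @is_derive_MVT h P 0 a _ _ dP; [by rewrite /N; lra|by rewrite /N; lra|].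
have [||d hd1 Ed] := @is_derive_MVT h P (0 + 2 * pi) (a + 2 * pi) _ _ dP;
  [by rewrite /N; lra|by rewrite /N; lra|].
rewrite (hs c) in Ec; last first.
  rewrite !subr0 in hc1; have := ler_norm c; apply/contraTN => /andP[? ?]; lra.
rewrite (hs d) in Ed; last first.
  have : `|d - (0 + 2 * pi)| <= `|a| by apply: le_trans hd1 _; rewrite (_ : _ - _ = a) //; ring.
  by rewrite ler_norml => /andP[h1 h2]; apply/negP => /andP[? ?]; lra.
move: Ec Ed; rewrite !mul0r => /eqP; rewrite subr_eq0 => /eqP -> /eqP; rewrite subr_eq0 => /eqP -> //.
Qed.

(** Differentiation under the integral sign: by the mean value theorem the
    difference quotient of K at (x, t) is a value dK c t with |c| <= |x|, and
    dK is uniformly continuous. *)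
Lemma mean_derive (K dK : R -> R -> R) (r : R) : 0 < r ->
  (forall x, continuous (K x)) ->
  continuous (fun p : R * R => dK p.1 p.2) ->
  (forall x t : R, `|x| < r -> is_derive x 1 (K ^~ t) (dK x t)) ->
  is_derive (0 : R) 1 (fun x => mean (K x)) (mean (dK 0)).
Proof.
move=> r0 cK cdK dd.
have cl : continuous (dK 0).
  apply: (@continuous_comp' _ _ _ (fun p : R * R => dK p.1 p.2) (fun t => (0, t))) cdK.
  by apply: continuous_pair; [exact: cst_continuous|move=> ?; exact: cvg_id].
suff H : h^-1 *: (mean (K (h *: 1 + 0)) - mean (K 0)) @[h --> 0^'] --> mean (dK 0).
  by apply: DeriveDef; [apply/cvg_ex; exists (mean (dK 0))|apply/cvg_lim].
apply/cvgrPdist_le => e e0.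
have [d d0 hd] := unif_cont2 cdK e0.
near=> x.
have x0 : x != 0 by near: x; exact: nbhs_dnbhs_neq.
have xd : `|x| < d.
  by near: x; apply: dnbhs0_lt.
have xr : `|x| < r.
  by near: x; apply: dnbhs0_lt.
rewrite [x *: 1]mulr1 addr0.
have cKx : continuous (fun t => x^-1 * (K x t - K 0 t)).
  move=> t; apply: cvgM; first exact: cvg_cst.
  by apply: cvgB; exact: cK.
have -> : x^-1 *: (mean (K x) - mean (K 0)) = mean (fun t => x^-1 * (K x t - K 0 t)).
  rewrite meanZ ?meanB //.
  by move=> t; apply: cvgB; exact: cK.
apply: mean_dist => // t ht.
have dd' (z : R) : - r < z < r -> is_derive z 1 (K ^~ t) (dK z t).
  by move=> hz; apply: dd; rewrite ltr_norml.
have [||c hc1 Ec] := @is_derive_MVT (dK ^~ t) (K ^~ t) 0 x _ _ dd';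
  [by rewrite -ltr_norml normr0|by rewrite -ltr_norml|].
rewrite Ec subr0 mulrC mulfK //; apply: hd => //.
  by rewrite lexx ltW // tau_gt0.
by rewrite distrC (le_trans hc1) // subr0 ltW.
Unshelve. all: by end_near.
Qed.

End Shift.
#[global] Opaque mean.

(** * A smooth bump *)

Section Bump.
Context {R : realType}.
Implicit Types (p : {poly R}) (k : nat) (t s : R).

Definition bump_gap : {poly R} := ('X - 1%:P) * (2%:P - 'X).

(** With y = 1 / ((t - 1) (2 - t)) these are the functions p(t) y^k exp (- y)
    on (1, 2), extended by 0. The family contains the classical bump exp (- y)
    and is closed under differentiation, which turns smoothness into an
    induction. *)
Definition bump_fun p k t : R := if 1 < t < 2 then
  p.[t] * (bump_gap.[t])^-1 ^+ k * expR (- (bump_gap.[t])^-1) else 0.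

Definition smooth_kernel (chi : R -> R) := exists p k, chi = bump_fun p k.

Lemma bump_gapE t : bump_gap.[t] = (t - 1) * (2 - t).
Proof. by rewrite /bump_gap !hornerE. Qed.

Lemma bump_gap_gt0 t : 1 < t < 2 -> 0 < bump_gap.[t].
Proof. by rewrite bump_gapE => /andP[? ?]; rewrite mulr_gt0 // subr_gt0. Qed.

Lemma smooth_kernel_supp chi t : smooth_kernel chi -> ~~ (1 < t < 2) -> chi t = 0.
Proof. by move=> [p [k ->]] /negbTE h; rewrite /bump_fun h. Qed.

Lemma poly_cont p : continuous (horner p).
Proof.
move=> x; apply: differentiable_continuous; apply/derivable1_diffP.
exact: (@ex_derive _ _ _ _ _ _ _ (is_derive_poly p x)).
Qed.

(** As y^(k+2) exp (- y) is bounded, p y^k exp (- y) is at most a constant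
    times the square of (t - 1) (2 - t), hence quadratically small at the end
    points of (1, 2); this is why its derivative vanishes outside the
    interval. *)
Lemma bump_fun_flat p k : exists2 C : R, 0 <= C &
  forall s t, ~~ (1 < t < 2) -> `|bump_fun p k s| <= C * `|s - t| ^+ 2.
Proof.
have [c _ hc] : exists2 c, c \in `[(1:R), 2] & forall t, t \in `[(1:R), 2] -> `|p.[t]| <= `|p.[c]|.
  apply: (@EVT_max R (fun t => `|p.[t]|)); first by lra.
  apply: continuous_subspaceT => x.
  by apply: (@continuous_comp _ _ _ (horner p) Num.norm); [exact: poly_cont|exact: norm_continuous].
exists (`|p.[c]| * k.+2`!%:R); first by rewrite mulr_ge0.
move=> s t ht; rewrite /bump_fun; case: ifPn => hs; last by rewrite normr0 !mulr_ge0.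
have g0 := bump_gap_gt0 hs; set y := (bump_gap.[s])^-1; have y0 : 0 < y by rewrite invr_gt0.
rewrite !normrM -!mulrA; apply: ler_pM => //.
  by apply: hc; rewrite in_itv /=; lra.
rewrite (gtr0_norm (exprn_gt0 _ y0)) (gtr0_norm (expR_gt0 _)).
have e1 : y ^+ k.+2 * expR (- y) <= k.+2`!%:R.
  rewrite expRN ler_pdivrMr ?expR_gt0 // mulrC -ler_pdivrMr ?ltr0n ?fact_gt0 //.
  by apply: le_trans (expR_ge1Dxn k.+1 (ltW y0)); rewrite lerDr.
have -> : y ^+ k * expR (- y) = (y ^+ k.+2 * expR (- y)) * bump_gap.[s] ^+ 2.
  by rewrite mulrAC !exprS /y; field; rewrite gt_eqF.
apply: ler_pM => //; [by rewrite mulr_ge0 ?exprn_ge0 ?expR_ge0 // ltW|exact: sqr_ge0|].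
rewrite lerXn2r ?nnegrE ?(ltW g0) // bump_gapE.
move: hs => /andP[s1 s2]; move: ht; rewrite negb_and -!leNgt => /orP[t1|t2].
  by apply: le_trans (ler_norm _); nra.
by rewrite distrC; apply: le_trans (ler_norm _); nra.
Qed.

Lemma bump_fun_deriv p k t : is_derive t 1 (bump_fun p k)
  (bump_fun (p^`() * bump_gap ^+ 2 - k%:R%:P * p * bump_gap^`() * bump_gap + p * bump_gap^`()) k.+2 t).
Proof.
pose q := p^`() * bump_gap ^+ 2 - k%:R%:P * p * bump_gap^`() * bump_gap + p * bump_gap^`(); rewrite -/q.
have [ht|ht] := boolP (1 < t < 2); last first.
  rewrite [X in is_derive _ _ _ X](_ : _ = 0); last by rewrite /bump_fun (negbTE ht).
  have [C C0 hC] := bump_fun_flat p k.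
  have rt : bump_fun p k t = 0 by rewrite /bump_fun (negbTE ht).
  suff H : h^-1 *: (bump_fun p k (h *: (1:R) + t) - bump_fun p k t) @[h --> 0^'] --> (0 : R).
    by apply: DeriveDef; [apply/cvg_ex; exists 0|apply/cvg_lim].
  apply/cvgrPdist_le => e e0; near=> h.
  have h0 : h != 0 by near: h; exact: nbhs_dnbhs_neq.
  have hd : `|h| < e / (C + 1) by near: h; apply: dnbhs0_lt; rewrite divr_gt0 // ltr_wpDl.
  rewrite sub0r normrN rt subr0 [h *: 1]mulr1 [_ *: _]/(_ * _) normrM normfV.
  rewrite ler_pdivrMl ?normr_gt0 //.
  apply: le_trans (hC _ t ht) _; rewrite addrK expr2 mulrCA ler_wpM2l //.
  move: hd; rewrite ltr_pdivlMr ?ltr_wpDl // mulrDr mulr1 mulrC => hd.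
  by apply: ltW; apply: le_lt_trans hd; rewrite lerDl.
have g0 := bump_gap_gt0 ht.
pose F := fun t : R => p.[t] * (bump_gap.[t])^-1 ^+ k * expR (- (bump_gap.[t])^-1).
have : is_derive t 1 F (bump_fun q k.+2 t).
  have d1 := is_derive_poly p t; have d2 := is_derive_poly bump_gap t.
  have d3 : is_derive t 1 (fun t => (bump_gap.[t])^-1) (- bump_gap.[t] ^- 2 *: bump_gap^`().[t]).
    by apply: is_deriveV => //; rewrite gt_eqF.
  have d4 := @is_deriveX _ _ (fun t => (bump_gap.[t])^-1) k t 1 _ d3.
  rewrite exprfctE in d4.
  have d5 := @is_derive1_comp R expR (fun t => - (bump_gap.[t])^-1) t _ _ (is_derive_expR _) (is_deriveN d3).
  apply: (is_derive_eq (is_deriveM (is_deriveM d1 d4) d5)).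
  rewrite /bump_fun ht (_ : q.[t] = p^`().[t] * bump_gap.[t] ^+ 2 -
    k%:R * p.[t] * bump_gap^`().[t] * bump_gap.[t] + p.[t] * bump_gap^`().[t]); last first.
    by rewrite /q; move: bump_gap bump_gap^`() => D D'; rewrite !hornerE.
  rewrite !fctE /= /GRing.scale /=.
  have gn0 : bump_gap.[t] != 0 by rewrite gt_eqF.
  move: (bump_gap.[t]) gn0 (expR _) => G G0 E.
  case: (k) => [|k'] /=; rewrite !exprS ?expr0.
    by field.
  by move: (G^-1 ^+ k') => Z; field.
apply: near_eq_is_derive; near=> s.
rewrite /F /bump_fun ifT //; apply/andP; split; near: s.
  by apply: lt_nbhsr; case/andP: ht.
by apply: lt_nbhsl; case/andP: ht.
Unshelve. all: by end_near.
Qed.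

Lemma smooth_kernel_deriv chi : smooth_kernel chi ->
  exists2 chi', smooth_kernel chi' & forall t, is_derive t 1 chi (chi' t).
Proof.
move=> [p [k ->]]; eexists; first by do 2 eexists.
move=> t; exact: bump_fun_deriv.
Qed.

Lemma smooth_kernel_cont chi : smooth_kernel chi -> continuous chi.
Proof.
move=> /smooth_kernel_deriv[chi' _ d] x; apply: differentiable_continuous.
by apply/derivable1_diffP; exact: (@ex_derive _ _ _ _ _ _ _ (d x)).
Qed.

Lemma bump : exists chi, [/\ smooth_kernel chi, forall t, 0 <= chi t & mean chi = 1].
Proof.
pose h := bump_fun 1%:P 0.
have sh : smooth_kernel h by exists 1%:P, 0%N.
have ch := smooth_kernel_cont sh.
have h0 t : 0 <= h t by rewrite /h /bump_fun; case: ifP => // _; rewrite hornerC expr0 !mul1r expR_ge0.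
have p2 := pi_ge2 R.
have m0 : 0 < mean h.
  apply: (@mean_gt0 _ h (3 / 2)) => //; first by lra.
  by rewrite /h /bump_fun ifT ?hornerC ?expr0 ?mul1r ?expR_gt0 //; lra.
exists (bump_fun ((mean h)^-1)%:P 0).
have E t : bump_fun ((mean h)^-1)%:P 0 t = (mean h)^-1 * h t.
  by rewrite /h /bump_fun; case: ifP => _; rewrite ?mulr0 // !hornerC expr0 !mulr1 mul1r.
split; first by exists ((mean h)^-1)%:P, 0%N.
  by move=> t; rewrite E mulr_ge0 // invr_ge0 ltW.
rewrite (_ : bump_fun _ _ = fun t => (mean h)^-1 * h t); last by apply/funext.
by rewrite meanZ // mulVf // gt_eqF.
Qed.

End Bump.

(** * Plurisubharmonicity and circle averages *)

(** A point outside A is isolated in the topology of the subspace A, so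
    semicontinuity says nothing there. *)
Lemma usc_onP (T : topologicalType) (R : realType) (A : set T) (f : T -> \bar R) :
  usc_on A f <-> forall x, A x -> (f x < +oo)%E /\
    forall c : R, (f x < c%:E)%E -> \forall y \near x, A y -> (f y < c%:E)%E.
Proof.
split=> [[fy lsc] x Ax|h].
  split; first exact: fy.
  move=> c fc; have : ((- c)%:E < - f x)%E by rewrite EFinN lteN2.
  move=> /(lsc x) [V nV hV].
  have : nbhs_subspace (x : subspace A) V by [].
  rewrite -(nbhs_subspace_in Ax) /within /=; apply: filterS => y Vy Ay.
  by have := hV y (Vy Ay); rewrite EFinN lteN2.
split=> [x /h[]//|x a]; have [Ax|nAx] := pselect (A x).
  rewrite -[a]opprK EFinN lteN2 => fa; exists [set y | (f y < (- a)%:E)%E].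
    have : nbhs_subspace (x : subspace A) [set y | (f y < (- a)%:E)%E].
      apply: (eq_ind _ (fun F : set_system T => F [set y | (f y < (- a)%:E)%E]) _ _
        (nbhs_subspace_in Ax)).
      exact: (proj2 (h x Ax) _ fa).
    by [].
  by move=> y hy; rewrite lteN2.
move=> fa; exists [set x]; last by move=> y ->.
have W : globally [set (x : T)] [set (x : T)] by [].
exact: (eq_ind _ (fun F : set_system T => F [set (x : T)]) W _ (nbhs_subspace_out nAx)).
Qed.

Lemma usc_on_continuous (T : topologicalType) (R : realType) (A : set T) (f : T -> R) :
  (forall x, A x -> {for x, continuous f}) -> usc_on A (EFin \o f).
Proof.
move=> cf; apply/usc_onP => x Ax; split; first exact: ltry.
move=> c fc; have N : nbhs (f x) [set y | y < c] by apply: lt_nbhsl; rewrite -lte_fin.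
have : nbhs x (f @^-1` [set y | y < c]) := cf x Ax _ N.
by apply: filterS => y yc _; rewrite lte_fin.
Qed.

Section CircleAverage.
Context {R : realType} {n : nat}.
Implicit Types (p b : Cn R n) (F v : Cn R n -> R) (U : set (Cn R n)).

Definition circle p b t : Cn R n := p + cis t *: b.
Definition cavg F p b : R := mean (fun t => F (circle p b t)).

Lemma continuous_scale (X : topologicalType) (f : X -> cplx R) (g : X -> Cn R n) :
  continuous f -> continuous g -> continuous (fun x => f x *: g x).
Proof. by move=> cf cg x; apply: cvgZ; [exact: cf|exact: cg]. Qed.

Lemma continuous_plus (X : topologicalType) (f g : X -> Cn R n) :
  continuous f -> continuous g -> continuous (fun x => f x + g x).
Proof. by move=> cf cg x; apply: cvgD; [exact: cf|exact: cg]. Qed.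

Lemma continuous_circle p b : continuous (circle p b).
Proof.
apply: continuous_plus; first exact: cst_continuous.
by apply: continuous_scale; [exact: continuous_cis|exact: cst_continuous].
Qed.

(** The disc of centre p and radius vector b: scaling b replaces both a radius
    and a complex line. *)
Definition disc_in p b U := forall a : cplx R, modc a <= 1 -> U (p + a *: b).

Lemma disc_in_circle p b U t : disc_in p b U -> U (circle p b t).
Proof. by apply; rewrite modc_cis. Qed.

Lemma disc_in_center p b U : disc_in p b U -> U p.
Proof.
by move=> /(_ 0); rewrite scale0r addr0; apply; rewrite -[0]rl0 modc_rl normr0.
Qed.

Definition submean_on U v := forall p b, disc_in p b U -> v p <= cavg v p b.

Lemma circle_comp_cont F p b : (forall t, {for circle p b t, continuous F}) ->
  continuous (fun t => F (circle p b t)).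
Proof.
by move=> cF t; apply: (continuous_comp (@continuous_circle p b t)); exact: cF.
Qed.

(** A closed disc in a complex line of C^n is the set of p + a b with |a| <= 1
    for a centre p and a radius vector b, and for a continuous function the
    circle mean is a real number. *)
Lemma psh_cont_submean U v : (forall z, U z -> {for z, continuous v}) ->
  psh U (EFin \o v) <-> submean_on U v.
Proof.
move=> cv; split=> [[_ h] p b pb|h].
  have [_ hs] := h p b.
  have E t : v (p + (0 + cplx_of_real 1 * cis t) *: b) = v (circle p b t).
    by rewrite /circle add0r rl1 mul1r.
  have := hs 0 1 ltr01; rewrite circle_meanE; last first.
    under eq_fun do rewrite E.
    by apply: circle_comp_cont => t; apply: cv; exact: disc_in_circle.
  rewrite (funext E) -/(cavg v p b).
  rewrite /= scale0r addr0 lee_fin; apply=> w /=.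
  by rewrite subr0 modcE rl_le => /pb.
split; first exact: usc_on_continuous.
move=> a b; split.
  apply: usc_on_continuous => w Uw.
  apply: (@continuous_comp _ _ _ (fun w : cplx R => a + w *: b) v); last exact: cv.
  apply: continuous_plus; first exact: cst_continuous.
  by apply: continuous_scale; [move=> ?; exact: cvg_id|exact: cst_continuous].
move=> c r r0 hD.
have E t : v (a + (c + cplx_of_real r * cis t) *: b) =
    v (circle (a + c *: b) (cplx_of_real r *: b) t).
  by rewrite /circle scalerDl addrA scalerA [cis t * _]mulrC.
have d : disc_in (a + c *: b) (cplx_of_real r *: b) U.
  move=> w w1; rewrite scalerA -addrA -scalerDl; apply: hD => /=.
  rewrite addrAC subrr add0r modcE rl_le modcM modc_rl gtr0_norm //.
  by rewrite ler_piMl // ltW.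
have ct : continuous (fun t => v (a + (c + cplx_of_real r * cis t) *: b)).
  under eq_fun do rewrite E.
  by apply: circle_comp_cont => t; apply: cv; exact: disc_in_circle.
rewrite circle_meanE // lee_fin; apply: le_trans (h _ _ d) _.
by rewrite /cavg; under eq_fun do rewrite -E.
Qed.

(** Comparing u with a continuous majorant F on the circle avoids the mean of
    u itself, which may be -oo. *)
Lemma psh_le_cavg U (u : Cn R n -> \bar R) F p b : psh U u -> disc_in p b U ->
  continuous F -> (forall t, (u (circle p b t) <= (F (circle p b t))%:E)%E) ->
  (u p <= (cavg F p b)%:E)%E.
Proof.
move=> [/usc_onP usc h] pb cF uF.
have [_ hs] := h p b.
have E t : p + (0 + cplx_of_real 1 * cis t) *: b = circle p b t.
  by rewrite /circle add0r rl1 mul1r.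
have E0 : p + (0 : cplx R) *: b = p by rewrite scale0r addr0.
have := hs 0 1 ltr01; rewrite E0 => /(_ _) H.
have {}H : (u p <= circle_mean (fun w : cplx R => u (p + w *: b)%R) 0 1)%E.
  by apply: H => w /=; rewrite subr0 modcE rl_le => /pb.
apply: le_trans H _.
have ct : continuous (fun t => F (circle p b t)) by apply: circle_comp_cont => t; exact: cF.
have -> : (cavg F p b)%:E = circle_mean (EFin \o (fun w : cplx R => F (p + w *: b))) 0 1.
  have E' t : F (p + (0 + cplx_of_real 1 * cis t) *: b) = F (circle p b t) by rewrite E.
  by rewrite circle_meanE (funext E').
apply: lee_wpmul2l; first by rewrite lee_fin invr_ge0 ltW // tau_gt0.
under eq_integral do rewrite E; under [in leRHS]eq_integral do rewrite /= E.
have mu1 : measurable_fun setT (fun t => u (circle p b t)).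
  rewrite (_ : (fun t => _) = (fun t => - - u (circle p b t))%E); last first.
    by apply/funext => t; rewrite oppeK.
  apply: (measurableT_comp (@oppe_measurable R setT)) => //.
  suff lsc : lower_semicontinuous (fun t : R => (- u (circle p b t))%E).
    exact: lower_semicontinuous_measurable.
  move=> t a ua0.
  have ua : (u (circle p b t) < (- a)%:E)%E by move: ua0; rewrite -lteN2 oppeK.
  have Uc s : U (circle p b s) by exact: disc_in_circle.
  have nu := (usc _ (Uc t)).2 _ ua.
  exists [set s | (u (circle p b s) < (- a)%:E)%E].
    have N : nbhs t (circle p b @^-1` [set y | U y -> (u y < (- a)%:E)%E]).
      exact: (@continuous_circle p b t _ nu).
    by apply: filterS N => s; apply.
  by move=> s /= us; rewrite -lteN2 oppeK.
have mF : measurable_fun setT (fun t => (F (circle p b t))%:E).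
  by apply/measurable_EFinP; exact: continuous_measurable_fun.
rewrite integralE [leRHS]integralE; apply: leeB.
  apply: ge0_le_integral => //.
  - by apply: measurable_funepos; exact: measurable_funTS.
  - by apply: measurable_funepos; exact: measurable_funTS.
  - move=> t _; apply: (@funepos_le _ _ setT) => //; rewrite ?inE //.
apply: ge0_le_integral => //.
- by apply: measurable_funeneg; exact: measurable_funTS.
- by apply: measurable_funeneg; exact: measurable_funTS.
- move=> t _; apply: (@funeneg_le _ _ setT) => //; rewrite ?inE //.
Qed.

Lemma cavg_continuous F b : continuous F -> continuous (cavg F ^~ b).
Proof.
move=> cF; apply: (@mean_continuous R _ (fun p t => F (circle p b t))).
apply: (@continuous_comp' _ _ _ F (fun x : Cn R n * R => circle x.1 b x.2)) => //.
apply: continuous_plus; first by move=> ?; exact: cvg_fst.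
apply: continuous_scale; last exact: cst_continuous.
by apply: (@continuous_comp' _ _ _ (@cis R) snd); [move=> ?; exact: cvg_snd|exact: continuous_cis].
Qed.

End CircleAverage.

(** * From the local to the global submean inequality *)

Section LocalGlobal.
Context {R : realType} {n : nat}.
Implicit Types (p b : Cn R n) (F v w : Cn R n -> R) (U V : set (Cn R n)).
Local Notation rl := (@cplx_of_real R).

Lemma mean_cos : mean (@cos R) = 0.
Proof.
have h := mean_shift_periodic pi (@continuous_cos R) (fun t => _).
have {h} := h _; rewrite (_ : (fun t => cos (t + pi)) = fun t => -1 * cos t); last first.
  by apply/funext => t; rewrite cosDpi mulN1r.
rewrite meanZ; last exact: continuous_cos.
move=> /(_ (fun t => _)) h; have : -1 * mean (@cos R) = mean (@cos R).
  by apply: h => t; rewrite mulrC mulr_natr cosD2pi.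
lra.
Qed.

Lemma modc_sum (r s t : R) : modc (rl r + rl s * cis t) ^+ 2 = r ^+ 2 + s ^+ 2 + 2 * r * s * cos t.
Proof.
rewrite modc_sqr (_ : complex.Re _ = r + s * cos t); last by rewrite /=; ring.
rewrite (_ : complex.Im _ = s * sin t); last by rewrite /=; ring.
transitivity (r ^+ 2 + s ^+ 2 * (cos t ^+ 2 + sin t ^+ 2) + 2 * r * s * cos t); first by ring.
by rewrite cos2Dsin2 mulr1.
Qed.

(** Averaging w over the rotations of the disc gives a function of |a| only,
    say h(|a|), with h 0 = w p and h 1 the circle average. If h 0 > h 1, then
    k r = h r + e r^2 has, for small e, a maximum over [0, 1] at some r < 1.
    The local inequality on circles of radius s centred at the points of
    modulus r, averaged over rotations, bounds h r by the mean of h over |r +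
    s cis x|; as k is maximal at r, this mean is at most k r - e (r^2 + s^2),
    so that h r <= h r - e s^2. *)
Lemma local_submean w V (d : R) : 0 < d -> continuous w ->
  (forall p b, V p -> nrm b <= d -> w p <= cavg w p b) -> submean_on V w.
Proof.
move=> d0 cw loc p b pb.
have [g gE] : exists g : cplx R -> R,
  forall a, g a = mean (fun t => w (p + (cis t * a) *: b)) by eexists.
have [h hE] : exists h : R -> R, forall r, h r = g (rl r) by eexists.
have gh a : g a = h (modc a).
  have [t {1}->] := polar a; rewrite hE !gE.
  pose H s := w (p + (cis s * rl (modc a)) *: b).
  have cH : continuous H.
    apply: (continuous_comp' _ cw); apply: continuous_plus; first exact: cst_continuous.
    apply: continuous_scale; last exact: cst_continuous.
    by move=> s; apply: cvgM; [exact: continuous_cis|exact: cvg_cst].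
  have pH s : H (s + 2 * pi) = H s by rewrite /H cisD cis2pi mulr1.
  transitivity (mean (fun s => H (s + t))); last exact: mean_shift_periodic.
  apply: mean_ext => s _.
  by rewrite /H cisD -!mulrA [cis t * _]mulrC.
have ch : continuous h.
  rewrite (_ : h = fun r => mean (fun t => w (p + (cis t * rl r) *: b))); last first.
    by apply/funext => r; rewrite hE gE.
  apply: (@mean_continuous R _ (fun r t => w (p + (cis t * rl r) *: b))).
  apply: (continuous_comp' _ cw); apply: continuous_plus; first exact: cst_continuous.
  apply: continuous_scale; last exact: cst_continuous.
  move=> x; apply: cvgM.
    by apply: (continuous_comp (f := snd)); [exact: cvg_snd|exact: continuous_cis].
  by apply: (continuous_comp (f := fst)); [exact: cvg_fst|exact: continuous_rl].
have h0 : h 0 = w p.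
  rewrite hE gE rl0 -[RHS]mean_cst; apply: mean_ext => t _.
  by rewrite mulr0 scale0r addr0.
have h1 : h 1 = cavg w p b.
  by rewrite hE gE /cavg rl1; apply: mean_ext => t _; rewrite mulr1.
rewrite -h0 -h1; apply/ler_addgt0Pr => e e0.
(* The quadratic term turns the averaged inequality at a maximum into a strict
   one. *)
pose k r := h r + e * r ^+ 2.
have ck : continuous k.
  move=> r; apply: cvgD; first exact: ch.
  by apply: cvgM; [exact: cvg_cst|apply: exprn_continuous].
have [r] := @EVT_max R k 0 1 ler01 (continuous_subspaceT ck).
rewrite in_itv /= => /andP[r0]; rewrite le_eqVlt => /predU1P[-> kmax|r1 kmax].
  have := kmax 0; rewrite in_itv /= lexx ler01 => /(_ isT).
  by rewrite /k expr0n mulr0 addr0 expr1n mulr1.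
exfalso.
(* The circle of radius s about a point of modulus r stays in the unit disc
   and is short enough for the local inequality. *)
pose s := Num.min (1 - r) (d / (nrm b + 1)).
have b1 : 0 < nrm b + 1 by rewrite ltr_wpDl ?nrm_ge0.
have s0 : 0 < s by rewrite lt_min subr_gt0 r1 divr_gt0.
have sr : s <= 1 - r by rewrite ge_min lexx.
have sd : s * nrm b <= d.
  have : s <= d / (nrm b + 1) by rewrite ge_min lexx orbT.
  by rewrite ler_pdivlMr // mulrDr mulr1; apply: le_trans; rewrite lerDl ltW.
pose lam t := rl r + rl s * cis t.
have clam : continuous lam.
  move=> t; apply: cvgD; first exact: cvg_cst.
  by apply: cvgM; [exact: cvg_cst|exact: continuous_cis].
pose H t x := w (p + (cis t * lam x) *: b).
have cH : continuous (fun q : R * R => H q.1 q.2).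
  apply: (continuous_comp' _ cw); apply: continuous_plus; first exact: cst_continuous.
  apply: continuous_scale; last exact: cst_continuous.
  move=> x; apply: cvgM.
    by apply: (continuous_comp (f := fst)); [exact: cvg_fst|exact: continuous_cis].
  by apply: (continuous_comp (f := snd)); [exact: cvg_snd|exact: clam].
have step : h r <= mean (fun t => mean (H t)).
  rewrite hE gE.
  apply: mean_le.
  - apply: (continuous_comp' _ cw); apply: continuous_plus; first exact: cst_continuous.
    apply: continuous_scale; last exact: cst_continuous.
    by move=> t; apply: cvgM; [exact: continuous_cis|exact: cvg_cst].
  - exact: mean_continuous cH.
  move=> t _; set q := p + _.
  have Vq : V q by apply: pb; rewrite modcM modc_cis mul1r modc_rl ger0_norm // ltW.
  apply: le_trans (loc q ((rl s * cis t) *: b) Vq _) _.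
    by rewrite nrmZ modcM modc_cis mulr1 modc_rl gtr0_norm.
  rewrite /cavg /H le_eqVlt; apply/orP; left; apply/eqP; apply: mean_ext => x _.
  rewrite /circle /q /lam -addrA scalerA -scalerDl; congr (w (p + _ *: b)); ring.
rewrite mean_swap // in step.
have step2 : mean (fun x => mean (H ^~ x)) <=
    mean (fun x => (k r - e * (r ^+ 2 + s ^+ 2)) - e * (2 * r * s) * cos x).
  have cmean : continuous (fun x => mean (H ^~ x)).
    apply: (@mean_continuous R _ (fun x t => H t x)).
    apply: (@continuous_comp' _ _ _ (fun q : R * R => H q.1 q.2) (fun q => (q.2, q.1))) cH.
    by apply: continuous_pair => ?; [exact: cvg_snd|exact: cvg_fst].
  apply: mean_le => //.
    move=> x; apply: cvgB; first exact: cvg_cst.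
    by apply: cvgM; [exact: cvg_cst|exact: continuous_cos].
  move=> x _; 
  have Eg : mean (H ^~ x) = g (lam x) by rewrite (gE (lam x)); reflexivity.
  rewrite Eg gh {Eg}.
  have m1 : modc (lam x) <= 1.
    apply: le_trans (modcD _ _) _; rewrite modcM modc_cis mulr1 !modc_rl.
    by rewrite ger0_norm // gtr0_norm //; lra.
  have := kmax (modc (lam x)); rewrite in_itv /= modc_ge0 m1 => /(_ isT).
  by rewrite {1}/k modc_sum; lra.
have := le_trans step step2; rewrite meanB; first last.
- by move=> x; apply: cvgM; [exact: cvg_cst|exact: continuous_cos].
- exact: cst_continuous.
rewrite mean_cst meanZ; last exact: continuous_cos.
rewrite mean_cos mulr0 subr0 /k.
have : 0 < e * s ^+ 2 by rewrite mulr_gt0 // exprn_gt0.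
lra.
Qed.

End LocalGlobal.

(** * Compactness and continuous majorants *)

(** The limit of the F i need not be continuous: it is enough that the
    decreasing sequence gets strictly below a continuous function at every
    point. *)
Lemma dini (T : topologicalType) (R : realType) (B : set T) (F : nat -> T -> R) (G : T -> R) :
  compact B -> (forall i, continuous (F i)) -> continuous G ->
  (forall i z, F i.+1 z <= F i z) -> (forall z, B z -> exists i, F i z < G z) ->
  exists i, forall z, B z -> F i z < G z.
Proof.
move=> /compact_near_coveringP cB cF cG dF h.
have mono i j z : (i <= j)%N -> F j z <= F i z.
  by elim: j => [|j IH]; [rewrite leqn0 => /eqP->|rewrite leq_eqVlt => /predU1P[->//|/IH]; exact: le_trans].
have : \forall i \near \oo, B `<=` (fun z => F i z < G z).
  apply: cB => z Bz; have [i hi] := h z Bz.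
  have N : \forall y \near z, F i y < G y.
    have c : {for z, continuous (fun y => G y - F i y)} by apply: cvgB; [exact: cG|exact: cF].
    have : nbhs z ((fun y => G y - F i y) @^-1` [set x | 0 < x]).
      by apply: c; apply: lt_nbhsr; rewrite subr_gt0.
    by apply: filterS => y /=; rewrite subr_gt0.
  exists ([set y | F i y < G y], [set j | (i <= j)%N]).
    by split => //; exists i.
  by move=> [y j] /= [hy ij]; apply: le_lt_trans hy; exact: mono.
by move=> [i _ hi]; exists i; apply: hi => /=.
Qed.

Lemma lt_between (R : realType) (x : \bar R) (c : R) : (x < c%:E)%E -> exists2 a : R, (x < a%:E)%E & a < c.
Proof.
case: x => [r||] //; last by exists (c - 1); rewrite ?ltNyr //; lra.
by rewrite lte_fin => rc; exists ((r + c) / 2); rewrite ?lte_fin; lra.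
Qed.

Section Neighborhoods.
Context {R : realType} {n : nat}.
Implicit Types (p z b : Cn R n) (K U : set (Cn R n)).

Definition thicken K (r : R) : set (Cn R n) := [set z | exists2 x, K x & nrm (z - x) <= r].

Lemma compact_thicken K U : compact K -> open U -> K `<=` U ->
  exists2 r : R, 0 < r & thicken K r `<=` U.
Proof.
move=> /compact_near_coveringP cK oU KU.
have : \forall r \near (0 : R)^'+, K `<=` (fun x => forall z, nrm (z - x) <= r -> U z).
  apply: cK => x Kx; have [e e0 he] := open_nrm oU (KU x Kx).
  have e2 : 0 < e / 2 by rewrite divr_gt0.
  exists ([set y | nrm (y - x) < e / 2], [set r | r < e / 2]).
    split; last by apply: nbhs_right_lt.
    by apply/nbhs_nrm; exists (e / 2).
  move=> [y r] /= [hy hr] z hz; apply: he.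
  by apply: le_lt_trans (nrm_tri _ _ y) _; rewrite (splitr e) ltrD // (le_lt_trans hz).
move=> H; have [r [r0 hr]] : exists r : R, 0 < r /\ (K `<=` (fun x => forall z, nrm (z - x) <= r -> U z)).
  apply: (@filter_ex _ ((0:R)^'+)); near=> r; split; near: r; last exact: H.
  exact: nbhs_right_gt.
by exists r => // z [x Kx hz]; exact: (hr x Kx).
Unshelve. all: by end_near.
Qed.

Lemma continuous_nrmB p : continuous (fun z : Cn R n => nrm (z - p)).
Proof.
move=> z; apply/cvg_nrmP => e e0; exists e => // w; apply: le_lt_trans.
have := nrm_tri w p z; have := nrm_tri z p w; rewrite (nrmB z w) ler_norml; lra.
Qed.

Lemma compact_closed_ball p (r : R) : compact [set z : Cn R n | nrm (z - p) <= r].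
Proof.
apply: (@Cn_compact _ _ _ (nrm p + r)) => [z /= hz|].
  by rewrite -[z](subrK p) addrC; apply: le_trans (nrmD _ _) _; rewrite lerD2l.
have -> : [set z : Cn R n | nrm (z - p) <= r] = (fun z : Cn R n => nrm (z - p)) @^-1` [set x | x <= r] by [].
apply: closed_comp; last exact: closed_le.
by move=> z _; exact: continuous_nrmB.
Qed.

Lemma thicken_compact K (r : R) : compact K -> compact (thicken K r).
Proof.
move=> cK.
have -> : thicken K r = (fun q : Cn R n * Cn R n => q.1 + q.2) @` (K `*` [set z : Cn R n | nrm (z - 0) <= r]).
  apply/seteqP; split=> [z [x Kx hz]|_ [[x y] [/= Kx hy] <-]].
    by exists (x, z - x); [split=> //=; rewrite subr0|rewrite /= addrC subrK].
  by exists x => //; rewrite addrAC subrr add0r -[y]subr0.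
apply: continuous_compact; last by apply: compact_setX => //; exact: compact_closed_ball.
apply: continuous_subspaceT; apply: continuous_plus => ?; [exact: cvg_fst|exact: cvg_snd].
Qed.

Lemma compact_fun_bounded (K : set (Cn R n)) (F : Cn R n -> R) : compact K ->
  {within K, continuous F} -> exists2 M : R, 0 < M & forall z, K z -> `|F z| <= M.
Proof.
move=> cK cF; have [M [_ hM]] := compact_bounded (continuous_compact cF cK).
exists (`|M| + 1); first by rewrite ltr_wpDl.
by move=> z Kz; apply: (hM (`|M| + 1)); [rewrite ltr_pwDr // ler_norm|exists z].
Qed.

(** Cut u off at - j and take the sup-convolution with the cone j |x - y|: it
    is j-Lipschitz, decreases in j and, at z, only sees values of u near z as
    j grows. Adding 1 / (j + 1) makes the inequality with u strict. *)
Lemma usc_approx K (u : Cn R n -> \bar R) : compact K -> usc_on K u ->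
  exists G : nat -> Cn R n -> R,
   [/\ forall j, continuous (G j), forall j z, G j.+1 z <= G j z,
       forall j z, K z -> (u z < (G j z)%:E)%E &
       forall z (c : R), K z -> (u z < c%:E)%E -> exists j, G j z < c].
Proof.
move=> cK /usc_onP usc.
have [[x0 Kx0]|nK] := pselect (exists x, K x); last first.
  exists (fun _ => cst 0); split => //; first by move=> j; exact: cst_continuous.
    by move=> j z Kz; exfalso; apply: nK; exists z.
  by move=> z c Kz; exfalso; apply: nK; exists z.
have [M hM] : exists M : nat, forall z, K z -> (u z < M%:R%:E)%E.
  move/compact_near_coveringP: (cK) => cov.
  have : \forall i \near \oo, K `<=` (fun z => K z -> (u z < i%:R%:E)%E).
    apply: cov => x Kx; have [ux hx] := usc x Kx.
    have [m hm] : exists m : nat, (u x < m%:R%:E)%E.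
      move: ux; case: (u x) => [r _||] //; last by exists 0%N; exact: ltNyr.
      have := archi_boundP (normr_ge0 r); set m := Num.bound _ => hm.
      by exists m; rewrite lte_fin; apply: le_lt_trans hm; exact: ler_norm.
    exists ([set y | K y -> (u y < m%:R%:E)%E], [set j | (m <= j)%N]).
      by split; [exact: hx|exists m].
    move=> [y j] /= [hy mj] /hy h; apply: lt_le_trans h _.
    by rewrite lee_fin ler_nat.
  by move=> [i _ hi]; exists i => z Kz; exact: (hi i (leqnn _) z Kz Kz).
pose f (j : nat) x : R := fine (maxe (u x) (- j%:R)%:E).
have fE j x : K x -> (f j x)%:E = maxe (u x) (- j%:R)%:E.
  move=> Kx; rewrite /f fineK // fin_numE; have := hM x Kx.
  by case: (u x) => [r _||] //; rewrite ?maxNye // -EFin_max.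
have fu j x : K x -> (u x <= (f j x)%:E)%E by move=> Kx; rewrite fE // le_max lexx.
have fM j x : K x -> f j x <= M%:R.
  move=> Kx; rewrite -lee_fin fE // ge_max ltW ?hM //= lee_fin.
  by apply: (@le_trans _ _ 0); rewrite ?oppr_le0.
have fd j x : K x -> f j.+1 x <= f j x.
  move=> Kx; rewrite -lee_fin !fE // ge_max !le_max lexx /= lee_fin lerN2 ler_nat.
  by rewrite leqnSn orbT.
pose A (j : nat) (y : Cn R n) := [set f j x - j%:R * nrm (x - y) | x in K].
have hA j (y : Cn R n) : has_sup (A j y).
  split; first by exists (f j x0 - j%:R * nrm (x0 - y)); exists x0.
  exists M%:R => _ [x Kx <-]; apply: le_trans (fM j x Kx).
  by rewrite gerBl mulr_ge0 ?nrm_ge0.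
pose S j (y : Cn R n) : R := sup (A j y).
have Sub j (y x : Cn R n) : K x -> f j x - j%:R * nrm (x - y) <= S j y.
  by move=> Kx; apply: (sup_upper_bound (hA j y)); exists x.
have Slub j (y : Cn R n) (c : R) : (forall x, K x -> f j x - j%:R * nrm (x - y) <= c) -> S j y <= c.
  move=> h; apply: ge_sup; first by case: (hA j y).
  by move=> _ [x Kx <-]; exact: h.
have Slip j (y y' : Cn R n) : S j y' <= S j y + j%:R * nrm (y - y').
  apply: Slub => x Kx; have := Sub j y x Kx.
  have := ler_wpM2l (ler0n R j) (nrm_tri x y y').
  rewrite mulrDr; have := ler_wpM2l (ler0n R j) (nrm_tri x y y').
  have := ler_wpM2l (ler0n R j) (nrm_tri x y' y); rewrite !mulrDr (nrmB y' y).
  lra.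
exists (fun j (y : Cn R n) => S j y + j.+1%:R^-1); split.
- move=> j y; apply/cvg_nrmP => e e0; exists (e / (j%:R + 1)).
    by rewrite divr_gt0 // ltr_wpDl.
  move=> w hw; have : (j%:R + 1) * nrm (w - y) < e.
    by rewrite mulrC -ltr_pdivlMr // ltr_wpDl.
  rewrite mulrDl mul1r => he; have := nrm_ge0 (w - y).
  have := Slip j y w; have := Slip j w y; rewrite (nrmB y w).
  move: (S j w) (S j y) (nrm (w - y)) (j.+1%:R^-1) he => a c t q.
  rewrite opprD addrACA subrr addr0; move: (j%:R * t) => jt.
  by rewrite ltr_norml => *; lra.
- move=> j z; apply: lerD.
    apply: Slub => x Kx; apply: le_trans (Sub j z x Kx).
    apply: lerB; first exact: fd.
    by apply: ler_wpM2r; [exact: nrm_ge0|rewrite ler_nat].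
  by rewrite lef_pV2 ?posrE // ler_nat.
- move=> j z Kz; apply: le_lt_trans (fu j z Kz) _; rewrite lte_fin.
  have := Sub j z z Kz; rewrite subrr nrm0 mulr0 subr0 => h.
  by apply: le_lt_trans h _; rewrite ltrDl invr_gt0.
- move=> z c Kz uc.
  have [c' uc' cc'] := lt_between uc.
  have /nbhs_nrm [r r0 hr] := (usc z Kz).2 _ uc'.
  pose B := `|c'| + `|(M%:R - c') / r| + (c - c')^-1.
  have [j hj] : exists j : nat, B < j%:R.
    have := archi_boundP (normr_ge0 B); set j := Num.bound _ => h.
    by exists j; apply: le_lt_trans h; exact: ler_norm.
  have i0 : 0 < (c - c')^-1 by rewrite invr_gt0; lra.
  have b1 := normr_ge0 c'; have b2 := normr_ge0 ((M%:R - c') / r).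
  have b3 := ler_norm (- c'); rewrite normrN in b3.
  have b4 := ler_norm ((M%:R - c') / r).
  have j1 : - j%:R <= c' by move: hj; rewrite /B; lra.
  have j2 : M%:R - c' <= j%:R * r by rewrite -ler_pdivrMr //; move: hj; rewrite /B; lra.
  have j3 : j.+1%:R^-1 < c - c'.
    rewrite invf_plt ?posrE ?subr_gt0 // -natr1; move: hj; rewrite /B; lra.
  exists j; suff Sc : S j z <= c'.
    by have := ler_ltD Sc j3; rewrite addrCA subrr addr0.
  apply: Slub => x Kx; have [xr|xr] := ltP (nrm (x - z)) r.
    have fc : f j x <= c'.
      by rewrite -lee_fin fE // ge_max lee_fin j1 andbT; apply: ltW; exact: hr.
    by apply: le_trans fc; rewrite gerBl mulr_ge0 ?nrm_ge0.
  have := fM j x Kx; have := ler_wpM2l (ler0n R j) xr; lra.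
Qed.
End Neighborhoods.

(** * Averaging operators *)

Section Averaging.
Context {R : realType} {n : nat}.
Implicit Types (p z b v : Cn R n) (F G : Cn R n -> R).
Local Notation rl := (@cplx_of_real R).

(** The properties of integration against a probability measure on D that the
    constructions below use. They are stated for functionals, so that iterated
    means can play the role of product measures: the last two fields are
    continuity under the integral sign and the exchange with a mean. *)
Record avg_functional (P : topologicalType) (D : set P) (L : (P -> R) -> R) : Prop := {
  avgf_cst : forall c, L (fun=> c) = c ;
  avgf_le : forall h g, continuous h -> continuous g -> (forall q, D q -> h q <= g q) -> L h <= L g ;
  avgf_addc : forall h c, continuous h -> L (fun q => h q + c) = L h + c ;
  avgf_param : forall (X : topologicalType) (H : X -> P -> R),
     continuous (fun x : X * P => H x.1 x.2) -> continuous (fun x => L (H x)) ;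
  avgf_swap : forall H : R -> P -> R, continuous (fun x : R * P => H x.1 x.2) ->
     mean (fun t => L (H t)) = L (fun q => mean (fun t => H t q)) }.

Lemma continuous_slice1 (X Y Z : topologicalType) (H : X -> Y -> Z) x :
  continuous (fun q : X * Y => H q.1 q.2) -> continuous (H x).
Proof.
move=> cH; apply: (@continuous_comp' _ _ _ (fun q : X * Y => H q.1 q.2) (fun y => (x, y))) cH.
by apply: continuous_pair; [exact: cst_continuous|move=> ?; exact: cvg_id].
Qed.
Lemma continuous_slice2 (X Y Z : topologicalType) (H : X -> Y -> Z) y :
  continuous (fun q : X * Y => H q.1 q.2) -> continuous (H ^~ y).
Proof.
move=> cH; apply: (@continuous_comp' _ _ _ (fun q : X * Y => H q.1 q.2) (fun x => (x, y))) cH.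
by apply: continuous_pair; [move=> ?; exact: cvg_id|exact: cst_continuous].
Qed.

Lemma avg_mean (chi : R -> R) : continuous chi -> (forall t, 0 <= chi t) -> mean chi = 1 ->
  avg_functional [set t | 0 <= t <= 2 * pi] (fun h => mean (fun t => h t * chi t)).
Proof.
move=> cc c0 m1.
have cm (h : R -> R) : continuous h -> continuous (fun t => h t * chi t).
  by move=> ch t; apply: cvgM; [exact: ch|exact: cc].
split.
- by move=> c; rewrite meanZ // m1 mulr1.
- move=> h g ch cg hg; apply: mean_le; [exact: cm|exact: cm|].
  by move=> t ht; rewrite ler_wpM2r //; exact: hg.
- move=> h c ch; under eq_fun do rewrite mulrDl.
  rewrite meanD; [|exact: cm|by apply: cm; exact: cst_continuous].
  by rewrite meanZ // m1 mulr1.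
- move=> X H cH; apply: (@mean_continuous _ _ (fun x t => H x t * chi t)).
  move=> q; apply: cvgM; first exact: cH.
  by apply: (continuous_comp (f := snd)); [exact: cvg_snd|exact: cc].
- move=> H cH; rewrite mean_swap; last first.
    move=> q; apply: cvgM; first exact: cH.
    by apply: (continuous_comp (f := snd)); [exact: cvg_snd|exact: cc].
  apply: mean_ext => t _; rewrite mulrC -meanZ; last exact: continuous_slice2.
  by apply: mean_ext => s _; rewrite mulrC.
Qed.

Lemma avg_prod (P Q : topologicalType) (D : set P) (E : set Q) L M :
  avg_functional D L -> avg_functional E M ->
  avg_functional (D `*` E) (fun h : P * Q -> R => L (fun x => M (fun y => h (x, y)))).
Proof.
move=> aL aM.
have ch2 (h : P * Q -> R) : continuous h -> continuous (fun q : P * Q => h (q.1, q.2)).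
  by move=> ch; rewrite (_ : (fun q => _) = h) //; apply/funext => -[].
have cM (h : P * Q -> R) : continuous h -> continuous (fun x => M (fun y => h (x, y))).
  by move=> ch; apply: (avgf_param aM (H := fun x y => h (x, y))); exact: ch2.
have cs (h : P * Q -> R) x : continuous h -> continuous (fun y => h (x, y)).
  by move=> ch; apply: (@continuous_slice1 _ _ _ (fun x y => h (x, y)) x); exact: ch2.
split.
- by move=> c; rewrite (avgf_cst aM) (avgf_cst aL).
- move=> h g ch cg hg; apply: (avgf_le aL); [exact: cM|exact: cM|] => x Dx.
  by apply: (avgf_le aM); [exact: cs|exact: cs|] => y Ey; exact: hg.
- move=> h c ch; rewrite -(avgf_addc aL); last exact: cM.
  by congr L; apply/funext => x; rewrite (avgf_addc aM) //; exact: cs.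
- move=> X H cH; refine (@avgf_param P D L aL X (fun w x => M (fun y => H w (x, y))) _).
  refine (@avgf_param Q E M aM (X * P)%type (fun (zx : X * P) y => H zx.1 (zx.2, y)) _).
  apply: (@continuous_comp' _ _ _ (fun x : X * (P * Q) => H x.1 x.2)
    (fun q : X * P * Q => (q.1.1, (q.1.2, q.2)))) cH.
  apply: continuous_pair.
    by apply: (@continuous_comp' _ _ _ fst fst) => ?; exact: cvg_fst.
  apply: continuous_pair; last by move=> ?; exact: cvg_snd.
  by apply: (@continuous_comp' _ _ _ snd fst) => ?; [exact: cvg_fst|exact: cvg_snd].
- move=> H cH.
  have cH1 : continuous (fun zx : R * P * Q => H zx.1.1 (zx.1.2, zx.2)).
    apply: (@continuous_comp' _ _ _ (fun x : R * (P * Q) => H x.1 x.2)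
      (fun q : R * P * Q => (q.1.1, (q.1.2, q.2)))) cH.
    apply: continuous_pair.
      by apply: (@continuous_comp' _ _ _ fst fst) => ?; exact: cvg_fst.
    apply: continuous_pair; last by move=> ?; exact: cvg_snd.
    by apply: (@continuous_comp' _ _ _ snd fst) => ?; [exact: cvg_fst|exact: cvg_snd].
  rewrite (avgf_swap aL (H := fun t x => M (fun y => H t (x, y)))); last first.
    exact: (@avgf_param Q E M aM (R * P)%type (fun (zx : R * P) y => H zx.1 (zx.2, y))).
  congr L; apply/funext => x; rewrite (avgf_swap aM (H := fun t y => H t (x, y))) //.
  apply: (@continuous_comp' _ _ _ (fun zx : R * P * Q => H zx.1.1 (zx.1.2, zx.2))
      (fun q : R * Q => (q.1, x, q.2))) cH1.
  apply: continuous_pair; last by move=> ?; exact: cvg_snd.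
  by apply: continuous_pair; [move=> ?; exact: cvg_fst|exact: cst_continuous].
Qed.

(** Operators that average the translates of F by vectors of norm at most r.
    They commute with circle averages (the last field), which together with
    monotonicity is why they preserve submean inequalities. *)
Record averaging (r : R) (A : (Cn R n -> R) -> Cn R n -> R) : Prop := {
  avg_cont : forall F, continuous F -> continuous (A F) ;
  avg_le : forall F G z, continuous F -> continuous G ->
     (forall y, nrm (y - z) <= r -> F y <= G y) -> A F z <= A G z ;
  avg_cst : forall c z, A (fun=> c) z = c ;
  avg_addc : forall F c z, continuous F -> A (fun y => F y + c) z = A F z + c ;
  avg_shift : forall F v z, A (fun y => F (y + v)) z = A F (z + v) ;
  avg_cavg : forall F p b, continuous F -> cavg (A F) p b = A (cavg F ^~ b) p }.

Lemma continuous_shift F v : continuous F -> continuous (fun y : Cn R n => F (y + v)).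
Proof.
move=> cF; apply: (@continuous_comp' _ _ _ F (fun y : Cn R n => y + v)) cF.
by apply: (@continuous_plus R n _ id (fun=> v)); [move=> ?; exact: cvg_id|exact: cst_continuous].
Qed.

Lemma avg_translations (P : topologicalType) (D : set P) L (g : P -> Cn R n) r :
  avg_functional D L -> continuous g -> (forall q, D q -> nrm (g q) <= r) ->
  averaging r (fun F z => L (fun q => F (z + g q))).
Proof.
move=> aL cg gr.
have cFg F : continuous F -> continuous (fun x : Cn R n * P => F (x.1 + g x.2)).
  move=> cF; apply: (@continuous_comp' _ _ _ F (fun x : Cn R n * P => x.1 + g x.2)) cF.
  apply: continuous_plus; first by move=> ?; exact: cvg_fst.
  by apply: (@continuous_comp' _ _ _ g snd) cg => ?; exact: cvg_snd.
have cFz F z : continuous F -> continuous (fun q => F (z + g q)).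
  by move=> /cFg; exact: (@continuous_slice1 _ _ _ (fun z q => F (z + g q))).
split.
- by move=> F cF; apply: (avgf_param aL (H := fun z q => F (z + g q))); exact: cFg.
- move=> F G z cF cG FG; apply: (avgf_le aL); [exact: cFz|exact: cFz|].
  by move=> q Dq; apply: FG; rewrite addrAC subrr add0r; exact: gr.
- by move=> c z; rewrite (avgf_cst aL).
- by move=> F c z cF; rewrite (avgf_addc aL) //; exact: cFz.
- by move=> F v z; congr L; apply/funext => q; rewrite addrAC.
- move=> F p b cF; rewrite /cavg (avgf_swap aL (H := fun t q => F (circle p b t + g q))); last first.
    apply: (@continuous_comp' _ _ _ (fun x : Cn R n * P => F (x.1 + g x.2))
      (fun x : R * P => (circle p b x.1, x.2))); last exact: cFg.
    apply: continuous_pair; last by move=> ?; exact: cvg_snd.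
    by apply: (@continuous_comp' _ _ _ (circle p b) fst); [move=> ?; exact: cvg_fst|exact: continuous_circle].
  by congr L; apply/funext => q; apply: mean_ext => t _; rewrite /circle addrAC.
Qed.

Lemma averaging_le r s A : r <= s -> averaging r A -> averaging s A.
Proof.
move=> rs aA; split; [exact: avg_cont aA| |exact: avg_cst aA|exact: avg_addc aA|exact: avg_shift aA|exact: avg_cavg aA].
by move=> F G z cF cG FG; apply: (avg_le aA) => // y yr; apply: FG; exact: le_trans rs.
Qed.

Lemma averaging_comp r s A B : averaging r A -> averaging s B -> 
  averaging (r + s) (fun F => A (B F)).
Proof.
move=> aA aB; split.
- by move=> F cF; apply: (avg_cont aA); exact: (avg_cont aB).
- move=> F G z cF cG FG; apply: (avg_le aA); [exact: (avg_cont aB)|exact: (avg_cont aB)|].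
  move=> y yr; apply: (avg_le aB) => // x xs; apply: FG.
  by apply: le_trans (nrm_tri _ _ y) _; rewrite addrC lerD.
- move=> c z; rewrite (_ : B _ = fun=> c); first exact: (avg_cst aA).
  by apply/funext => y; exact: (avg_cst aB).
- move=> F c z cF; rewrite -(avg_addc aA); last exact: (avg_cont aB).
  by congr A; apply/funext => y; rewrite (avg_addc aB).
- move=> F v z; rewrite -(avg_shift aA); congr A; apply/funext => y.
  by rewrite (avg_shift aB).
- move=> F p b cF; rewrite (avg_cavg aA); last exact: (avg_cont aB).
  by congr A; apply/funext => y; rewrite (avg_cavg aB).
Qed.

Lemma averaging_id : averaging 0 id.
Proof. by split => // F G z _ _; apply; rewrite subrr nrm0. Qed.

Lemma averaging_seq (I : Type) (l : seq I) (A : I -> (Cn R n -> R) -> Cn R n -> R) r :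
  (forall i, averaging r (A i)) ->
  averaging ((size l)%:R * r) (fun F => foldr (fun i G => A i G) F l).
Proof.
move=> aA; elim: l => [|i l IH] /=; first by rewrite mul0r; exact: averaging_id.
by rewrite -natr1 mulrDl mul1r addrC; apply: (averaging_comp (aA i) IH).
Qed.

Lemma avg_bound r A F M z : averaging r A -> continuous F ->
  (forall y, `|F y| <= M) -> `|A F z| <= M.
Proof.
move=> aA cF hM; rewrite ler_norml -{1}(avg_cst aA (- M) z) -{2}(avg_cst aA M z).
by apply/andP; split; apply: (avg_le aA) => //; try exact: cst_continuous;
  move=> y _; have := hM y; rewrite ler_norml => /andP[].
Qed.

Definition unit_vec (k : 'I_n) : Cn R n := delta_mx ord0 k.

Lemma nrm_unit_vec k : nrm (unit_vec k) <= 1.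
Proof.
apply: nrm_le => // i; rewrite mxE; case: (_ && _).
  by rewrite -[1%:R]/(1 : cplx R) -rl1 modc_rl normr1.
by rewrite -[0%:R]/(0 : cplx R) -rl0 modc_rl normr0.
Qed.

Definition lip_along (k : 'I_n) (C : R) F :=
  forall z (a : cplx R), `|F (z + a *: unit_vec k) - F z| <= C * modc a.

(** A monotone operator that commutes with translations and with the addition
    of constants keeps the inequalities F y - c <= F (y + v) <= F y + c. *)
Lemma avg_lip r A k C F : averaging r A -> continuous F -> lip_along k C F -> lip_along k C (A F).
Proof.
move=> aA cF lF z a.
have cF' := @continuous_shift F (a *: unit_vec k) cF.
have cD (c : R) : continuous (fun y : Cn R n => F y + c).
  apply: (@continuous_comp' _ _ _ (fun x : R => x + c) F) => // x.
    by apply: cvgD; [exact: cvg_id|exact: cvg_cst].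
rewrite -(avg_shift aA) ler_norml lerBlDr lerBrDr.
rewrite [_ * _ + _]addrC [- _ + _]addrC -!(avg_addc aA) //.
by apply/andP; split; apply: (avg_le aA) => //; move=> y _;
  have := lF y a; rewrite ler_norml; lra.
Qed.

(** Move from z to w one coordinate at a time. *)
Lemma lip_all C F : 0 <= C -> (forall k, lip_along k C F) ->
  forall z w, `|F w - F z| <= n%:R * C * nrm (w - z).
Proof.
move=> C0 lF z w.
have H (l : seq 'I_n) y : `|F (y + \sum_(k <- l) (w - z) ord0 k *: unit_vec k) - F y| <=
    (size l)%:R * (C * nrm (w - z)).
  elim: l y => [|k l IH] y; first by rewrite big_nil addr0 subrr normr0 mul0r.
  rewrite big_cons addrA /= -natr1 mulrDl mul1r.
  rewrite -(subrKA (F (y + (w - z) ord0 k *: unit_vec k))).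
  apply: le_trans (ler_normD _ _) _; apply: lerD; first exact: IH.
  by apply: le_trans (lF k _ _) _; rewrite ler_wpM2l // nrm_coord.
have E : z + \sum_(k <- index_enum 'I_n) (w - z) ord0 k *: unit_vec k = w.
  by rewrite -[in RHS](subrK z w) [in RHS](row_sum_delta (w - z)) addrC.
have := H (index_enum 'I_n) z; rewrite E.
have -> : size (index_enum 'I_n) = n by rewrite -[RHS]card_ord cardT enumT.
by rewrite mulrA.
Qed.

End Averaging.

(** * Area averages of plurisubharmonic functions *)

Section AreaAverages.
Context {R : realType} {n : nat}.
Implicit Types (p z b v : Cn R n) (F G : Cn R n -> R).
Local Notation rl := (@cplx_of_real R).
Local Notation turn := [set t : R | 0 <= t <= 2 * pi].

Lemma avg_mean1 : avg_functional turn (@mean R).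
Proof.
have E : (fun h : R -> R => mean (fun t => h t * 1)) = @mean R.
  by apply/funext => h; apply: mean_ext => t _; rewrite mulr1.
rewrite -E; apply: avg_mean; [exact: cst_continuous|by []|exact: mean_cst].
Qed.

Definition square_vec (d : R) k (s t : R) : Cn R n := (rl d * (rl s + 'i * rl t)) *: unit_vec k.

(** The average of F over circles in the k-th coordinate line whose radius
    vector runs over a square. Each circle average dominates a
    plurisubharmonic function; averaging over a two-dimensional set of radii
    is what creates Lipschitz regularity. *)
Definition coord_avg (d : R) (k : 'I_n) F z : R :=
  mean (fun s => mean (fun t => cavg F z (square_vec d k s t))).

(** The constant 16 bounds 4 pi. *)
Lemma nrm_square_vec d k s t : 0 <= d -> 0 <= s <= 2 * pi -> 0 <= t <= 2 * pi ->
  nrm (square_vec d k s t) <= 16 * d.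
Proof.
move=> d0 /andP[s0 s1] /andP[t0 t1]; rewrite nrmZ.
apply: le_trans (ler_pM (modc_ge0 _) (nrm_ge0 _) (lexx _) (nrm_unit_vec k)) _.
rewrite mulr1 modcM modc_rl ger0_norm // mulrC ler_wpM2r //.
apply: le_trans (modcD _ _) _; rewrite modcM modc_i mul1r !modc_rl !ger0_norm //.
have := pihalf_lt2 R; lra.
Qed.

Lemma continuous_square_vec (X : topologicalType) d k (f g : X -> R) :
  continuous f -> continuous g -> continuous (fun x => square_vec d k (f x) (g x)).
Proof.
move=> cf cg; apply: continuous_scale; last exact: cst_continuous.
move=> x; apply: cvgM; first exact: cvg_cst.
apply: cvgD; first by apply: (continuous_comp (f := f)); [exact: cf|exact: continuous_rl].
apply: cvgM; first exact: cvg_cst.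
by apply: (continuous_comp (f := g)); [exact: cg|exact: continuous_rl].
Qed.

Lemma coord_avg_averaging d k : 0 <= d -> averaging (16 * d) (coord_avg d k).
Proof.
move=> d0; have A := avg_prod avg_mean1 (avg_prod avg_mean1 avg_mean1).
pose g (q : R * (R * R)) : Cn R n := cis q.2.2 *: square_vec d k q.1 q.2.1.
have cg : continuous g.
  apply: continuous_scale.
    apply: (@continuous_comp' _ _ _ (@cis R) (fun q : R * (R * R) => q.2.2)) continuous_cis.
    by apply: (@continuous_comp' _ _ _ snd snd) => ?; exact: cvg_snd.
  apply: continuous_square_vec; first by move=> ?; exact: cvg_fst.
  by apply: (@continuous_comp' _ _ _ fst snd) => ?; [exact: cvg_snd|exact: cvg_fst].
have gr q : (turn `*` (turn `*` turn)) q -> nrm (g q) <= 16 * d.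
  by move=> [/= q1 [/= q2 _]]; rewrite nrmZ modc_cis mul1r; exact: nrm_square_vec.
exact: (avg_translations A cg gr).
Qed.

(** For a fixed angle th, translating z by a times the unit vector translates
    the parameters (s, t) of the square by the real and imaginary parts of a
    cis (- th) / d, and a mean is Lipschitz under translation of its
    integrand. *)
Lemma coord_avg_lip d k M G : 0 < d -> continuous G -> (forall y, `|G y| <= M) ->
  lip_along k (2 * M / d) (coord_avg d k G).
Proof.
move=> d0 cG GM z a.
have M0 : 0 <= M by exact: le_trans (normr_ge0 _) (GM z).
have [Phi PhiE] : exists Phi : Cn R n -> R -> R -> R -> R,
  forall z th s t, Phi z th s t = G (z + cis th *: square_vec d k s t) by eexists.
have cPhi4 : forall (X : topologicalType) (f1 : X -> Cn R n) (f2 f3 f4 : X -> R),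
    continuous f1 -> continuous f2 -> continuous f3 -> continuous f4 ->
    continuous (fun x => Phi (f1 x) (f2 x) (f3 x) (f4 x)).
  move=> X f1 f2 f3 f4 c1 c2 c3 c4.
  rewrite (_ : (fun x => _) = fun x => G (f1 x + cis (f2 x) *: square_vec d k (f3 x) (f4 x)));
    last by apply/funext => x; rewrite PhiE.
  apply: (@continuous_comp' _ _ _ G (fun x => f1 x + cis (f2 x) *: square_vec d k (f3 x) (f4 x))) cG.
  apply: continuous_plus; first exact: c1.
  apply: continuous_scale; first exact: continuous_comp' c2 continuous_cis.
  by apply: continuous_square_vec; [exact: c3|exact: c4].
have c_fst (X Y : topologicalType) : continuous (@fst X Y) by move=> ?; exact: cvg_fst.
have c_snd (X Y : topologicalType) : continuous (@snd X Y) by move=> ?; exact: cvg_snd.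
have c_id (X : topologicalType) : continuous (@id X) by move=> ?; exact: cvg_id.
have c_cst (X Y : topologicalType) (y : Y) : continuous (fun _ : X => y) by exact: cst_continuous.
have swapE y : coord_avg d k G y = mean (fun th => mean (fun s => mean (fun t => Phi y th s t))).
  transitivity (mean (fun s => mean (fun th => mean (fun t => Phi y th s t)))).
    apply: mean_ext => s _.
    transitivity (mean (fun t => mean (fun th => Phi y th s t))).
      by apply: mean_ext => t _; apply: mean_ext => th _; rewrite PhiE.
    apply: (mean_swap (H := fun t th => Phi y th s t)).
    exact: (cPhi4 _ _ _ _ _ (c_cst _ _ y) (c_snd _ _) (c_cst _ _ s) (c_fst _ _)).
  apply: (mean_swap (H := fun s th => mean (fun t => Phi y th s t))).
  apply: (@mean_continuous _ _ (fun (q : R * R) t => Phi y q.2 q.1 t)).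
  exact: (cPhi4 _ _ _ _ _ (c_cst _ _ y) (continuous_comp' (c_fst _ _) (c_snd _ _))
    (continuous_comp' (c_fst _ _) (c_fst _ _)) (c_snd _ _)).
rewrite !swapE.
have cm2 y : continuous (fun th => mean (fun s => mean (fun t => Phi y th s t))).
  apply: (@mean_continuous _ _ (fun th s => mean (fun t => Phi y th s t))).
  apply: (@mean_continuous _ _ (fun (q : R * R) t => Phi y q.1 q.2 t)).
  exact: (cPhi4 _ _ _ _ _ (c_cst _ _ y) (continuous_comp' (c_fst _ _) (c_fst _ _))
    (continuous_comp' (c_fst _ _) (c_snd _ _)) (c_snd _ _)).
apply: mean_dist => // th _.
pose h : cplx R := a * cis (- th) / rl d.
pose h1 : R := complex.Re (h : complex R); pose h2 : R := complex.Im (h : complex R).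
have mh : modc h = modc a / d.
  by rewrite /h !modcM modc_cis mulr1 -rlV modc_rl gtr0_norm // invr_gt0.
have hE s t : Phi (z + a *: unit_vec k) th s t = Phi z th (s + h1) (t + h2).
  rewrite !PhiE -addrA; congr (G (z + _)); rewrite /square_vec !scalerA -scalerDl; congr (_ *: _).
  have -> : a = cis th * (rl d * h).
    have dn : rl d != 0 by rewrite -rl0; apply/eqP => /rlI/eqP; rewrite gt_eqF.
    by rewrite /h [rl d * _]mulrC divfK // mulrCA -cisD subrr cis0 mulr1.
  by rewrite [h]cplxE -/h1 -/h2 !rlD; ring.
have -> : mean (fun s => mean (fun t => Phi (z + a *: unit_vec k) th s t)) =
    mean (fun s => mean (fun t => Phi z th (s + h1) (t + h2))).
  by apply: mean_ext => s _; apply: mean_ext => t _; exact: hE.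
pose psi s := mean (fun t => Phi z th s (t + h2)).
have c_add (c : R) : continuous (fun t : R => t + c).
  by move=> t; apply: cvgD; [exact: cvg_id|exact: cvg_cst].
have cpsi : continuous psi.
  apply: (@mean_continuous _ _ (fun s t => Phi z th s (t + h2))).
  exact: (cPhi4 _ _ _ _ _ (c_cst _ _ z) (c_cst _ _ th) (c_fst _ _)
    (continuous_comp' (c_snd _ _) (c_add h2))).
have psiM s : `|psi s| <= M.
  apply: mean_norm.
    exact: (cPhi4 _ _ _ _ _ (c_cst _ _ z) (c_cst _ _ th) (c_cst _ _ s) (c_add h2)).
  by move=> t _; rewrite PhiE; exact: GM.
rewrite -(subrKA (mean psi)); apply: le_trans (ler_normD _ _) _.
have e1 := mean_shift_lip h1 cpsi psiM.
have e2 : `|mean psi - mean (fun s => mean (fun t => Phi z th s t))| <= M * `|h2|.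
  apply: mean_dist => //.
    apply: (@mean_continuous _ _ (fun s t => Phi z th s t)).
    exact: (cPhi4 _ _ _ _ _ (c_cst _ _ z) (c_cst _ _ th) (c_fst _ _) (c_snd _ _)).
  move=> s _; apply: (@mean_shift_lip _ (fun t => Phi z th s t)).
    exact: (cPhi4 _ _ _ _ _ (c_cst _ _ z) (c_cst _ _ th) (c_cst _ _ s) (c_id _)).
  by move=> t; rewrite PhiE; exact: GM.
apply: le_trans (lerD e1 e2) _.
have := modc_Re h; have := modc_Im h; rewrite -/h1 -/h2 mh => i2 i1.
have := ler_wpM2l M0 i1; have := ler_wpM2l M0 i2.
rewrite (_ : 2 * M / d * modc a = M * (modc a / d) + M * (modc a / d)); last by ring.
lra.
Qed.

(** The inequality u <= A u, expressed through continuous majorants F of u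
    because A acts on real-valued continuous functions and u may be -oo. In
    this form it survives compositions. *)
Definition majorizes (r : R) (U : set (Cn R n)) (u : Cn R n -> \bar R) A :=
  forall F z, continuous F ->
   (forall y, nrm (y - z) <= r -> U y /\ (u y <= (F y)%:E)%E) -> (u z <= (A F z)%:E)%E.

Lemma cavg_majorizes U u b : psh U u -> majorizes (nrm b) U u (fun F z => cavg F z b).
Proof.
move=> pu F z cF h; apply: (psh_le_cavg pu) => //.
  move=> a a1; apply: (h _ _).1; rewrite addrAC subrr add0r nrmZ.
  by rewrite ler_piMl ?nrm_ge0.
by move=> t; apply: (h _ _).2; rewrite /circle addrAC subrr add0r nrmZ modc_cis mul1r.
Qed.

Lemma majorizes_le r s U u A : r <= s -> majorizes r U u A -> majorizes s U u A.
Proof. by move=> rs m F z cF h; apply: m => // y yr; apply: h; exact: le_trans rs. Qed.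

Lemma coord_avg_majorizes d k U u : 0 <= d -> psh U u ->
  majorizes (16 * d) U u (coord_avg d k).
Proof.
move=> d0 pu F z cF h.
have cb : continuous (fun q : R * R => cavg F z (square_vec d k q.1 q.2)).
  apply: (@mean_continuous _ _ (fun (q : R * R) t => F (circle z (square_vec d k q.1 q.2) t))).
  apply: (@continuous_comp' _ _ _ F (fun x : R * R * R => circle z (square_vec d k x.1.1 x.1.2) x.2)) cF.
  apply: continuous_plus; first exact: cst_continuous.
  apply: continuous_scale.
    by apply: (@continuous_comp' _ _ _ (@cis R) snd); [move=> ?; exact: cvg_snd|exact: continuous_cis].
  by apply: continuous_square_vec; [apply: (@continuous_comp' _ _ _ fst fst) => ?; exact: cvg_fst|
    apply: (@continuous_comp' _ _ _ snd fst) => ?; [exact: cvg_fst|exact: cvg_snd]].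
have H s t : 0 <= s <= 2 * pi -> 0 <= t <= 2 * pi ->
    (u z <= (cavg F z (square_vec d k s t))%:E)%E.
  move=> hs ht.
  have := majorizes_le (nrm_square_vec k d0 hs ht) (cavg_majorizes (b := square_vec d k s t) pu).
  exact.
case: (u z) H => [r||] H.
- rewrite lee_fin -[r in r <= _](mean_cst r); apply: mean_le; first exact: cst_continuous.
    exact: (@mean_continuous _ _ (fun s t => cavg F z (square_vec d k s t))).
  move=> s hs; rewrite -[r in r <= _](mean_cst r); apply: mean_le; first exact: cst_continuous.
    exact: (@continuous_slice1 _ _ _ (fun s t => cavg F z (square_vec d k s t))).
  by move=> t ht; rewrite -lee_fin; exact: H.
- have := H 0 0; rewrite lexx ltW ?tau_gt0 // => /(_ isT isT).
  by rewrite leNgt ltry.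
- exact: leNye.
Qed.

(** The coordinate averages, one after the other: the result is Lipschitz in
    every direction. *)
Definition ball_avg (d : R) F := foldr (coord_avg d) F (index_enum 'I_n).

Lemma size_index : size (index_enum 'I_n) = n.
Proof. by rewrite -[RHS]card_ord cardT enumT. Qed.

Lemma ball_avg_averaging d : 0 <= d -> averaging (n%:R * (16 * d)) (ball_avg d).
Proof.
move=> d0; rewrite -[n in n%:R]size_index.
exact: (averaging_seq (index_enum 'I_n) (fun k => coord_avg_averaging k d0)).
Qed.

Lemma ball_avg_majorizes d U u : 0 <= d -> psh U u ->
  majorizes (n%:R * (16 * d)) U u (ball_avg d).
Proof.
move=> d0 pu; rewrite -[n in n%:R]size_index /ball_avg.
elim: (index_enum 'I_n) => [|k l IH] F z cF h.
  by apply: (h z _).2; rewrite subrr nrm0 mul0r.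
rewrite /= in h *; refine (@coord_avg_majorizes d k U u d0 pu (foldr (coord_avg d) F l) z _ _).
  exact: (avg_cont (averaging_seq l (fun k => coord_avg_averaging k d0))).
move=> y yz; rewrite -natr1 mulrDl mul1r in h.
have l0 : 0 <= (size l)%:R * (16 * d) by rewrite !mulr_ge0.
split; first by apply: (h _ _).1; apply: le_trans yz _; rewrite lerDr.
apply: IH => // x xy; apply: h.
by apply: le_trans (nrm_tri _ _ y) _; apply: lerD.
Qed.

Lemma ball_avg_lip d M F : 0 < d -> continuous F -> (forall y, `|F y| <= M) ->
  forall z w, `|ball_avg d F w - ball_avg d F z| <= n%:R * (2 * M / d) * nrm (w - z).
Proof.
move=> d0 cF FM.
have d0' := ltW d0.
have M0 : 0 <= M by exact: le_trans (normr_ge0 _) (FM 0).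
apply: lip_all; first by rewrite divr_ge0 // mulr_ge0.
move=> k; have : k \in index_enum 'I_n by rewrite mem_index_enum.
rewrite /ball_avg; elim: (index_enum 'I_n) => //= j l IH.
have aS := averaging_seq l (fun k => coord_avg_averaging k d0').
have cl : continuous (foldr (coord_avg d) F l) by exact: (avg_cont aS).
rewrite in_cons => /predU1P[->|/IH h].
  by apply: coord_avg_lip => // y; exact: (avg_bound (r := (size l)%:R * (16 * d)) y aS).
exact: (avg_lip (coord_avg_averaging j d0')).
Qed.

End AreaAverages.

(** * Local regularization of plurisubharmonic functions *)

Section Regularization.
Context {R : realType} {n : nat}.
Implicit Types (p z b v : Cn R n) (F G : Cn R n -> R).

Lemma ball_avg_exists (U : set (Cn R n)) u (s : R) : psh U u -> 0 < s ->
  exists S : (Cn R n -> R) -> Cn R n -> R, [/\ averaging s S, majorizes s U u S &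
    forall M, exists2 C : R, 0 <= C & forall F, continuous F -> (forall y, `|F y| <= M) ->
      forall z w, `|S F w - S F z| <= C * nrm (w - z)].
Proof.
move=> pu s0; pose d := s / (16 * (n%:R + 1)).
have n1 : 0 < (n%:R + 1 : R) by rewrite ltr_wpDl.
have d0 : 0 < d by rewrite divr_gt0 // mulr_gt0.
have ds : n%:R * (16 * d) <= s.
  rewrite (_ : n%:R * (16 * d) = (n%:R / (n%:R + 1)) * s); last first.
    by rewrite /d; field; rewrite gt_eqF.
  by rewrite ler_piMl ?(ltW s0) // ler_pdivrMr // mul1r lerDl.
have aS := @ball_avg_averaging R n d (ltW d0).
exists (ball_avg d); split.
- exact: averaging_le aS.
- exact: (majorizes_le ds (ball_avg_majorizes (ltW d0) pu)).
- move=> M; exists (n%:R * (2 * `|M| / d)).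
    by rewrite mulr_ge0 // divr_ge0 ?(ltW d0) // mulr_ge0.
  move=> F cF FM z w; apply: ball_avg_lip => // y; apply: le_trans (FM y) (ler_norm _).
Qed.

Lemma open_usc_lt (U : set (Cn R n)) (u : Cn R n -> \bar R) (g : Cn R n -> R) : open U -> usc_on U u -> continuous g ->
  open [set z | U z /\ (u z < (g z)%:E)%E].
Proof.
move=> oU /usc_onP usc cg; rewrite openE => z [Uz uz].
have [a ua ag] := lt_between uz.
have h1 := (usc z Uz).2 a ua.
have h2 : nbhs z U by rewrite openE in oU; exact: oU.
have h3 : nbhs z (g @^-1` [set x | a < x]) by apply: cg; exact: lt_nbhsr.
apply: filterS (filterI h1 (filterI h2 h3)) => y [y1 [y2 y3]]; split => //.
by apply: lt_trans (y1 y2) _; rewrite lte_fin.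
Qed.

Lemma usc_onS (A B : set (Cn R n)) (u : Cn R n -> \bar R) : A `<=` B -> usc_on B u -> usc_on A u.
Proof.
move=> AB /usc_onP h; apply/usc_onP => x Ax; have [h1 h2] := h x (AB _ Ax).
split => // c /h2; apply: filterS => y hy Ay; exact: hy (AB _ Ay).
Qed.

Lemma compact_gap (K : set (Cn R n)) F g : compact K -> continuous F -> continuous g ->
  (forall z, K z -> F z < g z) ->
  exists2 r : R, 0 < r & forall p y, K p -> nrm (y - p) <= r -> F y + r <= g p.
Proof.
move=> /compact_near_coveringP cK cF cg Fg.
have : \forall r \near (0 : R)^'+, K `<=` (fun p => forall y, nrm (y - p) <= r -> F y + r <= g p).
  apply: cK => x Kx; pose e := (g x - F x) / 4.
  have e0 : 0 < e by rewrite divr_gt0 // subr_gt0 Fg.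
  have [d1 d10 h1] := (cvg_nrmP F x).1 (cF x) e e0.
  have [d2 d20 h2] := (cvg_nrmP g x).1 (cg x) e e0.
  exists ([set y | nrm (y - x) < Num.min (d1 / 2) d2], [set r | r < Num.min (d1 / 2) e]).
    split; last by apply: nbhs_right_lt; rewrite lt_min e0 divr_gt0.
    by apply/nbhs_nrm; exists (Num.min (d1 / 2) d2) => //; rewrite lt_min d20 divr_gt0.
  move=> [p r] /= []; rewrite !lt_min => /andP[p1 p2] /andP[r1 r2] y hy.
  have /h1 : nrm (y - x) < d1.
    apply: le_lt_trans (nrm_tri _ _ p) _; rewrite (splitr d1) ltrD //.
    exact: le_lt_trans hy r1.
  have := h2 p p2; rewrite !ltr_norml /e in r2 *; lra.
move=> H; have [r [r0 hr]] : exists r : R, 0 < r /\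
    (K `<=` (fun p => forall y, nrm (y - p) <= r -> F y + r <= g p)).
  apply: (@filter_ex _ ((0:R)^'+)); near=> r; split; near: r; last exact: H.
  exact: nbhs_right_gt.
by exists r => // p y Kp; exact: hr.
Unshelve. all: by end_near.
Qed.

(** On a neighbourhood K' of K, continuous F i decrease to the cut-off max (u,
    - k'). Their area averages S (F i) are equi-Lipschitz, so that w = inf S
    (F i) is continuous, and u <= S (F i) gives u <= w. The submean inequality
    of w is inherited from the cut-off, by Dini's theorem used twice: along
    the circle for w, and around p for the F j. If the area averages are taken
    at a small enough scale, w stays below g. *)
Lemma psh_regularize (U K : set (Cn R n)) (u : Cn R n -> \bar R) (g : Cn R n -> R) : open U -> psh U u -> compact K -> K `<=` U ->
  continuous g -> (forall z, K z -> (u z < (g z)%:E)%E) ->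
  exists (w : Cn R n -> R) (d : R), [/\ 0 < d, continuous w,
    forall p b, K p -> nrm b <= d -> w p <= cavg w p b,
    forall z, K z -> (u z <= (w z)%:E)%E & forall z, K z -> w z < g z].
Proof.
move=> oU pu cK KU cg ug.
have uscU : usc_on U u by case: pu.
have [R0 R00 hR0] : exists2 r : R, 0 < r & thicken K r `<=` [set z | U z /\ (u z < (g z)%:E)%E].
  apply: compact_thicken => //; first exact: open_usc_lt.
  by move=> z Kz; split; [exact: KU|exact: ug].
set K' := thicken K R0 in hR0.
have cK' : compact K' by exact: thicken_compact.
have K'U : K' `<=` U by move=> z /hR0[].
have [G [cG dG uG limG]] := usc_approx cK' (usc_onS K'U uscU).
(* The functions F i are the G i cut off below at - k', under the values of g,
   and above at M, so that their averages are uniformly Lipschitz. *)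
have [k k0 hk] := compact_fun_bounded cK' (continuous_subspaceT cg).
have [m m0 hm] := compact_fun_bounded cK' (continuous_subspaceT (cG 0%N)).
pose k' := k + 1; pose M := m + k'.
have kM : k' <= M by rewrite lerDr ltW.
have [F [[cF dF FM uF limF] Fk]] : exists F : nat -> Cn R n -> R,
  [/\ forall i, continuous (F i), forall i z, F i.+1 z <= F i z, forall i z, `|F i z| <= M,
    forall i z, K' z -> (u z <= (F i z)%:E)%E &
    forall z (c : R), K' z -> (u z < c%:E)%E -> - k' < c -> exists i, F i z < c] /\
    forall i z, - k' <= F i z.
  have G0 i z : G i z <= G 0%N z.
    by elim: i => // i; apply: le_trans; exact: dG.
  exists (fun i z => Num.min M (Num.max (G i z) (- k'))); split; last first.
    by move=> i z; rewrite le_min le_max lexx orbT andbT; rewrite /M /k'; lra.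
  split.
  - move=> i; apply: continuous_minr; first exact: cst_continuous.
    by apply: continuous_maxr; [exact: cG|exact: cst_continuous].
  - move=> i z; have := dG i z; rewrite /Num.min /Num.max; do ! case: ifP; lra.
  - move=> i z; rewrite ler_norml ge_min lexx /= le_min le_max lerN2 kM orbT andbT.
    by rewrite /M /k'; lra.
  - move=> i z Kz; apply: le_trans (ltW (uG i z Kz)) _; rewrite lee_fin le_min le_max lexx andbT.
    have := hm z Kz; rewrite ler_norml => /andP[_ ]; have := G0 i z; rewrite /M /k'; lra.
  - move=> z c Kz uc kc; have [i hi] := limG z c Kz uc; exists i.
    by rewrite gt_min gt_max hi kc orbT.
have [i0 hi0] : exists i, forall z, K' z -> F i z < g z.
  apply: dini => // z Kz; apply: limF => //; first by have [] := hR0 z Kz.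
  by have := hk z Kz; rewrite ler_norml /k' => /andP[h _]; lra.
have KK' : K `<=` K' by move=> z Kz; exists z => //; rewrite subrr nrm0 ltW.
have [r r0 hr] := compact_gap cK (cF i0) cg (fun z Kz => hi0 z (KK' z Kz)).
pose s := Num.min r (R0 / 2).
have s0 : 0 < s by rewrite lt_min r0 divr_gt0.
have sr : s <= r by rewrite ge_min lexx.
have sR : s <= R0 / 2 by rewrite ge_min lexx orbT.
have [S [aS mS lS]] := ball_avg_exists pu s0.
have cS i : continuous (S (F i)) by exact: (avg_cont aS).
have dS i z : S (F i.+1) z <= S (F i) z by apply: (avg_le aS).
have SM i z : `|S (F i) z| <= M by apply: (avg_bound z aS).
have hinf z : has_inf (range (fun i => S (F i) z)).
  split; first by exists (S (F 0%N) z); exists 0%N.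
  by exists (- M) => _ [i _ <-]; have := SM i z; rewrite ler_norml => /andP[].
have [w wE] : exists w : Cn R n -> R, forall z, w z = inf (range (fun i => S (F i) z)) by eexists.
have wle i z : w z <= S (F i) z.
  by rewrite wE; apply: inf_lbound; [case: (hinf z)|exists i].
have wge z c : (forall i, c <= S (F i) z) -> c <= w z.
  move=> h; rewrite wE; apply: lb_le_inf; first by case: (hinf z).
  by move=> _ [i _ <-].
have wex z e : 0 < e -> exists i, S (F i) z < w z + e.
  move=> e0; have [_ [i _ <-] hi] := inf_adherent e0 (hinf z).
  by exists i; rewrite wE.
have [C C0 hC] := lS M.
have cw : continuous w.
  have wl z y : w y <= w z + C * nrm (y - z).
    rewrite -lerBlDr; apply: wge => i; rewrite lerBlDr; apply: le_trans (wle i y) _.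
    have := hC (F i) (cF i) (FM i) z y; rewrite ler_norml => /andP[_]; lra.
  move=> z; apply/cvg_nrmP => e e0; exists (e / (C + 1)).
    by rewrite divr_gt0 // ltr_wpDl.
  move=> y; rewrite ltr_pdivlMr ?ltr_wpDl // mulrC mulrDl mul1r => hy.
  have := wl z y; have := wl y z; rewrite (nrmB z y); have := nrm_ge0 (y - z).
  move: (C * _) hy => q; rewrite ltr_norml; lra.
have hball z y : K z -> nrm (y - z) <= s -> K' y.
  move=> Kz yz; exists z => //; apply: le_trans yz _; apply: le_trans sR _; lra.
exists w, (R0 / 2); split => //.
- by rewrite divr_gt0.
(* First i with S (F i) close to w on the circle, then j with F j at most the
   circle average of F i plus e / 2 near p. *)
- move=> p b Kp bR; apply/ler_addgt0Pr => e e0; pose e2 := e / 2.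
  have e20 : 0 < e2 by rewrite divr_gt0.
  have [i hi] : exists i, forall t : R, `[0, 2 * pi]%classic t ->
      S (F i) (circle p b t) < w (circle p b t) + e2.
    apply: (@dini R R _ (fun i t => S (F i) (circle p b t)) (fun t => w (circle p b t) + e2)).
    - exact: segment_compact.
    - by move=> i; apply: circle_comp_cont => t; exact: cS.
    - move=> t; apply: cvgD; last exact: cvg_cst.
      exact: (circle_comp_cont (fun t => cw _)).
    - by move=> i t; exact: dS.
    - by move=> t _; exact: wex.
  pose Fb y := cavg (F i) y b.
  have cFb : continuous Fb by exact: cavg_continuous.
  have cFbe : continuous (fun y : Cn R n => Fb y + e2).
    apply: (@continuous_comp' _ _ _ (fun x : R => x + e2) Fb) => // x.
    by apply: cvgD; [exact: cvg_id|exact: cvg_cst].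
  have H (y : Cn R n) : [set y : Cn R n | nrm (y - p) <= R0 / 2] y -> exists j, F j y < Fb y + e2.
    move=> yp.
    have K'y x : nrm (x - y) <= R0 / 2 -> K' x.
      move=> xy; exists p => //; apply: le_trans (nrm_tri _ _ y) _.
      by rewrite (splitr R0) lerD.
    apply: limF.
    - by apply: K'y; rewrite subrr nrm0 divr_ge0 // ltW.
    - apply: (@le_lt_trans _ _ (Fb y)%:E); last by rewrite lte_fin; lra.
      apply: (cavg_majorizes (b := b) pu) => // x xy.
      have K'x : K' x by apply: K'y; exact: le_trans bR.
      by split; [exact: K'U|exact: uF].
    - apply: (@lt_le_trans _ _ (- k' + e2)); first by lra.
      rewrite lerD2r -(mean_cst (- k')); apply: mean_le; first exact: cst_continuous.
        by apply: circle_comp_cont => t; exact: cF.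
      by move=> t _; exact: Fk.
  have [j hj] := dini (@compact_closed_ball R n p (R0 / 2)) cF cFbe dF H.
  apply: le_trans (wle j p) _.
  apply: (@le_trans _ _ (S (fun y => Fb y + e2) p)).
    apply: (avg_le aS) => // y yp; apply: ltW; apply: hj => /=.
    exact: le_trans sR.
  rewrite (avg_addc aS) // /Fb -(avg_cavg aS) // [e]splitr -/e2 addrA lerD2r.
  rewrite -[leRHS]/(cavg w p b + e2) -(mean_cst e2) -meanD; first last.
  - exact: cst_continuous.
  - by apply: circle_comp_cont => t; exact: cw.
  apply: mean_le.
  - by apply: circle_comp_cont => t; exact: cS.
  - move=> t; apply: cvgD; last exact: cvg_cst.
    exact: (circle_comp_cont (fun t => cw _)).
  - by move=> t ht; apply: ltW; apply: hi; rewrite /= in_itv.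
- move=> z Kz.
  have H i : (u z <= (S (F i) z)%:E)%E.
    by apply: mS => // y yz; have K'y := hball z y Kz yz; split; [exact: K'U|exact: uF].
  case: (u z) H => [q||] H; last exact: leNye.
    by rewrite lee_fin; apply: wge => i; rewrite -lee_fin.
  by have := H 0%N; rewrite leNgt ltry.
- move=> z Kz; apply: le_lt_trans (wle i0 z) _.
  apply: (@le_lt_trans _ _ (g z - r)); last by lra.
  rewrite -(avg_cst aS (g z - r) z); apply: (avg_le aS) => //.
    exact: cst_continuous.
  move=> y yz; have := hr z y Kz (le_trans yz sr); lra.
Qed.

End Regularization.

(** * Smoothing by convolution *)

Section Mollify.
Context {R : realType} {n : nat}.
Implicit Types (p z b v e : Cn R n) (F G f : Cn R n -> R) (chi : R -> R).
Local Notation rl := (@cplx_of_real R).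

(** Convolution along the real direction e. The smooth kernels live in (1, 2),
    well inside [0, 2 pi], so that the mean computes the whole convolution up
    to a factor. *)
Definition conv1 e chi F z : R := mean (fun t => F (z + rl t *: e) * chi t).

Fixpoint conv (es : seq (Cn R n)) (chis : seq (R -> R)) F : Cn R n -> R :=
  match es, chis with
  | e :: es', chi :: chis' => conv1 e chi (conv es' chis' F)
  | _, _ => F
  end.

Fixpoint lincomb (cs : seq R) (es : seq (Cn R n)) : Cn R n :=
  match cs, es with
  | c :: cs', e :: es' => rl c *: e + lincomb cs' es'
  | _, _ => 0
  end.

Fixpoint smooth_kernels (chis : seq (R -> R)) : Prop :=
  if chis is chi :: chis' then smooth_kernel chi /\ smooth_kernels chis' else True.

Lemma continuous_line (X : topologicalType) (f : X -> Cn R n) (g : X -> R) e :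
  continuous f -> continuous g -> continuous (fun x => f x + rl (g x) *: e).
Proof.
move=> cf cg; apply: continuous_plus; first exact: cf.
apply: continuous_scale; last exact: cst_continuous.
exact: continuous_comp' cg continuous_rl.
Qed.

Lemma conv1_cont e chi F : continuous chi -> continuous F -> continuous (conv1 e chi F).
Proof.
move=> cc cF; apply: (@mean_continuous _ _ (fun z t => F (z + rl t *: e) * chi t)).
apply: continuous_mulr; last by apply: (continuous_comp' _ cc) => ?; exact: cvg_snd.
apply: (continuous_comp' _ cF); apply: continuous_line => ?; [exact: cvg_fst|exact: cvg_snd].
Qed.

Lemma conv_cont es chis F : smooth_kernels chis -> continuous F -> continuous (conv es chis F).
Proof.
elim: es chis => [|e es IH] [|chi chis] //= [s1 s2] cF.
by apply: conv1_cont; [exact: smooth_kernel_cont|exact: IH].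
Qed.

Definition dir_derive v f f' := forall z, is_derive (0 : R) 1 (fun t : R => f (z + rl t *: v)) (f' z).

Lemma dir_derive_at v f f' z (t0 : R) : dir_derive v f f' ->
  is_derive t0 1 (fun t : R => f (z + rl t *: v)) (f' (z + rl t0 *: v)).
Proof.
move=> d; have h := d (z + rl t0 *: v).
have d2 : is_derive t0 1 (fun t => t - t0) (1 : R) by apply: is_derive_eq; rewrite subr0.
have d1 : is_derive (t0 - t0) 1 (fun t : R => f (z + rl t0 *: v + rl t *: v)) (f' (z + rl t0 *: v)).
  by rewrite subrr.
have E : (fun t : R => f (z + rl t0 *: v + rl t *: v)) \o (fun t : R => t - t0) =
    fun t : R => f (z + rl t *: v).
  by apply/funext => t; rewrite /= -addrA -scalerDl -rlD [t0 + _]addrC subrK.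
by have := @is_derive1_comp R _ (fun t => t - t0) t0 _ _ d1 d2; rewrite mulr1 E.
Qed.

(** The change of variable t |-> t - c x moves the displacement along c e from
    g to the kernel, which is differentiable; the displacement along v stays
    on g. *)
Lemma conv1_derive e chi chi' (g g' : Cn R n -> R) (c : R) v :
  smooth_kernel chi -> smooth_kernel chi' -> (forall t : R, is_derive t 1 chi (chi' t)) ->
  continuous g -> continuous g' -> dir_derive v g g' ->
  dir_derive (rl c *: e + v) (conv1 e chi g)
    (fun z => conv1 e chi g' z - c * conv1 e chi' g z).
Proof.
move=> sc sc' dchi cg cg' dg z.
have cc := smooth_kernel_cont sc; have cc' := smooth_kernel_cont sc'.
(* The integrand of conv1 e chi g at the displaced point, after the change of
   variable; only its first factor is displaced along v. *)
pose K (x t : R) := g (z + rl t *: e + rl x *: v) * chi (t - x * c).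
pose dK (x t : R) := g' (z + rl t *: e + rl x *: v) * chi (t - x * c)
   - c * (g (z + rl t *: e + rl x *: v) * chi' (t - x * c)).
have c_fst (X Y : topologicalType) : continuous (@fst X Y) by move=> ?; exact: cvg_fst.
have c_snd (X Y : topologicalType) : continuous (@snd X Y) by move=> ?; exact: cvg_snd.
have carg : continuous (fun q : R * R => z + rl q.2 *: e + rl q.1 *: v).
  apply: continuous_line; last exact: c_fst.
  by apply: continuous_line; [exact: cst_continuous|exact: c_snd].
have ct : continuous (fun q : R * R => q.2 - q.1 * c).
  move=> q; apply: cvgB; first exact: c_snd.
  by apply: cvgM; [exact: c_fst|exact: cvg_cst].
have cK : continuous (fun q : R * R => K q.1 q.2).
  by apply: continuous_mulr; [exact: (continuous_comp' carg cg)|exact: (continuous_comp' ct cc)].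
have cdK : continuous (fun q : R * R => dK q.1 q.2).
  apply: continuous_addr.
    by apply: continuous_mulr; [exact: (continuous_comp' carg cg')|exact: (continuous_comp' ct cc)].
  have cm : continuous (fun q : R * R => (- c) * (g (z + rl q.2 *: e + rl q.1 *: v) * chi' (q.2 - q.1 * c))).
    apply: continuous_mulr; first exact: cst_continuous.
    by apply: continuous_mulr; [exact: (continuous_comp' carg cg)|exact: (continuous_comp' ct cc')].
  by rewrite (_ : (fun q : R * R => - _) = fun q : R * R => (- c) * (g (z + rl q.2 *: e + rl q.1 *: v) * chi' (q.2 - q.1 * c)));
    [exact: cm|apply/funext => q; rewrite mulNr].
have dKd (x t : R) : is_derive x 1 (K ^~ t) (dK x t).
  have d1 := @dir_derive_at v g g' (z + rl t *: e) x dg.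
  have d2 : is_derive x 1 (fun x : R => t - x * c) (- c).
    by apply: is_derive_eq; rewrite /GRing.scale /=; ring.
  have d3 := @is_derive1_comp R chi (fun x : R => t - x * c) x _ _ (dchi _) d2.
  apply: (is_derive_eq (is_deriveM d1 d3)); rewrite /dK /GRing.scale /=; ring.
have [r r0 hr] : exists2 r : R, 0 < r & forall x : R, `|x| < r -> `|x * c| < 1.
  exists (`|c| + 1)^-1; first by rewrite invr_gt0 ltr_wpDl.
  move=> x; rewrite -[_^-1]mul1r ltr_pdivlMr ?ltr_wpDl // mulrDr mulr1 normrM => h.
  by apply: le_lt_trans h; rewrite lerDl.
have main := mean_derive r0 (fun x => continuous_slice1 (x := x) cK) cdK (fun x t _ => dKd x t).
have -> : conv1 e chi g' z - c * conv1 e chi' g z = mean (dK 0).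
  have ca : continuous (fun t : R => z + rl t *: e).
    by apply: continuous_line; [exact: cst_continuous|move=> ?; exact: cvg_id].
  have c1 : continuous (fun t => g' (z + rl t *: e) * chi t).
    by apply: continuous_mulr => //; exact: (continuous_comp' ca cg').
  have c2 : continuous (fun t => g (z + rl t *: e) * chi' t).
    by apply: continuous_mulr => //; exact: (continuous_comp' ca cg).
  rewrite /conv1 -meanZ // -meanB //.
    by apply: mean_ext => t _; rewrite /dK rl0 scale0r addr0 mul0r subr0.
  by apply: continuous_mulr => //; exact: cst_continuous.
apply: near_eq_is_derive main.
have N : \forall x \near (0 : R), `|x| < r.
  by exists r => // y; rewrite /= sub0r normrN.
near=> x.
have xr : `|x| < r by near: x; exact: N.
pose h t := g (z + rl (t + x * c) *: e + rl x *: v) * chi t.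
have ch : continuous h.
  apply: continuous_mulr => //; apply: (continuous_comp' _ cg).
  apply: continuous_line; last exact: cst_continuous.
  apply: continuous_line; first exact: cst_continuous.
  by move=> t; apply: cvgD; [exact: cvg_id|exact: cvg_cst].
have hs t : ~~ (1 < t < 2) -> h t = 0 by move=> ht; rewrite /h (smooth_kernel_supp sc ht) mulr0.
have E := mean_shift_supp (a := - (x * c)) ch hs; rewrite normrN in E.
transitivity (mean h); last first.
  rewrite /conv1; apply: mean_ext => t _; rewrite /h; congr (g _ * _).
  rewrite scalerDr scalerA -rlM rlD scalerDl -!addrA; congr (_ + _).
  by rewrite addrC -addrA.
rewrite -E; last exact: hr.
by apply: mean_ext => t _; rewrite /h /K subrK.
Unshelve. all: by end_near.
Qed.

(** The linear combinations of convolutions of F along the directions es, with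
    arbitrary kernels. They are closed under derivatives along the span of es
    (mollified_derive), hence smooth when es spans C^n over R. *)
Inductive mollified (es : seq (Cn R n)) F : (Cn R n -> R) -> Prop :=
| mollified0 : mollified es F (fun=> 0)
| mollifiedD c chis f : size chis = size es -> smooth_kernels chis -> mollified es F f ->
    mollified es F (fun z => c * conv es chis F z + f z).

Lemma mollified_cont es F f : continuous F -> mollified es F f -> continuous f.
Proof.
move=> cF; elim=> [|c chis f' _ sc _ IH]; first exact: cst_continuous.
apply: continuous_addr => //; apply: continuous_mulr; first exact: cst_continuous.
exact: conv_cont.
Qed.

Lemma mollified_add es F f g : mollified es F f -> mollified es F g ->
  mollified es F (fun z => f z + g z).
Proof.
move=> mf mg; elim: mf => [|c chis f' sz sc mf' IH].
  by rewrite (_ : (fun z => _) = g) //; apply/funext => z; rewrite add0r.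
rewrite (_ : (fun z => _) = fun z => c * conv es chis F z + (f' z + g z)); last first.
  by apply/funext => z; rewrite addrA.
exact: mollifiedD.
Qed.

Lemma mollified_scale es F f a : mollified es F f -> mollified es F (fun z => a * f z).
Proof.
elim=> [|c chis f' sz sc mf' IH].
  by rewrite (_ : (fun z => _) = fun=> 0); [exact: mollified0|apply/funext => z; rewrite mulr0].
rewrite (_ : (fun z => _) = fun z => (a * c) * conv es chis F z + a * f' z); last first.
  by apply/funext => z; rewrite mulrDr mulrA.
exact: mollifiedD.
Qed.

Lemma mollified_conv1 e chi es F f : smooth_kernel chi -> continuous F -> mollified es F f ->
  mollified (e :: es) F (conv1 e chi f).
Proof.
move=> sc cF; have cc := smooth_kernel_cont sc; elim=> [|c chis f' sz scs mf' IH].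
  rewrite (_ : conv1 _ _ _ = fun=> 0); first exact: mollified0.
  by apply/funext => z; rewrite /conv1 -[RHS](mean_cst 0); apply: mean_ext => t _; rewrite mul0r.
rewrite (_ : conv1 _ _ _ = fun z => c * conv (e :: es) (chi :: chis) F z + conv1 e chi f' z).
  by apply: mollifiedD => //=; rewrite sz.
have ca z : continuous (fun t : R => z + rl t *: e).
  by apply: continuous_line; [exact: cst_continuous|move=> ?; exact: cvg_id].
apply/funext => z; rewrite /= /conv1.
have cC := @conv_cont es chis F scs cF; have cf' := mollified_cont cF mf'.
have k1 : continuous (fun t => conv es chis F (z + rl t *: e) * chi t).
  by apply: continuous_mulr => //; exact: (continuous_comp' (ca z) cC).
have k2 : continuous (fun t => f' (z + rl t *: e) * chi t).
  by apply: continuous_mulr => //; exact: (continuous_comp' (ca z) cf').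
rewrite -meanZ // -meanD //.
  by apply: mean_ext => t _; rewrite mulrDl mulrA.
by apply: continuous_mulr => //; exact: cst_continuous.
Qed.

Lemma dir_derive_lin v f f' g g' a : dir_derive v f f' -> dir_derive v g g' ->
  dir_derive v (fun z => a * f z + g z) (fun z => a * f' z + g' z).
Proof.
move=> df dg z; have h1 := is_deriveZ a (df z).
exact: (is_deriveD h1 (dg z)).
Qed.

(** A derivative along the i-th direction falls on the i-th kernel. *)
Lemma conv_derive es chis F cs : size chis = size es -> size cs = size es ->
  smooth_kernels chis -> continuous F ->
  exists2 f', mollified es F f' & dir_derive (lincomb cs es) (conv es chis F) f'.
Proof.
move=> + + + cF; elim: es chis cs => [|e es IH] [|chi chis] [|c cs] //=.
  move=> _ _ _; exists (fun=> 0); first exact: mollified0.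
  move=> z; rewrite (_ : (fun t : R => _) = fun=> F z); last first.
    by apply/funext => t; rewrite scaler0 addr0.
  exact: is_derive_cst.
move=> [sz] [szc] [sc scs]; have [g' mg' dg'] := IH _ _ sz szc scs.
have [chi' sc' dchi] := smooth_kernel_deriv sc.
exists (fun z => conv1 e chi g' z - c * conv1 e chi' (conv es chis F) z).
  apply: mollified_add; first exact: mollified_conv1.
  rewrite (_ : (fun z => _) = fun z => (- c) * conv (e :: es) (chi' :: chis) F z + 0); last first.
    by apply/funext => z; rewrite addr0 mulNr.
  by apply: mollifiedD => //=; [rewrite sz|exact: mollified0].
apply: conv1_derive => //; first exact: conv_cont.
exact: (mollified_cont cF mg').
Qed.

Lemma mollified_derive es F f v : continuous F ->
  (exists2 cs, size cs = size es & v = lincomb cs es) ->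
  mollified es F f -> exists2 f', mollified es F f' & dir_derive v f f'.
Proof.
move=> cF [cs scs ->]; elim=> [|c chis f0 sz sc mf0 [f0' m0 d0]].
  by exists (fun=> 0); [exact: mollified0|move=> z; exact: is_derive_cst].
have [g' mg' dg'] := conv_derive sz scs sc cF.
exists (fun z => c * g' z + f0' z); last exact: dir_derive_lin.
by apply: mollified_add => //; exact: mollified_scale.
Qed.

Lemma mollified_smooth es F f U : continuous F ->
  (forall v, exists2 cs, size cs = size es & v = lincomb cs es) ->
  mollified es F f -> smooth_on U f.
Proof.
move=> cF span mf s z Uz.
have ms : mollified es F (iter_dirD s f).
  elim: s => //= v s IH; have [f' mf' df'] := mollified_derive cF (span v) IH.
  rewrite (_ : dirD v _ = f') //; apply/funext => y.
  by rewrite /dirD derive1E; exact: (@derive_val _ _ _ _ _ _ _ (df' y)).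
split; first exact: (mollified_cont cF ms).
move=> v; have [f' _ df'] := mollified_derive cF (span v) ms.
exact: (@ex_derive _ _ _ _ _ _ _ (df' z)).
Qed.

Definition real_basis (d : R) : seq (Cn R n) :=
  [seq rl d *: unit_vec k | k <- index_enum 'I_n] ++
  [seq ('i * rl d) *: unit_vec k | k <- index_enum 'I_n].

Lemma lincomb_cat cs ds es fs : size cs = size es ->
  lincomb (cs ++ ds) (es ++ fs) = lincomb cs es + lincomb ds fs.
Proof.
elim: es cs => [|e es IH] [|c cs] //=; first by rewrite add0r.
by move=> [/IH->]; rewrite addrA.
Qed.

Lemma lincomb_map (I : Type) (l : seq I) (c : I -> R) (e : I -> Cn R n) :
  lincomb [seq c i | i <- l] [seq e i | i <- l] = \sum_(i <- l) rl (c i) *: e i.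
Proof. by elim: l => [|i l IH] /=; rewrite ?big_nil // big_cons IH. Qed.

Lemma real_basis_span d v : 0 < d ->
  exists2 cs, size cs = size (real_basis d) & v = lincomb cs (real_basis d).
Proof.
move=> d0.
pose c1 k := complex.Re (v ord0 k : complex R) / d.
pose c2 k := complex.Im (v ord0 k : complex R) / d.
exists ([seq c1 k | k <- index_enum 'I_n] ++ [seq c2 k | k <- index_enum 'I_n]).
  by rewrite !size_cat !size_map.
rewrite lincomb_cat ?size_map // !lincomb_map -big_split /=.
rewrite [LHS]row_sum_delta; apply: eq_bigr => k _.
rewrite !scalerA -scalerDl; congr (_ *: _); rewrite [LHS]cplxE.
by rewrite mulrCA -!rlM /c1 /c2 !divfK ?gt_eqF.
Qed.

Lemma conv1_averaging e chi : smooth_kernel chi -> (forall t, 0 <= chi t) -> mean chi = 1 ->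
  averaging (2 * pi * nrm e) (conv1 e chi).
Proof.
move=> sc c0 m1; have A := avg_mean (smooth_kernel_cont sc) c0 m1.
apply: (avg_translations (g := fun t : R => rl t *: e) A).
  apply: continuous_scale; [exact: continuous_rl|exact: cst_continuous].
move=> t /= /andP[t0 t1]; rewrite nrmZ modc_rl ger0_norm // ler_wpM2r //; exact: nrm_ge0.
Qed.

Lemma conv_averaging (es : seq (Cn R n)) chi (r : R) : smooth_kernel chi -> (forall t, 0 <= chi t) ->
  mean chi = 1 -> (forall e, e \in es -> 2 * pi * nrm e <= r) ->
  averaging ((size es)%:R * r) (conv es (nseq (size es) chi)).
Proof.
move=> sc c0 m1; elim: es => [|e es IH] h /=; first by rewrite mul0r; exact: averaging_id.
rewrite -natr1 mulrDl mul1r addrC.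
have he : 2 * pi * nrm e <= r by apply: h; rewrite mem_head.
have A := conv1_averaging e sc c0 m1.
by apply: (averaging_comp (averaging_le he A)); apply: IH => e' he'; apply: h; rewrite in_cons he' orbT.
Qed.

(** Convolve along the 2 n vectors of a real basis of C^n; each convolution
    moves points by at most s / (2 n + 1). *)
Lemma smoothing (s : R) : 0 < s -> exists A : (Cn R n -> R) -> Cn R n -> R,
  averaging s A /\ forall F U, continuous F -> smooth_on U (A F).
Proof.
move=> s0; have [chi [sc c0 m1]] := @bump R.
pose r := s / (2 * n%:R + 1); pose d := r / (2 * pi).
have n1 : 0 < (2 * n%:R + 1 : R) by rewrite ltr_wpDl // mulr_ge0.
have r0 : 0 < r by rewrite divr_gt0.
have d0 : 0 < d by rewrite divr_gt0 // tau_gt0.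
pose es := real_basis d.
have hes e : e \in es -> 2 * pi * nrm e <= r.
  have h (a : cplx R) k : modc a <= d -> 2 * pi * nrm (a *: unit_vec k : Cn R n) <= r.
    move=> ad; rewrite -ler_pdivlMl ?tau_gt0 // mulrC -/d nrmZ.
    by apply: le_trans (ler_pM (modc_ge0 _) (nrm_ge0 _) ad (nrm_unit_vec k)) _; rewrite mulr1.
  rewrite mem_cat => /orP[] /mapP[k _ ->]; apply: h.
    by rewrite modc_rl gtr0_norm.
  by rewrite modcM modc_i mul1r modc_rl gtr0_norm.
have A := conv_averaging sc c0 m1 hes.
have ss : (size es)%:R * r <= s.
  rewrite size_cat !size_map size_index addnn -mul2n natrM /r mulrCA ler_piMr ?(ltW s0) //.
  by rewrite ler_pdivrMr // mul1r lerDl.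
exists (conv es (nseq (size es) chi)); split.
  exact: averaging_le A.
move=> F U cF; apply: (@mollified_smooth es F) => //.
  by move=> v; exact: real_basis_span.
rewrite (_ : conv _ _ F = fun z => 1 * conv es (nseq (size es) chi) F z + 0); last first.
  by apply/funext => z; rewrite addr0 mul1r.
apply: mollifiedD; [by rewrite size_nseq| |exact: mollified0].
by elim: (size es) => //= m IH; split.
Qed.

End Mollify.

(** * Continuous plurisubharmonic functions near a compact set *)

Section NearPsh.
Context {R : realType} {n : nat}.
Implicit Types (p z b x y : Cn R n) (F G u v w : Cn R n -> R) (X U K L O : set (Cn R n)).

(** For a function that is continuous everywhere, this is plurisubharmonicity
    near X (near_psh_psh), and every continuous function that is
    plurisubharmonic near X agrees on X with such an F (near_psh_of_nbhd). The
    uniform radius lets averaging operators and gluing act without keeping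
    track of neighbourhoods. *)
Definition near_psh X F := continuous F /\ exists2 r : R, 0 < r &
  forall p b, thicken X r p -> nrm b <= r -> F p <= cavg F p b.

Lemma thickenS X r s : r <= s -> thicken X r `<=` thicken X s.
Proof. by move=> rs z [x Xx h]; exists x => //; exact: le_trans rs. Qed.

Lemma sub_thicken X r : 0 <= r -> X `<=` thicken X r.
Proof. by move=> r0 z Xz; exists z => //; rewrite subrr nrm0. Qed.

(** Unite, for x in the first set, the balls about x of radius at most half
    the distance to the second set, and conversely. *)
Lemma Cn_normal : normal_space (Cn R n).
Proof.
apply/(@normal_openP R) => A B clA clB AB.
pose W (C D : set (Cn R n)) := [set z : Cn R n | exists x (e : R),
  [/\ C x, 0 < e, nrm (z - x) < e & forall y, nrm (y - x) < 2 * e -> ~ D y]].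
have oW C D : open (W C D).
  rewrite openE => z [x [e [Cx e0 zx hD]]].
  apply/nbhs_nrm; exists (e - nrm (z - x)); first by rewrite subr_gt0.
  move=> w wz; exists x, e; split => //.
  by apply: le_lt_trans (nrm_tri _ _ z) _; lra.
have sW C D : closed D -> C `&` D = set0 -> C `<=` W C D.
  move=> /closed_openC oD CD x Cx.
  have nDx : (~` D) x by move=> Dx; suff : set0 x by []; rewrite -CD.
  have [e e0 he] := open_nrm oD nDx.
  exists x, (e / 2); split => //; first by rewrite divr_gt0.
    by rewrite subrr nrm0 divr_gt0.
  by move=> y hy; apply: he; lra.
exists (W A B), (W B A); split; [exact: oW|exact: oW|exact: sW|by apply: sW => //; rewrite setIC|].
apply/seteqP; split=> // z [[x [e [Ax e0 zx hB]]] [y [d [By d0 zy hA]]]].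
have h := nrm_tri x y z; rewrite (nrmB x z) in h.
have [ed|de] := leP e d.
  by apply: (hA x) => //; lra.
by apply: (hB y) => //; rewrite nrmB; lra.
Qed.

(** Tietze's extension theorem in the normal space C^n. *)
Lemma extend_compact K v : compact K -> {within K, continuous v} ->
  exists2 F, continuous F & forall z, K z -> F z = v z.
Proof.
move=> cK cv; have [M M0 hM] := compact_fun_bounded cK cv.
have clK : closed K by apply: compact_closed => //; exact: norm_hausdorff.
have [F [Fv cF _]] := continuous_bounded_extension Cn_normal clK M0 cv hM.
by exists F => // z Kz; rewrite Fv // inE.
Qed.

Lemma extend_continuous X U v : compact X -> open U -> X `<=` U ->
  (forall z, U z -> {for z, continuous v}) ->
  exists F (r : R), [/\ 0 < r, continuous F, thicken X r `<=` U &
     forall z, thicken X r z -> F z = v z].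
Proof.
move=> cX oU XU cv; have [s s0 hs] := compact_thicken cX oU XU.
have cv' : {within thicken X s, continuous v}.
  by apply: continuous_in_subspaceT => z /set_mem Hz; exact: cv (hs z Hz).
have [F cF Fv] := extend_compact (thicken_compact cX) cv'.
by exists F, s.
Qed.

Lemma near_psh_of_nbhd X u : compact X -> psh_cont_nbhd X u ->
  exists2 F, near_psh X F & forall z, X z -> F z = u z.
Proof.
move=> cX [U [v [oU XU pv cv vu]]].
have cv' z : U z -> {for z, continuous v}.
  move: cv; rewrite continuous_open_subspace // => cv Uz.
  by apply: cv; rewrite inE.
have sv := (psh_cont_submean cv').1 pv.
have [F [r [r0 cF rU Fv]]] := extend_continuous cX oU XU cv'.
exists F; last by move=> z Xz; rewrite Fv ?vu //; apply: sub_thicken Xz; exact: ltW.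
split => //; exists (r / 2); first by rewrite divr_gt0.
move=> p b [x Xx px] br.
have hc (a : cplx R) : modc a <= 1 -> thicken X r (p + a *: b).
  move=> a1; exists x => //; apply: le_trans (nrm_tri _ _ p) _.
  rewrite addrAC subrr add0r (splitr r) lerD // nrmZ.
  by apply: le_trans br; rewrite ler_piMl ?nrm_ge0.
have hp : thicken X r p by have := hc 0; rewrite scale0r addr0; apply; rewrite -rl0 modc_rl normr0.
rewrite Fv //; apply: le_trans (sv p b _) _; first by move=> a a1; apply: rU; exact: hc.
rewrite le_eqVlt; apply/orP; left; apply/eqP; apply: mean_ext => t _.
by rewrite Fv //; apply: hc; rewrite modc_cis.
Qed.

Lemma near_psh_psh X F : near_psh X F -> exists V, [/\ open V, X `<=` V & psh V (EFin \o F)].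
Proof.
move=> [cF [r r0 h]].
exists (\bigcup_(x in X) [set z | nrm (z - x) < r]); split.
- apply: bigcup_open => x Xx; rewrite openE => z /= zx.
  apply/nbhs_nrm; exists (r - nrm (z - x)); first by rewrite subr_gt0.
  by move=> y hy /=; apply: le_lt_trans (nrm_tri _ _ z) _; lra.
- by move=> z Xz; exists z => //=; rewrite subrr nrm0.
apply/psh_cont_submean; first by move=> z _; exact: cF.
apply: (local_submean r0 cF) => p b [x Xx /= px]; apply: h.
by exists x => //; exact: ltW.
Qed.

Lemma near_psh_max X F G : near_psh X F -> near_psh X G -> near_psh X (fun z => Num.max (F z) (G z)).
Proof.
move=> [cF [r r0 hF]] [cG [s s0 hG]]; split; first exact: continuous_maxr.
exists (Num.min r s); first by rewrite lt_min r0.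
have mr : Num.min r s <= r by rewrite ge_min lexx.
have ms : Num.min r s <= s by rewrite ge_min lexx orbT.
move=> p b tp bm; rewrite ge_max; apply/andP; split.
  apply: le_trans (hF p b (thickenS mr tp) (le_trans bm mr)) _.
  by apply: mean_le => [||t _]; [exact: (circle_comp_cont (fun t => cF _))|apply: continuous_maxr; [exact: (circle_comp_cont (fun t => cF _))|exact: (circle_comp_cont (fun t => cG _))]|rewrite le_max lexx].
apply: le_trans (hG p b (thickenS ms tp) (le_trans bm ms)) _.
by apply: mean_le => [||t _]; [exact: (circle_comp_cont (fun t => cG _))|apply: continuous_maxr; [exact: (circle_comp_cont (fun t => cF _))|exact: (circle_comp_cont (fun t => cG _))]|rewrite le_max lexx orbT].
Qed.

Lemma near_psh_lin X F G (a c : R) : 0 <= a -> 0 <= c -> near_psh X F -> near_psh X G ->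
  near_psh X (fun z => a * F z + c * G z).
Proof.
move=> a0 c0 [cF [r r0 hF]] [cG [s s0 hG]].
have ca (H : Cn R n -> R) (q : R) : continuous H -> continuous (fun z => q * H z).
  by move=> cH; apply: continuous_mulr => //; exact: cst_continuous.
split; first by apply: continuous_addr; exact: ca.
exists (Num.min r s); first by rewrite lt_min r0.
have mr : Num.min r s <= r by rewrite ge_min lexx.
have ms : Num.min r s <= s by rewrite ge_min lexx orbT.
move=> p b tp bm.
have h1 := hF p b (thickenS mr tp) (le_trans bm mr).
have h2 := hG p b (thickenS ms tp) (le_trans bm ms).
have cc (H : Cn R n -> R) : continuous H -> continuous (fun t => H (circle p b t)).
  by move=> cH; exact: (circle_comp_cont (fun t => cH _)).
rewrite /cavg meanD; [|exact: (cc _ (ca _ a cF))|exact: (cc _ (ca _ c cG))].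
rewrite !meanZ; [|exact: cc|exact: cc].
by rewrite lerD // ler_wpM2l.
Qed.

Lemma near_psh_cst X (c : R) : near_psh X (fun=> c).
Proof.
split; first exact: cst_continuous.
by exists 1 => // p b _ _; rewrite /cavg mean_cst.
Qed.

Lemma near_psh_affine X F (a c : R) : 0 <= a -> near_psh X F -> near_psh X (fun z => a * F z + c).
Proof.
move=> a0 nF; have := near_psh_lin a0 ler01 nF (near_psh_cst X c).
by rewrite (_ : (fun z => _ + 1 * _) = fun z => a * F z + c) //; apply/funext => z; rewrite mul1r.
Qed.

(** The operator averages over translates that are too short to leave the
    neighbourhood where F has the submean property, and too short to change F
    by more than e on X. *)
Lemma smooth_approx X F (e : R) : compact X -> near_psh X F -> 0 < e ->
  exists w, [/\ continuous w, smooth_psh_near X w & forall z, X z -> `|w z - F z| <= e].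
Proof.
move=> cX [cF [r r0 h]] e0.
have cN : continuous (fun z => - F z).
  apply: (@continuous_comp' _ _ _ (fun q : R => - q) F) => //; exact: opp_continuous.
have cFe : continuous (fun z => F z + e) by apply: continuous_addr => //; exact: cst_continuous.
have cNe : continuous (fun z => - F z + e) by apply: continuous_addr => //; exact: cst_continuous.
have [s1 s10 hs1] := compact_gap cX cF cFe (fun z _ => ltr_pwDr e0 (lexx _)).
have [s2 s20 hs2] := compact_gap cX cN cNe (fun z _ => ltr_pwDr e0 (lexx _)).
pose s := Num.min (Num.min s1 s2) (r / 2).
have s0 : 0 < s by rewrite !lt_min s10 s20 divr_gt0.
have ss1 : s <= s1 by rewrite !ge_min lexx.
have ss2 : s <= s2 by rewrite !ge_min lexx orbT.
have ssr : s <= r / 2 by rewrite ge_min lexx orbT.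
have [A [aA sA]] := @smoothing R n s s0.
have cw : continuous (A F) by exact: (avg_cont aA).
exists (A F); split => //.
  have nw : near_psh X (A F).
    split => //; exists (r / 2); first by rewrite divr_gt0.
    move=> p b [x Xx px] br; rewrite (avg_cavg aA) //; apply: (avg_le aA) => //.
      exact: cavg_continuous.
    move=> y ys; apply: h; last by apply: le_trans br _; lra.
    exists x => //; apply: le_trans (nrm_tri _ _ p) _.
    by rewrite (splitr r) lerD // (le_trans ys).
  by have [V [oV XV pV]] := near_psh_psh nw; exists V; split => //; exact: sA.
move=> z Xz; rewrite ler_norml lerBlDr lerBrDr.
apply/andP; split.
  rewrite -[leLHS](avg_cst aA (- e + F z) z); apply: (avg_le aA) => //; first exact: cst_continuous.
  by move=> y ys; have := hs2 z y Xz (le_trans ys ss2); lra.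
rewrite -[leRHS](avg_cst aA (e + F z) z); apply: (avg_le aA) => //; first exact: cst_continuous.
by move=> y ys; have := hs1 z y Xz (le_trans ys ss1); lra.
Qed.

(** The function is max (u, psi) on O and psi elsewhere; it equals psi off L,
    so that it is continuous. At each point it coincides with u or with psi,
    dominates that function on short circles, and so inherits its submean
    inequality. The inequality for u is only needed at points of L, and short
    circles about these stay in O. *)
Lemma near_psh_glue X O L (u psi : Cn R n -> R) (d : R) : near_psh X psi ->
  open O -> compact L -> L `<=` O -> continuous u -> 0 < d ->
  (forall p b, O p -> nrm b <= d -> u p <= cavg u p b) ->
  (forall z, O z -> ~ L z -> u z <= psi z) ->
  exists v, [/\ near_psh X v, forall z, psi z <= v z, forall z, O z -> u z <= v z &
    forall z, v z = psi z \/ (O z /\ v z = u z)].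
Proof.
move=> [cpsi [r r0 hpsi]] oO cL LO cu d0 su upsi.
pose v z := if pselect (O z) then Num.max (u z) (psi z) else psi z.
have vO z : O z -> v z = Num.max (u z) (psi z) by rewrite /v; case: pselect.
have vL z : ~ L z -> v z = psi z.
  rewrite /v; case: pselect => // Oz nLz; apply/max_idPr; exact: upsi.
have vpsi z : psi z <= v z.
  by rewrite /v; case: pselect => // Oz; rewrite le_max lexx orbT.
have vu z : O z -> u z <= v z by move=> /vO->; rewrite le_max lexx.
have vor z : v z = psi z \/ (L z /\ v z = u z).
  have [Lz|nLz] := pselect (L z); last by left; exact: vL.
  by rewrite vO; [case: (leP (u z) (psi z)); [left|right]|exact: LO].
have cmax : continuous (fun z => Num.max (u z) (psi z)) by exact: continuous_maxr.
have clL : open (~` L).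
  by apply: closed_openC; apply: compact_closed => //; exact: norm_hausdorff.
have cv : continuous v.
  move=> z; have [Oz|nOz] := pselect (O z).
    have E : \forall y \near z, Num.max (u y) (psi y) = v y.
      have N : nbhs z O by move: oO; rewrite openE; exact.
      by apply: filterS N => y Oy; rewrite vO.
    rewrite /continuous_at -(nbhs_singleton E).
    exact: (cvg_trans (near_eq_cvg E) (cmax z)).
  have nLz : (~` L) z by move=> /LO.
  have E : \forall y \near z, psi y = v y.
    have N : nbhs z (~` L) by move: clL; rewrite openE; exact.
    by apply: filterS N => y Ly; rewrite vL.
  rewrite /continuous_at -(nbhs_singleton E).
  exact: (cvg_trans (near_eq_cvg E) (cpsi z)).
have [s s0 hs] := compact_thicken cL oO LO.
exists v; split => //; last first.
  by move=> z; case: (vor z) => [|[Lz ->]]; [left|right; split => //; exact: LO].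
split => //; pose m := Num.min r (Num.min d s).
have m0 : 0 < m by rewrite !lt_min r0 d0.
have mr : m <= r by rewrite ge_min lexx.
have md : m <= d by rewrite !ge_min lexx orbT.
have ms : m <= s by rewrite !ge_min lexx !orbT.
exists m => // p b tp bm; case: (vor p) => [->|[Lp ->]].
  apply: le_trans (hpsi p b (thickenS mr tp) (le_trans bm mr)) _.
  by apply: mean_le => [||t _]; [exact: (circle_comp_cont (fun t => cpsi _))|exact: (circle_comp_cont (fun t => cv _))|].
apply: le_trans (su p b (LO _ Lp) (le_trans bm md)) _.
apply: mean_le => [||t _]; [exact: (circle_comp_cont (fun t => cu _))|exact: (circle_comp_cont (fun t => cv _))|].
apply: vu; apply: hs; exists p => //.
by rewrite /circle addrAC subrr add0r nrmZ modc_cis mul1r (le_trans bm).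
Qed.

End NearPsh.

(** * The Hahn-Banach theorem *)

Section HahnBanach.
Context {R : realType} {V : lmodType R} (B : set V).
Implicit Types (p : V -> R) (x y : V).
Hypothesis BD : forall x y, B x -> B y -> B (x + y).
Hypothesis BZ : forall (a : R) x, B x -> B (a *: x).

(** Functionals are total functions on V of which only the values on the
    subspace B matter; this avoids subspaces as types. *)
Definition sublinear p :=
  (forall x y, B x -> B y -> p (x + y) <= p x + p y) /\
  (forall (a : R) x, 0 <= a -> B x -> p (a *: x) = a * p x).

Lemma sublinear0 p x : B x -> sublinear p -> p 0 = 0.
Proof. by move=> Bx [_ h]; have := h 0 x (lexx _) Bx; rewrite scale0r mul0r. Qed.

Lemma sublinearN p x : B x -> sublinear p -> - p (- x) <= p x.
Proof.
move=> Bx sp; have BN : B (- x) by rewrite -scaleN1r; exact: BZ.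
by have := sp.1 x (- x) Bx BN; rewrite subrr (sublinear0 Bx sp) -lerBlDr sub0r.
Qed.

(** A sublinear functional below p with the least possible value at - y,
    namely - p y. *)
Definition tilt p y x : R := inf [set p (x + t *: y) - t * p y | t in [set t : R | 0 <= t]].

Lemma tilt_bounds p y x : sublinear p -> B y -> B x ->
  has_inf [set p (x + t *: y) - t * p y | t in [set t : R | 0 <= t]].
Proof.
move=> sp By Bx; split; first by exists (p (x + 0 *: y) - 0 * p y), 0 => //=.
have BN : B (- x) by rewrite -scaleN1r; exact: BZ.
exists (- p (- x)) => _ [t /= t0 <-].
have := sp.1 (x + t *: y) (- x) (BD Bx (BZ t By)) BN.
by rewrite addrAC subrr add0r (sp.2 t y t0 By); lra.
Qed.

Lemma tilt_le p y x (t : R) : sublinear p -> B y -> B x -> 0 <= t ->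
  tilt p y x <= p (x + t *: y) - t * p y.
Proof.
by move=> sp By Bx t0; apply: inf_lbound; [case: (tilt_bounds sp By Bx)|exists t].
Qed.

Lemma tilt_sublinear p y : sublinear p -> B y -> sublinear (tilt p y).
Proof.
move=> sp By; split=> [x x' Bx Bx'|a x].
  apply/ler_addgt0Pr => e e0; have e2 : 0 < e / 2 by rewrite divr_gt0.
  have [_ [t /= t0 <-] ht] := inf_adherent e2 (tilt_bounds sp By Bx).
  have [_ [s /= s0 <-] hs] := inf_adherent e2 (tilt_bounds sp By Bx').
  apply: le_trans (tilt_le sp By (BD Bx Bx') (addr_ge0 t0 s0)) _.
  have := sp.1 _ _ (BD Bx (BZ t By)) (BD Bx' (BZ s By)).
  rewrite addrACA -scalerDl; rewrite -/(tilt p y x) in ht; rewrite -/(tilt p y x') in hs; lra.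
rewrite le_eqVlt => /predU1P[<-|a0] Bx.
  rewrite scale0r mul0r; have B0 : B 0 by rewrite -(scale0r x); exact: BZ.
  apply/eqP; rewrite eq_le; apply/andP; split.
    have := tilt_le sp By B0 (lexx 0).
    by rewrite scale0r addr0 mul0r subr0 (sublinear0 Bx sp).
  apply: lb_le_inf; first by case: (tilt_bounds sp By B0).
  by move=> _ [t /= t0 <-]; rewrite add0r (sp.2 t y t0 By) subrr.
have key (b : R) (x' : V) : 0 < b -> B x' -> tilt p y (b *: x') <= b * tilt p y x'.
  move=> b0 Bx'; rewrite -ler_pdivrMl //.
  apply: lb_le_inf; first by case: (tilt_bounds sp By Bx').
  move=> _ [t /= t0 <-]; rewrite ler_pdivrMl //.
  apply: le_trans (tilt_le sp By (BZ b Bx') (mulr_ge0 (ltW b0) t0)) _.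
  by rewrite -scalerA -scalerDr (sp.2 _ _ (ltW b0) (BD Bx' (BZ t By))) mulrBr mulrA.
apply/eqP; rewrite eq_le key //=.
have := key a^-1 (a *: x); rewrite invr_gt0 => /(_ a0 (BZ a Bx)).
by rewrite scalerA mulVf ?gt_eqF // scale1r ler_pdivlMl.
Qed.

Lemma tilt_le_self p y x : sublinear p -> B y -> B x -> tilt p y x <= p x.
Proof.
by move=> sp By Bx; have := tilt_le sp By Bx (lexx 0); rewrite scale0r addr0 mul0r subr0.
Qed.

(** By Zorn's lemma. A chain is bounded below by x |-> inf p x, which is
    sublinear because any two members are comparable, and finite because p x
    >= - p (- x) >= - p0 (- x). *)
Lemma minimal_sublinear p0 : sublinear p0 -> exists p, [/\ sublinear p,
  forall x, B x -> p x <= p0 x &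
  forall q, sublinear q -> (forall x, B x -> q x <= p x) -> forall x, B x -> p x <= q x].
Proof.
move=> s0; pose T := {p | sublinear p /\ forall x, B x -> p x <= p0 x}.
pose r (p q : T) : bool := `[< forall x, B x -> sval q x <= sval p x >].
have t0 : T by exists p0.
have [|||[p [sp pp0]] hp] := @ZL_preorder T t0 r.
- by move=> t; apply/asboolP.
- move=> q p t /asboolP h1 /asboolP h2; apply/asboolP => x Bx.
  exact: le_trans (h2 x Bx) (h1 x Bx).
- move=> A tA; have [[a Aa]|nA] := pselect (exists a, A a); last first.
    by exists t0 => s As; exfalso; apply: nA; exists s.
  pose D x := [set sval q x | q in A].
  have hD x : B x -> has_inf (D x).
    move=> Bx; have BN : B (- x) by rewrite -scaleN1r; exact: BZ.
    split; first by exists (sval a x); exists a.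
    exists (- p0 (- x)) => _ [[q [sq qp]] Aq <-] /=.
    by apply: le_trans (sublinearN Bx sq); rewrite lerN2 qp.
  have [m mE] : exists m : V -> R, forall x, m x = inf (D x) by eexists.
  have mle x q : B x -> A q -> m x <= sval q x.
    by move=> Bx Aq; rewrite mE; apply: inf_lbound; [case: (hD x Bx)|exists q].
  have mlt x (e : R) : B x -> 0 < e -> exists2 q, A q & sval q x < m x + e.
    by move=> Bx e0; have [_ [q Aq <-] h] := inf_adherent e0 (hD x Bx); exists q; rewrite ?mE.
  have mge x (c : R) : B x -> (forall q, A q -> c <= sval q x) -> c <= m x.
    move=> Bx h; rewrite mE; apply: lb_le_inf; first by case: (hD x Bx).
    by move=> _ [q Aq <-]; exact: h.
  have sm : sublinear m.
    split=> [x y Bx By|b x b0 Bx].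
      apply/ler_addgt0Pr => e e0; have e2 : 0 < e / 2 by rewrite divr_gt0.
      have [q Aq hq] := mlt x _ Bx e2; have [q' Aq' hq'] := mlt y _ By e2.
      have [/asboolP rq|/asboolP rq] := tA q q' Aq Aq'.
        apply: le_trans (mle _ q' (BD Bx By) Aq') _.
        have := (svalP q').1.1 x y Bx By; have := rq x Bx; lra.
      apply: le_trans (mle _ q (BD Bx By) Aq) _.
      have := (svalP q).1.1 x y Bx By; have := rq y By; lra.
    apply/eqP; rewrite eq_le; apply/andP; split.
      move: b0; rewrite [in X in X -> _]le_eqVlt => /predU1P[<-|b0].
        by have := mle _ a (BZ 0 Bx) Aa; rewrite ((svalP a).1.2 0 x (lexx _) Bx) !mul0r.
      rewrite -ler_pdivrMl //; apply: mge => // q Aq; rewrite ler_pdivrMl //.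
      by have := mle _ q (BZ b Bx) Aq; rewrite ((svalP q).1.2 b x (ltW b0) Bx).
    apply: mge; first exact: BZ.
    by move=> q Aq; rewrite ((svalP q).1.2 b x b0 Bx) ler_wpM2l // mle.
  have mp0 x : B x -> m x <= p0 x.
    by move=> Bx; apply: le_trans (mle x a Bx Aa) _; exact: (svalP a).2.
  exists (exist _ m (conj sm mp0)) => s As; apply/asboolP => x Bx /=; exact: mle.
exists p; split => // q sq qp x Bx.
have qp0 : forall x, B x -> q x <= p0 x by move=> y By; apply: le_trans (qp y By) (pp0 y By).
have := hp (exist _ q (conj sq qp0)) => /(_ _)/asboolP; apply => //.
by apply/asboolP.
Qed.

(** A minimal sublinear functional l is below all its tilts, so that l x <= l
    (x + y) - l y: with subadditivity, l is additive. Choosing l below tilt p0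
    x0 forces l (- x0) <= - p0 x0, which is the equality at x0. *)
Lemma hahn_banach p0 x0 : sublinear p0 -> B x0 -> exists l : V -> R,
  [/\ forall x y, B x -> B y -> l (x + y) = l x + l y,
      forall (a : R) x, B x -> l (a *: x) = a * l x,
      forall x, B x -> l x <= p0 x & l x0 = p0 x0].
Proof.
move=> s0 B0; have [l [sl lt lmin]] := minimal_sublinear (tilt_sublinear s0 B0).
have lp0 x : B x -> l x <= p0 x by move=> Bx; apply: le_trans (lt x Bx) (tilt_le_self s0 B0 Bx).
have lD x y : B x -> B y -> l (x + y) = l x + l y.
  move=> Bx By; apply/eqP; rewrite eq_le sl.1 //=.
  (* Minimality of l against its tilt at y. *)
  have := lmin _ (tilt_sublinear sl By) (fun x => tilt_le_self sl By) x Bx.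
  by have := tilt_le sl By Bx ler01; rewrite scale1r mul1r; lra.
have BN x : B x -> B (- x) by rewrite -scaleN1r; exact: BZ.
have lN x : B x -> l (- x) = - l x.
  move=> Bx; apply/eqP; rewrite -subr_eq0 opprK -lD //; last exact: BN.
  by rewrite addNr (sublinear0 Bx sl).
exists l; split => //.
  move=> a x Bx; have [a0|a0] := leP 0 a; first exact: sl.2.
  rewrite -[in LHS](opprK a) scaleNr lN ?sl.2 ?oppr_ge0 ?(ltW a0) //; last exact: BZ.
  by rewrite mulNr opprK.
apply/eqP; rewrite eq_le lp0 //=.
have := le_trans (lt _ (BN _ B0)) (tilt_le s0 B0 (BN _ B0) ler01).
by rewrite scale1r addNr (sublinear0 B0 s0) mul1r sub0r lN // lerN2.
Qed.

End HahnBanach.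

(** * From a content to a Borel probability *)

Section RegularContent.
Context {R : realType} {n : nat} (X : set (Cn R n)) (nu : set (Cn R n) -> R).
Implicit Types (A B C O U : set (Cn R n)).
Hypothesis cX : compact X.
Hypothesis nuS : forall A B, A `&` X `<=` B -> nu A <= nu B.
Hypothesis nuU : forall A B, A `&` B = set0 -> nu (A `|` B) = nu A + nu B.
Hypothesis nuX : nu X = 1.

Lemma nu_set0 : nu set0 = 0.
Proof. by have := nuU (setI0 set0); rewrite setU0; lra. Qed.

Lemma nu_le1 A : nu A <= 1.
Proof. by rewrite -nuX; apply: nuS => z []. Qed.

Lemma nu_leU A B : nu (A `|` B) <= nu A + nu B.
Proof.
have -> : A `|` B = A `|` (B `\` A).
  by apply/seteqP; split=> z [Az|Bz]; [left| |left|right; case: Bz] => //; have [Az|nAz] := pselect (A z); [left|right].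
rewrite nuU; last by rewrite setDE setIA setIAC setICr set0I.
by rewrite lerD2l; apply: nuS => z [[]].
Qed.

Lemma nu_le_sum (F : nat -> set (Cn R n)) m : nu (\bigcup_(k < m) F k) <= \sum_(k < m) nu (F k).
Proof.
elim: m => [|m IH]; first by rewrite big_ord0 II0 bigcup_set0 nu_set0.
rewrite big_ord_recr /= IIS bigcup_setU bigcup_set1.
exact: le_trans (nu_leU _ _) (lerD IH (lexx _)).
Qed.

(** The inner regularization of nu on open sets, and the outer measure that it
    generates, are countably subadditive although nu is only finitely
    additive; compactness of X makes the difference. *)
Definition inner U : R := sup [set nu C | C in [set C | closed C /\ C `<=` U]].

Lemma inner_has_sup U : has_sup [set nu C | C in [set C | closed C /\ C `<=` U]].
Proof.
split; first by exists (nu set0), set0 => //; split => //; exact: closed0.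
by exists 1 => _ [C _ <-]; exact: nu_le1.
Qed.

Lemma inner_ge U C : closed C -> C `<=` U -> nu C <= inner U.
Proof. by move=> cC CU; apply: ub_le_sup; [case: (inner_has_sup U)|exists C]. Qed.

Lemma inner_le U (c : R) : (forall C, closed C -> C `<=` U -> nu C <= c) -> inner U <= c.
Proof.
move=> h; apply: ge_sup; first by case: (inner_has_sup U).
by move=> _ [C [cC CU] <-]; exact: h.
Qed.

Lemma inner_lt U (e : R) : 0 < e -> exists C, [/\ closed C, C `<=` U & inner U < nu C + e].
Proof.
move=> e0; have [_ [C [cC CU] <-] h] := sup_adherent e0 (inner_has_sup U).
by exists C; split => //; rewrite -ltrBlDr.
Qed.

Lemma inner_le_nu U : inner U <= nu U.
Proof. by apply: inner_le => C _ CU; apply: nuS => z [/CU]. Qed.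

Lemma innerS U V : U `<=` V -> inner U <= inner V.
Proof. by move=> UV; apply: inner_le => C cC CU; apply: inner_ge => //; exact: subset_trans UV. Qed.

Lemma inner_ge0 U : 0 <= inner U.
Proof. by rewrite -nu_set0; apply: inner_ge => //; exact: closed0. Qed.

(** Its complement is the union of the balls of radius r centred outside U. *)
Lemma closed_core U (r : R) : closed [set z | forall y, nrm (y - z) < r -> U y].
Proof.
rewrite -openC.
rewrite (_ : ~` _ = \bigcup_(y in ~` U) [set z | nrm (z - y) < r]); last first.
  apply/seteqP; split=> z /=.
    move=> /existsNP[y /not_implyP[yr nUy]]; exists y => //=; by rewrite nrmB.
  by move=> [y nUy /= zr] h; apply: nUy; apply: h; rewrite nrmB.
apply: bigcup_open => y _; rewrite openE => z /= zr.
apply/nbhs_nrm; exists (r - nrm (z - y)); first by rewrite subr_gt0.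
by move=> w hw /=; apply: le_lt_trans (nrm_tri _ _ z) _; lra.
Qed.

(** The closed cores of the U k at scale 1 / (m + 1) cover a neighbourhood of
    any given point of C as soon as m is large, so that by compactness one
    scale m and finitely many k suffice. *)
Lemma compact_shrink (U : nat -> set (Cn R n)) C : closed C -> (forall k, open (U k)) ->
  C `<=` \bigcup_k U k ->
  exists m (F : nat -> set (Cn R n)), [/\ forall k, closed (F k), forall k, F k `<=` U k &
    C `&` X `<=` \bigcup_(k < m) F k].
Proof.
move=> cC oU CU.
have cCX : compact (X `&` C) by exact: compact_closedI.
pose P (m : nat) (z : Cn R n) := exists2 k, (k < m)%N & forall y, nrm (y - z) < m.+1%:R^-1 -> U k y.
have H : \forall m \near \oo, X `&` C `<=` P m.
  apply: (compact_near_coveringP (X `&` C)).1 => //.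
  move=> x [_ /CU[k _ Ux]].
  have [r r0 hr] := open_nrm (oU k) Ux.
  have r2 : 0 < r / 2 by rewrite divr_gt0.
  exists ([set z | nrm (z - x) < r / 2], [set m : nat | (k < m)%N /\ m.+1%:R^-1 < r / 2]); first split.
  - by apply/nbhs_nrm; exists (r / 2).
  - near=> m; split; near: m; first exact: nbhs_infty_gt.
    by have := near_infty_natSinv_lt (PosNum r2).
  - move=> [z m] [/= zx [km mr]]; exists k => // y yz; apply: hr.
    by apply: le_lt_trans (nrm_tri _ _ z) _; rewrite (splitr r) ltrD // (lt_trans yz).
have [m _ hm] := H; exists m.
exists (fun k => [set z | forall y, nrm (y - z) < m.+1%:R^-1 -> U k y]); split.
- by move=> k; exact: closed_core.
- by move=> k z /= h; apply: h; rewrite subrr nrm0 invr_gt0.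
- by move=> z [Cz Xz]; have [k km h] := hm m (leqnn m) z (conj Xz Cz); exists k.
Unshelve. all: by end_near. Qed.

Lemma inner_bigcup (U : nat -> set (Cn R n)) : (forall k, open (U k)) ->
  ((inner (\bigcup_k U k))%:E <= \sum_(k <oo) (inner (U k))%:E)%E.
Proof.
move=> oU; apply/lee_addgt0Pr => e e0.
have [C [cC CU hC]] := inner_lt (\bigcup_k U k) e0.
have [m [F [cF FU CF]]] := compact_shrink cC oU CU.
apply: (@le_trans _ _ (\sum_(0 <= k < m) (inner (U k))%:E + e%:E)%E).
  rewrite sumEFin -EFinD lee_fin; apply: le_trans (ltW hC) _; rewrite lerD2r.
  apply: le_trans (nuS CF) _; apply: le_trans (nu_le_sum _ _) _.
  by rewrite big_mkord; apply: ler_sum => k _; exact: inner_ge.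
rewrite leeD2r //; apply: nneseries_lim_ge => k _ _; by rewrite lee_fin inner_ge0.
Qed.

Definition outer A : R := inf [set inner U | U in [set U | open U /\ A `<=` U]].

Lemma outer_has_inf A : has_inf [set inner U | U in [set U | open U /\ A `<=` U]].
Proof.
split; first by exists (inner setT), setT => //; split => //; exact: openT.
by exists 0 => _ [C _ <-]; exact: inner_ge0.
Qed.

Lemma outer_le A U : open U -> A `<=` U -> outer A <= inner U.
Proof. by move=> oU AU; apply: inf_lbound; [case: (outer_has_inf A)|exists U]. Qed.

Lemma outer_ge A (c : R) : (forall U, open U -> A `<=` U -> c <= inner U) -> c <= outer A.
Proof.
move=> h; apply: lb_le_inf; first by case: (outer_has_inf A).
by move=> _ [U [oU AU] <-]; exact: h.
Qed.

Lemma outer_lt A (e : R) : 0 < e -> exists U, [/\ open U, A `<=` U & inner U < outer A + e].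
Proof.
by move=> e0; have [_ [U [oU AU] <-] h] := inf_adherent e0 (outer_has_inf A); exists U.
Qed.

Lemma outer_open U : open U -> outer U = inner U.
Proof.
move=> oU; apply/eqP; rewrite eq_le outer_le //=.
by apply: outer_ge => V _; exact: innerS.
Qed.

Lemma outer_ge0 A : 0 <= outer A.
Proof. by apply: outer_ge => U _ _; exact: inner_ge0. Qed.

Lemma outerS A B : A `<=` B -> outer A <= outer B.
Proof. by move=> AB; apply: outer_ge => U oU BU; apply: outer_le => //; exact: subset_trans BU. Qed.

Lemma outer_set0 : outer set0 = 0.
Proof.
apply/eqP; rewrite eq_le outer_ge0 andbT -nu_set0.
by apply: le_trans (inner_le_nu _); apply: outer_le => //; exact: open0.
Qed.

Lemma outer_subadditive : sigma_subadditive (fun A => (outer A)%:E).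
Proof.
move=> F; apply/lee_addgt0Pr => e e0.
have : forall k, exists U, [/\ open U, F k `<=` U & inner U < outer (F k) + e / (2 ^ k.+1)%:R].
  by move=> k; apply: outer_lt; rewrite divr_gt0 // ltr0n expn_gt0.
move=> /choice[U hU].
apply: (@le_trans _ _ (\sum_(k <oo) (inner (U k))%:E)%E).
  apply: le_trans (inner_bigcup _); last by move=> k; case: (hU k).
  rewrite lee_fin; apply: outer_le.
    by apply: bigcup_open => k _; case: (hU k).
  by move=> z [k _ Fz]; exists k => //; case: (hU k) => _ + _; exact.
apply: le_trans (epsilon_trick xpredT _ (ltW e0)); last by move=> k; rewrite lee_fin outer_ge0.
apply: lee_nneseries => k _; first by rewrite lee_fin inner_ge0.
by rewrite -EFinD lee_fin; case: (hU k) => _ _ /ltW.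
Qed.

(** Open sets satisfy the condition of Caratheodory: fill the part of U inside
    O by a closed C, then the rest of U by a closed D inside U minus C; these
    are disjoint, and nu adds up. *)
Lemma outer_split A O : open O -> outer (A `&` O) + outer (A `&` ~` O) <= outer A.
Proof.
move=> oO; apply: outer_ge => U oU AU.
apply/ler_addgt0Pr => e e0; have e2 : 0 < e / 2 by rewrite divr_gt0.
have [C [cC CU hC]] := inner_lt (U `&` O) e2.
have oUC : open (U `&` ~` C) by apply: openI => //; exact: closed_openC.
have [D [cD DU hD]] := inner_lt (U `&` ~` C) e2.
have h1 : outer (A `&` O) <= inner (U `&` O) by apply: outer_le; [exact: openI|exact: setSI].
have h2 : outer (A `&` ~` O) <= inner (U `&` ~` C).
  by apply: outer_le => // z [/AU Uz nOz]; split => // /CU[].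
have h3 : nu C + nu D <= inner U.
  rewrite -nuU; last by apply/seteqP; split=> z // [Cz /DU[]].
  apply: inner_ge; first exact: closedU.
  by move=> z [/CU[]|/DU[]].
lra.
Qed.

(** The restriction of the outer measure to the Borel sets. It need not agree
    with nu, but the inequality on open sets determines the integrals of
    continuous functions. *)
Lemma regular_probability : exists P : probability (borelCn R n) R,
  P X = 1%E /\ forall O, open O -> (P O <= (nu O)%:E)%E.
Proof.
pose m (A : set (Cn R n)) : \bar R := (outer A)%:E.
have m0 : m set0 = 0%E by rewrite /m outer_set0.
have mge A : (0 <= m A)%E by rewrite lee_fin outer_ge0.
have mS : {homo m : A B / A `<=` B >-> (A <= B)%E} by move=> A B AB; rewrite lee_fin outerS.
pose mix := isOuterMeasure.Build R (Cn R n) m m0 mge mS outer_subadditive.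
pose mu : {outer_measure set (Cn R n) -> \bar R} := HB.pack m mix.
have mT : m setT = 1%E.
  rewrite /m; congr EFin; apply/eqP; rewrite eq_le outer_open; last exact: openT.
  apply/andP; split; first by apply: le_trans (inner_le_nu _) (nu_le1 _).
  by rewrite -nuX; apply: inner_ge => //; apply: compact_closed cX; exact: norm_hausdorff.
have mX : m X = 1%E.
  apply/eqP; rewrite eq_le; apply/andP; split; first by rewrite -mT lee_fin; exact: outerS.
  rewrite lee_fin; apply: outer_ge => U oU XU; rewrite -nuX; apply: inner_ge => //.
  by apply: compact_closed cX; exact: norm_hausdorff.
have cara A : <<s @open (Cn R n) >> A -> mu.-caratheodory A.
  move: A; apply: smallest_sub.
    split; first exact: caratheodory_measurable_set0.
    - by move=> A hA; rewrite setTD; exact: caratheodory_measurable_setC.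
    - by move=> A hA; exact: caratheodory_measurable_bigcup.
  move=> O oO; apply: le_caratheodory_measurable => A /=.
  by rewrite /mu /= /m -EFinD lee_fin; exact: outer_split.
pose mb : set (borelCn R n) -> \bar R := m.
have sa : semi_sigma_additive mb.
  move=> A mA tA mUA; apply: (@caratheodory_measure_sigma_additive R _ mu A) => //.
  - by move=> k; apply: cara; exact: mA.
  - by apply: cara.
pose mix1 := isMeasure.Build _ (borelCn R n) R mb m0 mge sa.
pose mb1 : {measure set (borelCn R n) -> \bar R} := HB.pack mb mix1.
pose mix2 := Measure_isProbability.Build _ (borelCn R n) R mb1 mT.
pose P : probability (borelCn R n) R := HB.pack mb mix1 mix2.
exists P; split; first exact: mX.
by move=> O oO; rewrite lee_fin outer_open //; exact: inner_le_nu.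
Qed.

End RegularContent.

(** * The Riesz representation theorem *)

Section Riesz.
Context {R : realType} {n : nat} (X : set (Cn R n)).
Implicit Types (f g G : Cn R n -> R) (A B O : set (Cn R n)).

(** The functionals below act on all functions that are bounded on X, so that
    indicator functions are available. *)
Definition bdd_on f := exists M : R, forall x, X x -> `|f x| <= M.

Lemma bdd_onD f g : bdd_on f -> bdd_on g -> bdd_on (fun x => f x + g x).
Proof.
move=> [M hM] [N hN]; exists (M + N) => x Xx.
by apply: le_trans (ler_normD _ _) _; rewrite lerD ?hM ?hN.
Qed.

Lemma bdd_onZ (a : R) f : bdd_on f -> bdd_on (fun x => a * f x).
Proof. by move=> [M hM]; exists (`|a| * M) => x Xx; rewrite normrM ler_wpM2l // hM. Qed.

Lemma bdd_on_cst (c : R) : bdd_on (fun=> c).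
Proof. by exists `|c|. Qed.

Lemma bdd_on_indic A : bdd_on (\1_A).
Proof. by exists 1 => x _; rewrite indicE normr_nat lern1 leq_b1. Qed.

Lemma bdd_on_continuous G : compact X -> continuous G -> bdd_on G.
Proof.
move=> cX cG; have [M _ hM] := compact_fun_bounded cX (continuous_subspaceT cG).
by exists M.
Qed.

Lemma measurable_continuous G (D : set (borelCn R n)) : continuous G ->
  measurable_fun D (G : borelCn R n -> R).
Proof.
move=> cG; apply: measurable_funTS.
apply: (measurability _ (RGenOInfty.measurableE R)) => _ [_ [a ->] <-].
rewrite setTI; apply: sub_sigma_algebra.
by apply: open_comp => //; exact: open_gt.
Qed.

(** The layer cake formula for the values 0 <= h <= N d, at resolution d. *)
Lemma step_bounds (d h : R) (N : nat) : 0 < d -> 0 <= h ->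
  let s := \sum_(k < N) d * (k.+1%:R * d < h)%R%:R in
  s <= h /\ (h <= N%:R * d -> h <= d + s).
Proof.
move=> d0 h0 s.
suff [h1 h2] : s <= Num.min h (N%:R * d) /\ Num.min h (N.+1%:R * d) - d <= s.
  split; first by apply: le_trans h1 _; rewrite ge_min lexx.
  move=> hN; move: h2; rewrite min_l; first by lra.
  by apply: le_trans hN _; rewrite ler_wpM2r ?ler_nat // ltW.
rewrite /s; elim: N {s} => [|N [IH1 IH2]].
  rewrite big_ord0 mul0r mul1r le_min h0 lexx /=; split => //.
  by rewrite subr_le0 ge_min lexx orbT.
rewrite big_ord_recr /=; move: IH1 IH2; rewrite -[N.+2%:R]natr1 -[N.+1%:R]natr1 !mulrDl !mul1r.
move: (\sum_(k < N) _) (N%:R * d) => S q.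
case: (ltP h q); case: (ltP h (q + d)); case: (ltP h (q + d + d));
  case: (ltP (q + d) h); rewrite ?mulr1 ?mulr0; lra.
Qed.

Variable l : (Cn R n -> R) -> R.
Hypothesis cX : compact X.
Hypothesis lD : forall f g, bdd_on f -> bdd_on g -> l (fun x => f x + g x) = l f + l g.
Hypothesis lZ : forall (a : R) f, bdd_on f -> l (fun x => a * f x) = a * l f.
Hypothesis l_le0 : forall f, bdd_on f -> (forall x, X x -> f x <= 0) -> l f <= 0.
Hypothesis l1 : l (fun=> 1) = 1.

Lemma functional_le f g : bdd_on f -> bdd_on g -> (forall x, X x -> f x <= g x) -> l f <= l g.
Proof.
move=> bf bg fg; have := @l_le0 (fun x => f x + (- 1) * g x) (bdd_onD bf (bdd_onZ _ bg)).
rewrite lD //; last exact: bdd_onZ.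
rewrite lZ // => h; suff : l f + -1 * l g <= 0 by lra.
by apply: h => x /fg; lra.
Qed.

Lemma functional_cst (c : R) : l (fun=> c) = c.
Proof.
by rewrite -[RHS]mulr1 -l1 -lZ; [congr l; apply/funext => x; rewrite mulr1|exact: bdd_on_cst].
Qed.

(** The functional applied to indicators gives a finitely additive nu, hence a
    probability P that is at most nu on open sets. For G >= 0 the layer cake
    formula with the open sets where G > k d shows that the integral of G is
    at most l G + d. Adding constants removes the sign condition on G, and the
    inequality for - G is the reverse one. *)
Lemma functional_measure : exists P : probability (borelCn R n) R,
  P X = 1%E /\ forall G, continuous G -> (\int[P]_(x in X) (G x)%:E = (l G)%:E)%E.
Proof.
pose nu A := l (\1_A).
have nuS A B : A `&` X `<=` B -> nu A <= nu B.
  move=> AB; apply: functional_le => [||x Xx]; [exact: bdd_on_indic|exact: bdd_on_indic|].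
  rewrite !indicE ler_nat; have [/set_mem Ax|//] := boolP (x \in A).
  by rewrite (mem_set (AB x (conj Ax Xx))).
have nuU A B : A `&` B = set0 -> nu (A `|` B) = nu A + nu B.
  move=> AB; rewrite /nu -lD; [|exact: bdd_on_indic|exact: bdd_on_indic].
  congr l; apply/funext => x; rewrite !indicE in_setU.
  have [/set_mem Ax|_] := boolP (x \in A); last by rewrite add0r.
  have [/set_mem Bx|_] := boolP (x \in B); last by rewrite addr0.
  by suff : set0 x by []; rewrite -AB.
have nuX : nu X = 1.
  apply/eqP; rewrite eq_le -[X in _ <= X]l1 -[X in _ && (X <= _)]l1.
  by apply/andP; split; apply: functional_le => [||x Xx];
    try exact: bdd_on_indic; try exact: bdd_on_cst; rewrite indicE (mem_set Xx).
have [P [PX PO]] := regular_probability cX nuS nuU nuX.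
exists P; split => //.
have oX : closed X by apply: compact_closed => //; exact: norm_hausdorff.
have mO O : open O -> measurable (O : set (borelCn R n)) by move=> oO; exact: sub_sigma_algebra.
have mX : measurable (X : set (borelCn R n)).
  by rewrite -(setCK X); apply: measurableC; apply: mO; exact: closed_openC.
have ic (c : R) : (\int[P]_(x in X) c%:E = c%:E)%E.
  transitivity (c%:E * P X)%E; last by rewrite PX mule1.
  exact: (integral_cst P mX c%:E).
have iG G : continuous G -> P.-integrable X (EFin \o (G : borelCn R n -> R)).
  move=> cG; have [M hM] := bdd_on_continuous cX cG.
  apply: measurable_bounded_integrable => //; first by apply: le_lt_trans (probability_le1 P mX) _; exact: ltry.
    exact: measurable_continuous.
  exists M; split; first exact: num_real.
  by move=> N MN x Xx; apply: le_trans (hM x Xx) (ltW MN).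
have pos G : continuous G -> (forall x, X x -> 0 <= G x) -> (\int[P]_(x in X) (G x)%:E <= (l G)%:E)%E.
  move=> cG G0; have [M hM] := bdd_on_continuous cX cG.
  apply/lee_addgt0Pr => d d0; pose N := Num.bound (M / d).
  have GN x : X x -> G x <= N%:R * d.
    move=> Xx; rewrite -ler_pdivrMr //.
    have Md : 0 <= M / d by rewrite divr_ge0 ?(ltW d0) // (le_trans _ (hM x Xx)).
    apply: le_trans (ltW (archi_boundP Md)).
    by rewrite ler_pM2r ?invr_gt0 //; apply: le_trans (ler_norm _) (hM x Xx).
  pose O k := [set x | k.+1%:R * d < G x].
  have oO k : open (O k).
    have /continuousP h := cG; exact: (h _ (@open_gt R (k.+1%:R * d))).
  pose S m (x : Cn R n) : R := \sum_(k < m) d * \1_(O k) x.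
  have S0 x : S 0%N x = 0 by rewrite /S big_ord0.
  have SS m x : S m.+1 x = S m x + d * \1_(O m) x by rewrite /S big_ord_recr.
  have SE m x : S m x = \sum_(k < m) d * (k.+1%:R * d < G x)%R%:R.
    apply: eq_bigr => k _; rewrite indicE; congr (_ * (nat_of_bool _)%:R).
    by apply/idP/idP => [/set_mem|/mem_set].
  have bO k : bdd_on (fun x => d * \1_(O k) x) by apply: bdd_onZ; exact: bdd_on_indic.
  (* The integral of a step function is at most the value of the functional,
     one layer at a time. *)
  have SP m : [/\ bdd_on (S m), forall x, 0 <= S m x,
      measurable_fun (X : set (borelCn R n)) (S m : borelCn R n -> R) &
      (\int[P]_(x in X) (S m x)%:E <= (l (S m))%:E)%E].
    elim: m => [|m [b1 b2 b3 b4]].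
      rewrite (_ : S 0%N = fun=> 0); last by apply/funext => x; rewrite S0.
      split => //; first exact: bdd_on_cst.
      by rewrite integral0_eq // functional_cst.
    have mI : measurable_fun (X : set (borelCn R n)) (fun x : borelCn R n => d * \1_(O m) x).
      apply: measurable_funM; first exact: measurable_cst.
      by apply: measurable_indic; exact: mO.
    have I0 x : 0 <= d * \1_(O m) x by rewrite mulr_ge0 ?(ltW d0) // indicE ler0n.
    rewrite (_ : S m.+1 = fun x => S m x + d * \1_(O m) x); last by apply/funext => x; rewrite SS.
    split; [exact: bdd_onD|by move=> x; rewrite addr_ge0|exact: measurable_funD|].
    rewrite lD // EFinD.
    under eq_integral do rewrite EFinD.
    rewrite ge0_integralD //=; last 4 first.
    - by move=> x _; rewrite lee_fin.
    - exact/measurable_EFinP.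
    - by move=> x _; rewrite lee_fin.
    - exact/measurable_EFinP.
    rewrite leeD //.
    under eq_integral do rewrite EFinM.
    rewrite ge0_integralZl_EFin //=; last 2 first.
    - by apply/measurable_EFinP; apply: measurable_indic; exact: mO.
    - exact: ltW.
    rewrite integral_indic //; last exact: mO.
    rewrite lZ; last exact: bdd_on_indic.
    rewrite EFinM lee_pmul2l //; apply: le_trans (PO _ (oO m)).
    by apply: le_measure; rewrite ?inE //; [apply: measurableI => //; exact: mO|exact: mO].
  have [b1 b2 b3 b4] := SP N.
  apply: (@le_trans _ _ (\int[P]_(x in X) (S N x + d)%:E)%E).
    apply: ge0_le_integral => //.
    - by apply/measurable_EFinP; exact: measurable_continuous.
    - by apply/measurable_EFinP; apply: measurable_funD => //; exact: measurable_cst.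
    move=> x Xx; rewrite lee_fin SE addrC.
    by have [_] := step_bounds N d0 (G0 x Xx); apply; exact: GN.
  under eq_integral do rewrite EFinD.
  rewrite ge0_integralD //=; last 3 first.
  - by move=> x _; rewrite lee_fin.
  - exact/measurable_EFinP.
  - by move=> x _; rewrite lee_fin ltW.
  rewrite ic leeD2r //.
  apply: le_trans b4 _; rewrite lee_fin; apply: functional_le => //.
    exact: bdd_on_continuous.
  by move=> x Xx; rewrite SE; have [] := step_bounds N d0 (G0 x Xx).
have le G : continuous G -> (\int[P]_(x in X) (G x)%:E <= (l G)%:E)%E.
  move=> cG; have [M hM] := bdd_on_continuous cX cG.
  have cGM : continuous (fun x => G x + M) by apply: continuous_addr => //; exact: cst_continuous.
  have := pos _ cGM; rewrite lD; [|exact: bdd_on_continuous|exact: bdd_on_cst].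
  rewrite functional_cst => h.
  have {h} : (\int[P]_(x in X) (G x + M)%:E <= (l G + M)%:E)%E.
    by apply: h => x /hM; rewrite ler_norml; lra.
  under eq_integral do rewrite EFinD.
  rewrite (integralD_EFin mX (iG G cG) (iG (fun=> M) (@cst_continuous _ _ M))).
  by rewrite ic EFinD leeD2rE.
move=> G cG; apply/eqP; rewrite eq_le le //=.
have cN : continuous (fun x => - G x).
  by apply: (@continuous_comp' _ _ _ (fun q : R => - q) G) => //; exact: opp_continuous.
have := le _ cN; under eq_integral do rewrite EFinN.
have -> : (fun x => - G x) = (fun x => (-1) * G x) by apply/funext => x; rewrite mulN1r.
rewrite lZ; last exact: bdd_on_continuous.
rewrite mulN1r integralN; last exact: (integrable_add_def mX (iG G cG)).
by rewrite EFinN leeN2.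
Qed.

End Riesz.

(** * Edwards' duality theorem *)

Section Edwards.
Context {R : realType} {n : nat} (X : set (Cn R n)).
Implicit Types (f g v w : Cn R n -> R) (z x : Cn R n).
Hypothesis cX : compact X.

(** The least - v z over the functions v that are plurisubharmonic near X with
    f <= - v on X. At f = - phi this is minus the supremum of v z over v <=
    phi; the signs make the functional sublinear. *)
Definition upper_env z (f : Cn R n -> R^o) : R :=
  inf [set - v z | v in [set v | near_psh X v /\ forall x, X x -> f x <= - v x]].

Lemma upper_env_inf z f : X z -> bdd_on X f ->
  has_inf [set - v z | v in [set v | near_psh X v /\ forall x, X x -> f x <= - v x]].
Proof.
move=> Xz [M hM]; split.
  exists (- - M), (fun=> - M) => //; split; first exact: near_psh_cst.
  by move=> x Xx; rewrite opprK; apply: le_trans (ler_norm _) (hM x Xx).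
by exists (f z) => _ [v [_ h] <-]; exact: h.
Qed.

Lemma upper_env_le z f v : X z -> bdd_on X f -> near_psh X v ->
  (forall x, X x -> f x <= - v x) -> upper_env z f <= - v z.
Proof.
by move=> Xz bf nv h; apply: inf_lbound; [case: (upper_env_inf Xz bf)|exists v].
Qed.

Lemma upper_env_lt z f (e : R) : X z -> bdd_on X f -> 0 < e -> exists v,
  [/\ near_psh X v, forall x, X x -> f x <= - v x & - v z < upper_env z f + e].
Proof.
move=> Xz bf e0; have [_ [v [nv h] <-] hv] := inf_adherent e0 (upper_env_inf Xz bf).
by exists v.
Qed.

Lemma upper_env_sublinear z : X z -> sublinear (bdd_on X : set (Cn R n -> R^o)) (upper_env z).
Proof.
move=> Xz; split=> [f g bf bg|a f a0 bf].
  apply/ler_addgt0Pr => e e0; have e2 : 0 < e / 2 by rewrite divr_gt0.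
  have [v [nv hv1 hv2]] := upper_env_lt Xz bf e2.
  have [w [nw hw1 hw2]] := upper_env_lt Xz bg e2.
  have := @upper_env_le z (f + g) _ Xz (bdd_onD bf bg) (near_psh_lin ler01 ler01 nv nw).
  move=> h; apply: le_trans (h _) _; last by rewrite !mul1r; lra.
  by move=> x Xx; have := hv1 x Xx; have := hw1 x Xx; rewrite !mul1r /= fctE; lra.
have key (b : R) h : 0 < b -> bdd_on X h -> upper_env z (b *: (h : Cn R n -> R^o)) <= b * upper_env z h.
  move=> b0 bh; apply/ler_addgt0Pr => e e0; have eb : 0 < e / b by rewrite divr_gt0.
  have [v [nv hv1 hv2]] := upper_env_lt Xz bh eb.
  have := @upper_env_le z (b *: (h : Cn R n -> R^o)) _ Xz (bdd_onZ b bh) (near_psh_affine 0 (ltW b0) nv).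
  move=> H; apply: le_trans (H _) _.
    by move=> x Xx; rewrite addr0 -mulrN; apply: ler_wpM2l; [exact: ltW|exact: hv1].
  rewrite addr0 -mulrN; have := hv2; rewrite -(ltr_pM2l b0) mulrDr => /ltW.
  by rewrite [b * (e / b)]mulrC divfK // gt_eqF.
move: a0; rewrite [in X in X -> _]le_eqVlt => /predU1P[<-|a0].
  rewrite scale0r mul0r; apply/eqP; rewrite eq_le; apply/andP; split.
    have := @upper_env_le z 0 _ Xz (bdd_on_cst X 0) (near_psh_cst X 0).
    by rewrite oppr0; apply.
  apply: lb_le_inf; first by case: (upper_env_inf Xz (bdd_on_cst X 0)).
  by move=> _ [v [_ h] <-]; exact: h.
apply/eqP; rewrite eq_le key //=.
have := key a^-1 (a *: (f : Cn R n -> R^o)); rewrite invr_gt0 => /(_ a0 (bdd_onZ a bf)).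
by rewrite scalerA mulVf ?gt_eqF // scale1r ler_pdivlMl.
Qed.

(** A linear functional l below upper_env satisfies v z <= l v for v
    plurisubharmonic near X, and is therefore integration against a Jensen
    measure for z. Choose l with l (- phi) = upper_env (- phi): as phi z is at
    most the integral of phi, which is l phi, it is at most the supremum of
    the v z over v <= phi. *)
Lemma edwards_pointwise phi z (e : R) : psh_compact X (EFin \o phi) ->
  {within X, continuous phi} -> X z -> 0 < e ->
  exists v, [/\ near_psh X v, forall x, X x -> v x <= phi x & phi z - e < v z].
Proof.
move=> [_ jphi] cphi Xz e0; have [g cg gphi] := extend_compact cX cphi.
have bg := bdd_on_continuous cX cg.
have [l [lD lZ lp lg]] := @hahn_banach R (Cn R n -> R^o) (bdd_on X) (@bdd_onD _ _ X)
  (@bdd_onZ _ _ X) _ (-1 *: (g : Cn R n -> R^o)) (upper_env_sublinear Xz) (bdd_onZ (-1) bg).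
have l_le0 f : bdd_on X f -> (forall x, X x -> f x <= 0) -> l f <= 0.
  move=> bf f0; apply: le_trans (lp f bf) _; rewrite -[leRHS]oppr0.
  by apply: (upper_env_le Xz bf (near_psh_cst X 0)) => x Xx; rewrite oppr0 f0.
have lc (c : R) : l (fun=> c) <= c.
  apply: le_trans (lp _ (bdd_on_cst X c)) _; rewrite -[leRHS]opprK.
  by apply: (upper_env_le Xz (bdd_on_cst X c) (near_psh_cst X (- c))) => x _; rewrite opprK.
have lN f : bdd_on X f -> l (fun x => -1 * f x) = - l f.
  by move=> bf; rewrite -[RHS]mulN1r -(lZ (-1) f bf).
have l1 : l (fun=> 1) = 1.
  apply/eqP; rewrite eq_le lc /=.
  have := lc (-1); rewrite (_ : (fun=> -1) = fun x : Cn R n => -1 * 1); last first.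
    by apply/funext => x; rewrite mulr1.
  by rewrite (lN (fun=> 1) (bdd_on_cst X 1)) lerN2.
have [P [PX PI]] := functional_measure cX lD lZ l_le0 l1.
have J : jensen_measure X z P.
  split => // u pu; have [F nF Fu] := near_psh_of_nbhd cX pu.
  rewrite (@eq_integral _ _ _ P X (fun x => (F x)%:E)); last first.
    by move=> x /set_mem Xx; rewrite Fu.
  rewrite (PI F nF.1) lee_fin -(Fu z Xz).
  have bF := bdd_on_continuous cX nF.1.
  rewrite -lerN2 -(lN F bF); apply: le_trans (lp _ (bdd_onZ (-1) bF)) _.
  by apply: (upper_env_le Xz (bdd_onZ (-1) bF) nF) => x _; rewrite mulN1r.
have := jphi z P Xz J.
rewrite (@eq_integral _ _ _ P X (fun x => (g x)%:E)); last first.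
  by move=> x /set_mem Xx /=; rewrite gphi.
rewrite (PI g cg) lee_fin => h.
have [v [nv hv1 hv2]] := upper_env_lt Xz (bdd_onZ (-1) bg) e0.
exists v; split => //.
  by move=> x Xx; have := hv1 x Xx; rewrite mulN1r lerN2 gphi.
move: lg; rewrite (lN g bg) => lg.
have : - v z < - l g + e by rewrite lg.
lra.
Qed.

(** The functions v <= phi that are plurisubharmonic near X are closed under
    maxima and come arbitrarily close to phi at every point of X; by
    compactness a finite maximum is uniformly close. *)
Lemma edwards phi (e : R) : psh_compact X (EFin \o phi) ->
  {within X, continuous phi} -> 0 < e ->
  exists2 v, near_psh X v & forall x, X x -> v x <= phi x < v x + e.
Proof.
move=> pphi cphi e0; have [g cg gphi] := extend_compact cX cphi.
pose C v := near_psh X v /\ forall x, X x -> v x <= phi x.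
have CM : exists v, C v.
  have [M hM] := bdd_on_continuous cX cg.
  exists (fun=> - M); split; first exact: near_psh_cst.
  by move=> x Xx; have := hM x Xx; rewrite gphi // ler_norml => /andP[].
have Cmax v w : C v -> C w -> C (fun x => Num.max (v x) (w x)).
  move=> [nv hv] [nw hw]; split; first exact: near_psh_max.
  by move=> x Xx; rewrite ge_max hv ?hw.
(* The sections of the family C, which is directed by maxima, generate a
   filter; near-covering along it selects one member of C for all points of X. *)
pose FF : set_system (Cn R n -> R) := fun A => exists2 v, C v & forall w, C w -> (forall x, v x <= w x) -> A w.
have FFF : Filter FF.
  split; first by have [v Cv] := CM; exists v.
    move=> A B [v Cv hv] [w Cw hw]; exists (fun x => Num.max (v x) (w x)); first exact: Cmax.
    move=> q Cq vwq; split.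
      by apply: hv => // x; apply: le_trans (vwq x); rewrite le_max lexx.
    by apply: hw => // x; apply: le_trans (vwq x); rewrite le_max lexx orbT.
  by move=> A B AB [v Cv hv]; exists v => // w Cw vw; apply: AB; exact: hv.
have [v Cv hv] : FF [set w | X `<=` [set x | g x - e < w x]].
  have := (compact_near_coveringP X).1 cX _ FF (fun w x => g x - e < w x) FFF.
  apply => z Xz.
  have [v [nv h1 h2]] := edwards_pointwise pphi cphi Xz e0.
  exists ([set x | g x - e < v x], [set w | forall x, v x <= w x]); last first.
    by move=> [x w] /= [gv vw]; exact: lt_le_trans gv (vw x).
  split; last by exists v.
  have cd : continuous (fun x => v x + (e - g x)).
    apply: continuous_addr; first exact: nv.1.
    apply: continuous_addr; first exact: cst_continuous.
    by apply: (@continuous_comp' _ _ _ (fun q : R => - q) g) => //; exact: opp_continuous.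
  have : nbhs z ((fun x => v x + (e - g x)) @^-1` [set q | 0 < q]).
    by apply: cd; apply: lt_nbhsr; rewrite gphi //; lra.
  by apply: filterS => x /=; lra.
exists v; first exact: Cv.1.
move=> x Xx; rewrite Cv.2 //=; have := hv v Cv (fun x => lexx _) x Xx.
by rewrite /= gphi //; lra.
Qed.

End Edwards.

(** * The maximum principle *)

Section MaxPrinciple.
Context {R : realType} {n : nat}.
Implicit Types (p z b x y : Cn R n) (f g v w : Cn R n -> R) (K X Omega : set (Cn R n)).

Lemma compact_neg K f : compact K -> continuous f -> (forall z, K z -> f z < 0) ->
  exists2 s : R, 0 < s & forall z, K z -> f z <= - s.
Proof.
move=> cK cf f0; have [K0|K0] := pselect (K !=set0); last first.
  by exists 1 => // z Kz; exfalso; apply: K0; exists z.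
have [c /set_mem Kc hc] := compact_EVT_max K0 cK (continuous_subspaceT cf).
exists (- f c); first by rewrite oppr_gt0 f0.
by move=> z Kz; rewrite opprK; apply: hc; exact: mem_set.
Qed.

Lemma continuous_opp f : continuous f -> continuous (fun z => - f z).
Proof. by move=> cf; apply: (@continuous_comp' _ _ _ (fun q : R => - q) f) => //; exact: opp_continuous. Qed.

Lemma compact_sublevel K f (c : R) : compact K -> continuous f -> compact (K `&` [set z | f z <= c]).
Proof.
move=> cK cf; apply: compact_closedI => //.
have /continuous_closedP h := cf; exact: (h _ (@closed_le R c)).
Qed.

(** On discs inside Omega, phi inherits the submean inequality from its
    uniform approximants near closure Omega. If the maximum over closure Omega
    were attained in Omega, the set where it is attained would be open and
    closed in Omega, and phi would be constant. So it is attained on the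
    boundary only, where phi = 0. *)
Lemma max_principle Omega phi : open Omega -> connected Omega -> compact (closure Omega) ->
  psh_compact (closure Omega) (EFin \o phi) -> {within closure Omega, continuous phi} ->
  ~ (exists c : R, forall z, closure Omega z -> phi z = c) ->
  (forall z, topological_boundary Omega z -> phi z = 0) ->
  forall z, Omega z -> phi z < 0.
Proof.
move=> oO conO cX pphi cphi nphi bphi z0 Oz0.
set X := closure Omega in cX pphi cphi nphi.
have OX : Omega `<=` X by exact: subset_closure.
have [g cg gphi] := extend_compact cX cphi.
have sub p b : disc_in p b Omega -> g p <= cavg g p b.
  move=> pb; apply/ler_addgt0Pr => e e0.
  have [v nv hv] := edwards cX pphi cphi e0.
  have [V [oV XV pV]] := near_psh_psh nv.
  have Xp : X p by apply: OX; exact: disc_in_center pb.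
  have /andP[_ h] := hv p Xp; rewrite gphi //; apply: ltW; apply: lt_le_trans h _.
  rewrite lerD2r; have sv := (psh_cont_submean (fun z _ => nv.1 z)).1 pV.
  apply: le_trans (sv p b _) _; first by move=> a /pb /OX /XV.
  apply: mean_le => [||t _]; [exact: (circle_comp_cont (fun t => nv.1 _))|exact: (circle_comp_cont (fun t => cg _))|].
  have Xt : X (circle p b t) by apply: OX; exact: disc_in_circle.
  by rewrite gphi //; case/andP: (hv _ Xt).
have X0 : X !=set0 by exists z0; exact: OX.
have [c /set_mem Xc hc] := compact_EVT_max X0 cX (continuous_subspaceT cg).
have gc z : X z -> g z <= g c by move=> Xz; apply: hc; exact: mem_set.
have nmax z : Omega z -> g z < g c.
  move=> Oz; rewrite lt_neqAle gc ?andbT; last exact: OX.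
  apply/eqP => gzc.
  pose B := Omega `&` [set y | g y = g c].
  suff BO : B = Omega.
    apply: nphi; exists (g c) => y Xy; rewrite -gphi //.
    suff : closed [set y | g y = g c] by apply; move: Xy; apply: closureS; rewrite -BO => ? [].
    have /continuous_closedP h := cg; exact: (h _ (@closed_eq R (g c))).
  apply: conO; first by exists z.
    exists B; last by rewrite setIA setIid.
    rewrite openE => p [Op gp]; have [r r0 hr] := open_nrm oO Op.
    apply/nbhs_nrm; exists r => // q qr; split; first exact: hr.
    have [b bE] : exists b, b = cis (- 1) *: (q - p) by eexists.
    have nb : nrm b = nrm (q - p) by rewrite bE nrmZ modc_cis mul1r.
    have db : disc_in p b Omega.
      move=> a a1; apply: hr; rewrite addrAC subrr add0r nrmZ nb.
      by apply: le_lt_trans qr; rewrite ler_piMl // nrm_ge0.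
    have qE : q = circle p b 1.
      by rewrite /circle bE scalerA -cisD subrr cis0 scale1r addrC subrK.
    have ch : continuous (fun t => g (circle p b t)) by exact: (circle_comp_cont (fun t => cg _)).
    have chc : continuous (fun t => g c - g (circle p b t)).
      by move=> t; apply: cvgB; [exact: cvg_cst|exact: ch].
    have Xt t : X (circle p b t) by apply: OX; exact: disc_in_circle.
    apply/eqP; rewrite /= eq_le gc ?leNgt /=; last by apply: OX; exact: hr.
    apply/negP => gq; have : 0 < mean (fun t => g c - g (circle p b t)).
      apply: (@mean_gt0 _ _ 1) => //.
      - by move=> t; rewrite subr_ge0; exact: gc (Xt t).
      - by have := @pi_ge2 R; lra.
      - by rewrite -qE subr_gt0; exact: gq.
    rewrite meanB //; last exact: cst_continuous.
    by rewrite mean_cst subr_gt0; have := sub p b db; rewrite gp /cavg; lra.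
  exists [set y | g y = g c] => //.
  have /continuous_closedP h := cg; exact: (h _ (@closed_eq R (g c))).
have Oc : ~ Omega c by move=> /nmax; rewrite ltxx.
have gc0 : g c = 0.
  rewrite gphi //; apply: bphi; split => //.
  by move=> /interior_subset.
by rewrite -(gphi z0 (OX z0 Oz0)) -gc0; exact: nmax.
Qed.

End MaxPrinciple.

(** * Decreasing smooth approximants *)

Section Approximation.
Context {R : realType} {n : nat}.
Implicit Types (p z b x y : Cn R n) (f g v w rho psi : Cn R n -> R) (K X E Omega : set (Cn R n)).
Implicit Type u : Cn R n -> \bar R.

Lemma continuous_gap f g K : compact K -> continuous f -> continuous g ->
  (forall z, K z -> f z < g z) -> exists2 e : R, 0 < e & forall z, K z -> f z + e <= g z.
Proof.
move=> cK cf cg fg.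
have cd : continuous (fun z => f z + - g z) by apply: continuous_addr => //; exact: continuous_opp.
have [|e e0 he] := compact_neg cK cd; first by move=> z /fg; lra.
by exists e => // z /he; lra.
Qed.

Lemma smooth_psh_between X E f g : compact X -> near_psh X f -> compact E -> E `<=` X -> continuous g ->
  (forall z, E z -> f z < g z) ->
  exists w, [/\ continuous w, smooth_psh_near X w, forall z, X z -> f z < w z &
    forall z, E z -> w z < g z].
Proof.
move=> cX nf cE EX cg fg.
have [e e0 he] := continuous_gap cE nf.1 cg fg.
have e4 : 0 < e / 4 by rewrite divr_gt0.
have [w [cw sw hw]] := smooth_approx cX (near_psh_affine (e / 2) ler01 nf) e4.
exists w; split => // z Xz; first by have := hw z Xz; rewrite mul1r ler_norml; lra.
by have := hw z (EX _ Xz); have := he z Xz; rewrite mul1r ler_norml; lra.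
Qed.

(** Regularize u near the compact set where rho <= - t1, below min (g, m).
    There the regularization is less than m, hence less than psi where
    moreover rho >= - t2: it can be glued with psi, and the result smoothed.
    Where the result is not known to dominate u by construction, namely for
    rho = - t1, it is at least psi >= m > u. *)
Lemma smooth_psh_squeeze X Omega rho u psi g E (t1 t2 m : R) : compact X -> open Omega -> Omega `<=` X ->
  psh Omega u -> continuous rho -> (forall z, X z -> ~ Omega z -> 0 <= rho z) ->
  0 < t1 -> t1 < t2 ->
  (forall z, X z -> rho z <= - t1 -> (u z < m%:E)%E) ->
  near_psh X psi -> (forall z, X z -> - t2 <= rho z -> m <= psi z) ->
  continuous g -> (forall z, X z -> rho z <= - t1 -> (u z < (g z)%:E)%E) ->
  compact E -> E `<=` X -> (forall z, E z -> psi z < g z) ->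
  exists w, [/\ continuous w, smooth_psh_near X w,
    forall z, X z -> rho z <= - t1 -> (u z < (w z)%:E)%E,
    forall z, X z -> psi z < w z & forall z, E z -> w z < g z].
Proof.
move=> cX oO OX pu crho rho0 t10 t12 um npsi mpsi cg ug cE EX psig.
pose L' := X `&` [set z | rho z <= - t1]; have cL' : compact L' by exact: compact_sublevel.
pose L := X `&` [set z | rho z <= - t2]; have cL : compact L by exact: compact_sublevel.
have L'O : L' `<=` Omega.
  move=> z [Xz rz]; have [//|nO] := pselect (Omega z).
  by have := rho0 z Xz nO; rewrite /= in rz; lra.
have cmin : continuous (fun z => Num.min (g z) m).
  by apply: continuous_minr => //; exact: cst_continuous.
have umin z : L' z -> (u z < (Num.min (g z) m)%:E)%E.
  by move=> [Xz rz]; rewrite EFin_min lt_min ug ?um.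
have [w0 [d [d0 cw0 sw0 uw0 w0g]]] := psh_regularize oO pu cL' L'O cmin umin.
pose O := Omega `&` [set z | rho z < - t1].
have OL' z : O z -> L' z by move=> [/OX Xz /= rz]; split => //=; exact: ltW.
have oO' : open O.
  apply: openI => //; have /continuousP h := crho; exact: (h _ (@open_lt R (- t1))).
have LO : L `<=` O.
  move=> z [Xz /= rz]; split; last by rewrite /=; lra.
  by apply: L'O; split => //=; lra.
have w0psi z : O z -> ~ L z -> w0 z <= psi z.
  move=> Oz nLz; have [Xz rz] := OL' z Oz.
  apply: le_trans (ltW (w0g z (OL' z Oz))) _.
  have : m <= psi z.
    by apply: mpsi => //; rewrite leNgt; apply/negP => h; apply: nLz; split => //=; exact: ltW.
  by apply: le_trans; rewrite ge_min lexx orbT.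
have [v [nv psiv w0v vor]] := near_psh_glue npsi oO' cL LO cw0 d0
  (fun p b Op => sw0 p b (OL' p Op)) w0psi.
have [|w [cw sw vw wg]] := @smooth_psh_between X E v g cX nv cE EX cg.
  move=> z Ez; case: (vor z) => [->|[Oz ->]]; first exact: psig.
  by apply: lt_le_trans (w0g z (OL' z Oz)) _; rewrite ge_min lexx.
exists w; split => //.
- move=> z Xz; rewrite le_eqVlt => /predU1P[rz|rz].
    apply: lt_trans (um z Xz _) _; first by rewrite rz.
    rewrite lte_fin; apply: le_lt_trans (vw z Xz); apply: le_trans (psiv z).
    by apply: mpsi => //; rewrite rz lerN2 ltW.
  have Oz : O z by split => //; apply: L'O; split => //=; exact: ltW.
  apply: le_lt_trans (uw0 z (OL' z Oz)) _; rewrite lte_fin.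
  exact: le_lt_trans (w0v z Oz) (vw z Xz).
- by move=> z Xz; exact: le_lt_trans (psiv z) (vw z Xz).
Qed.

(** Choose the (j + 1)-st function below the minimum of the j-th one and of a
    continuous G j, where the G j decrease to u on L. *)
Lemma decreasing_smooth_approx X L E u : compact L -> usc_on L u -> E `<=` L ->
  (forall g, continuous g -> (forall z, L z -> (u z < (g z)%:E)%E) ->
    exists w, [/\ continuous w, smooth_psh_near X w,
      forall z, L z -> (u z < (w z)%:E)%E & forall z, E z -> w z < g z]) ->
  exists us : nat -> Cn R n -> R, (forall j, smooth_psh_near X (us j)) /\ decreases_to E us u.
Proof.
move=> cL usc EL H.
have [G [cG dG uG Glt]] := usc_approx cL usc.
pose good w := [/\ continuous w, smooth_psh_near X w & forall z, L z -> (u z < (w z)%:E)%E].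
have step (j : nat) (w : {w | good w}) : exists w' : {w | good w},
    forall z, E z -> sval w' z < sval w z /\ sval w' z < G j z.
  have [cw _ uw] := svalP w.
  have cm : continuous (fun z => Num.min (sval w z) (G j z)) by exact: continuous_minr.
  have [z Lz|w' [h1 h2 h3 h4]] := H _ cm; first by rewrite EFin_min lt_min uw ?uG.
  exists (exist good w' (And3 h1 h2 h3)) => z /h4; rewrite lt_min => /andP[] //.
have : forall jw : nat * {w | good w}, exists s' : {w | good w}, forall z, E z ->
    sval s' z < sval jw.2 z /\ sval s' z < G jw.1 z by case=> j s; exact: step.
move=> /choice[f hf].
have [s0 _] : exists s0 : {w | good w}, True.
  have [w [h1 h2 h3 _]] := H _ (cG 0%N) (uG 0%N).
  by exists (exist good w (And3 h1 h2 h3)).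
pose W := fix W (j : nat) : {w | good w} := if j is k.+1 then f (k, W k) else s0.
exists (fun j => sval (W j)); split; first by move=> j; case: (svalP (W j)).
move=> z Ez; have Lz := EL _ Ez.
have ni : nonincreasing_seq (fun j => sval (W j) z).
  by apply/nonincreasing_seqP => j /=; have [h _] := hf (j, W j) z Ez; exact: ltW.
split => //.
have uW j : (u z < (sval (W j) z)%:E)%E by have [_ _ h] := svalP (W j); exact: h.
have GW j : sval (W j.+1) z < G j z by have [] := hf (j, W j) z Ez.
have Glt' (c : R) : (u z < c%:E)%E -> \forall j \near \oo, sval (W j) z < c.
  move=> uc; have [j0 hj0] := Glt z c Lz uc.
  exists j0.+1 => // j /= j0j; apply: le_lt_trans (ni _ _ j0j) _.
  exact: lt_trans (GW j0) hj0.
have niE : nonincreasing_seq (fun j => (sval (W j) z)%:E).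
  by move=> i j ij; rewrite lee_fin; exact: ni.
have := ereal_nonincreasing_cvgn niE.
have Ige : (u z <= ereal_inf (range (fun j => (sval (W j) z)%:E)))%E.
  by apply: le_ereal_inf_tmp => _ [j _ <-]; exact: ltW.
have Ile (c : R) : (u z < c%:E)%E -> (ereal_inf (range (fun j => (sval (W j) z)%:E)) <= c%:E)%E.
  move=> /Glt'[j _ /(_ j (leqnn j)) h]; apply: le_trans (ltW _ : ((sval (W j) z)%:E <= c%:E)%E).
    by apply: ereal_inf_lbound; exists j.
  by rewrite lte_fin.
move: Ige Ile; move: (ereal_inf _) => I Ige Ile.
suff -> : I = u z by [].
apply/eqP; rewrite eq_le Ige andbT leNgt; apply/negP => uI.
have [c uc cI] : exists2 c : R, (u z < c%:E)%E & (c%:E < I)%E.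
  move: uI; case: (I) => [r||].
  - by move=> /lt_between[c uc cr]; exists c.
  - by move=> _; exists (G 0%N z); [exact: uG|exact: ltry].
  - by rewrite ltNge leNye.
by have := Ile c uc; rewrite leNgt cI.
Qed.



(** The competitor psi is A phi + B, with phi replaced by an approximant near
    X. As phi separates K from the boundary, a large A makes psi at least a
    bound of u where rho >= - 2 t, and at most any prescribed constant on K. *)
Lemma compact_approx X Omega rho phi u K : compact X -> open Omega -> Omega `<=` X ->
  psh_compact X (EFin \o phi) -> {within X, continuous phi} ->
  continuous rho -> (forall z, X z -> rho z = phi z) ->
  (forall z, X z -> ~ Omega z -> rho z = 0) -> (forall z, Omega z -> rho z < 0) ->
  psh Omega u -> compact K -> K `<=` Omega ->
  exists us : nat -> Cn R n -> R, (forall j, smooth_psh_near X (us j)) /\ decreases_to K us u.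
Proof.
move=> cX oO OX pphi cphi crho rphi rho0 rhon pu cK KO.
have [s s0 hs] := compact_neg cK crho (fun z Kz => rhon z (KO z Kz)).
pose t := s / 4; have t0 : 0 < t by rewrite divr_gt0.
pose L := X `&` [set z | rho z <= - t]; have cL : compact L by exact: compact_sublevel.
have LO : L `<=` Omega.
  move=> z [Xz rz]; have [//|nO] := pselect (Omega z).
  by have := rho0 z Xz nO; rewrite /= in rz; lra.
have KL : K `<=` L.
  by move=> z Kz; split; [exact/OX/KO|have := hs z Kz; rewrite /= /t; lra].
have uscL : usc_on L u by apply: usc_onS LO _; case: pu.
have [G [cG _ uG _]] := usc_approx cL uscL.
have [m m0 hm] := compact_fun_bounded cL (continuous_subspaceT (cG 0%N)).
have um z : X z -> rho z <= - t -> (u z < m%:E)%E.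
  move=> Xz rz; apply: lt_le_trans (uG 0%N z (conj Xz rz)) _; rewrite lee_fin.
  exact: le_trans (ler_norm _) (hm z (conj Xz rz)).
apply: (decreasing_smooth_approx cL uscL KL) => g cg ug.
have [M M0 hM] := compact_fun_bounded cK (continuous_subspaceT cg).
(* Such that A t exceeds m plus the bound M of g on K. *)
pose A := (m + M + 1) / t.
have A0 : 0 < A by rewrite divr_gt0 // !addr_gt0.
have At : A * t = m + M + 1 by rewrite divfK // gt_eqF.
have [psi0 npsi0 hpsi0] := edwards cX pphi cphi t0.
pose psi z := A * psi0 z + (m + A * t * 3).
have psim z : X z -> - (2 * t) <= rho z -> m <= psi z.
  move=> Xz rz; have /andP[_] := hpsi0 z Xz; rewrite -rphi // => h.
  have : A * (- (3 * t)) <= A * psi0 z by rewrite ler_pM2l //; lra.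
  by rewrite mulrN mulrCA At /psi At; lra.
have psig z : K z -> psi z < g z.
  move=> Kz; have Xz : X z by exact/OX/KO.
  have /andP[h _] := hpsi0 z Xz; rewrite -rphi // in h.
  have := hM z Kz; rewrite ler_norml => /andP[gM _].
  have rz : rho z <= - (4 * t) by have := hs z Kz; rewrite /t; lra.
  have : A * psi0 z <= A * (- (4 * t)) by rewrite ler_pM2l //; exact: le_trans rz.
  by rewrite mulrN mulrCA At /psi At; lra.
have tt : t < 2 * t by lra.
have rho0' z : X z -> ~ Omega z -> 0 <= rho z by move=> Xz /(rho0 z Xz)->.
have [w [cw sw uw _ wg]] := smooth_psh_squeeze cX oO OX pu crho rho0' t0 tt um
  (near_psh_affine (m + A * t * 3) (ltW A0) npsi0) psim cg (fun z Xz rz => ug z (conj Xz rz)) cK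
  (subset_trans KO OX) psig.
by exists w; split => // z [Xz rz]; exact: uw.
Qed.

(** Give u the constant value c > M on X outside Omega: the extended function
    is upper semicontinuous on X, and continuous majorants g of it exceed c
    near the boundary of Omega. Now psi is close to A phi + c; a large A
    pushes it below g on the compact set Q where g does not exceed c by 2 eta,
    and psi >= c remains true in a thin layer - t <= rho, whose width is
    chosen after A. *)
Lemma bounded_approx X Omega rho phi u (M : R) : compact X -> open Omega -> Omega `<=` X ->
  psh_compact X (EFin \o phi) -> {within X, continuous phi} ->
  continuous rho -> (forall z, X z -> rho z = phi z) ->
  (forall z, X z -> ~ Omega z -> rho z = 0) -> (forall z, Omega z -> rho z < 0) ->
  psh Omega u -> (forall z, Omega z -> (u z <= M%:E)%E) ->
  exists us : nat -> Cn R n -> R, (forall j, smooth_psh_near X (us j)) /\ decreases_to Omega us u.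
Proof.
move=> cX oO OX pphi cphi crho rphi rho0 rhon pu uM.
pose c := M + 1.
have rle z : X z -> rho z <= 0.
  by move=> Xz; have [/rhon/ltW//|/(rho0 z Xz)->] := pselect (Omega z).
have uc z : Omega z -> (u z < c%:E)%E.
  by move=> /uM h; apply: le_lt_trans h _; rewrite lte_fin /c; lra.
have [u' u'E] : exists u' : Cn R n -> \bar R, forall z, u' z = if pselect (Omega z) then u z else c%:E by eexists.
have u'O z : Omega z -> u' z = u z by rewrite u'E; case: pselect.
have u'c z : ~ Omega z -> u' z = c%:E by rewrite u'E; case: pselect.
have u'le z : (u' z <= c%:E)%E.
  by have [Oz|nO] := pselect (Omega z); [rewrite u'O // ltW // uc|rewrite u'c].
have usc' : usc_on X u'.
  apply/usc_onP => x Xx; split; first exact: le_lt_trans (u'le x) (ltry _).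
  move=> d; have [Ox|nO] := pselect (Omega x).
    rewrite u'O // => ud; have usc := pu.1; move/usc_onP in usc.
    have N : nbhs x Omega by rewrite openE in oO; exact: oO.
    apply: filterS (filterI N ((usc x Ox).2 d ud)) => y [Oy h] _.
    by rewrite u'O //; exact: h.
  rewrite (u'c x nO) => cd; apply: filterS (@filterT _ _ _) => y _ _; exact: le_lt_trans (u'le y) cd.
have [us [sus dus]] : exists us : nat -> Cn R n -> R,
    (forall j, smooth_psh_near X (us j)) /\ decreases_to X us u'; last first.
  by exists us; split => // z Oz; rewrite -u'O //; apply: dus; exact: OX.
apply: (decreasing_smooth_approx cX usc' (fun z Xz => Xz)) => g cg ug.
have cB : compact (X `&` ~` Omega).
  by apply: compact_closedI => //; exact: open_closedC.
have [|e e0 he] := @continuous_gap (fun=> c) g _ cB (@cst_continuous _ _ c) cg.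
  by move=> z [Xz nO]; have := ug z Xz; rewrite u'c // lte_fin.
(* Outside Q there is room for 2 eta between c and g. *)
pose eta := e / 4; have eta0 : 0 < eta by rewrite divr_gt0.
pose Q := X `&` [set z | g z <= c + 2 * eta]; have cQ : compact Q by exact: compact_sublevel.
have QO : Q `<=` Omega.
  move=> z [Xz /= gz]; have [//|nO] := pselect (Omega z).
  by have := he z (conj Xz nO); rewrite /eta in gz; lra.
have [s s0 hs] := compact_neg cQ crho (fun z Qz => rhon z (QO z Qz)).
have [N N0 hN] := compact_fun_bounded cX (continuous_subspaceT cg).
pose A := (`|c| + 2 * eta + N + 1) / s.
have A0 : 0 < A by rewrite divr_gt0 //; have := normr_ge0 c; lra.
have As : A * s = `|c| + 2 * eta + N + 1 by rewrite divfK // gt_eqF.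
pose t := eta / A; have t0 : 0 < t by rewrite divr_gt0.
have At : A * t = eta by rewrite mulrC divfK // gt_eqF.
have [psi0 npsi0 hpsi0] := edwards cX pphi cphi t0.
pose psi z := A * psi0 z + (c + 2 * eta).
have psic z : X z -> - t <= rho z -> c <= psi z.
  move=> Xz rz; have /andP[_] := hpsi0 z Xz; rewrite -rphi // => h.
  have : A * (- (2 * t)) <= A * psi0 z by rewrite ler_pM2l //; lra.
  by rewrite mulrN mulrCA At /psi; lra.
have psig z : X z -> psi z < g z.
  move=> Xz; have /andP[h _] := hpsi0 z Xz; rewrite -rphi // in h.
  have h' : A * psi0 z <= A * rho z by rewrite ler_pM2l.
  have [gz|gz] := leP (g z) (c + 2 * eta); last first.
    have : A * rho z <= 0 by rewrite pmulr_rle0 // rle.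
    by rewrite /psi; lra.
  have : A * rho z <= A * (- s) by rewrite ler_pM2l // hs.
  have := hN z Xz; rewrite ler_norml => /andP[gN _]; have := ler_norm c.
  by rewrite mulrN As /psi; lra.
have t2 : 0 < t / 2 by rewrite divr_gt0.
have t2t : t / 2 < t by lra.
have rO z : X z -> rho z <= - (t / 2) -> Omega z.
  move=> Xz rz; have [//|nO] := pselect (Omega z).
  by have := rho0 z Xz nO; lra.
have uc' z : X z -> rho z <= - (t / 2) -> (u z < c%:E)%E by move=> Xz /(rO z Xz); exact: uc.
have ug' z : X z -> rho z <= - (t / 2) -> (u z < (g z)%:E)%E.
  by move=> Xz /(rO z Xz) Oz; rewrite -u'O //; exact: ug.
have rho0' z : X z -> ~ Omega z -> 0 <= rho z by move=> Xz /(rho0 z Xz)->.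
have [w [cw sw uw psiw wg]] := smooth_psh_squeeze cX oO OX pu crho rho0' t2 t2t uc'
  (near_psh_affine (c + 2 * eta) (ltW A0) npsi0) psic cg ug' cX (fun z Xz => Xz) psig.
exists w; split => // z Xz.
have [rz|rz] := leP (rho z) (- (t / 2)).
  by rewrite u'O; [exact: uw|exact: rO].
apply: le_lt_trans (u'le z) _; rewrite lte_fin; apply: le_lt_trans (psiw z Xz).
by apply: psic => //; lra.
Qed.

End Approximation.

Theorem theorem3 (R : realType) (n : nat) (Omega : set (Cn R n))
    (u : Cn R n -> \bar R) :
  P_hyperconvex Omega -> psh Omega u ->
  (forall E : set (Cn R n), relatively_compact_in E Omega ->
     exists us : nat -> Cn R n -> R,
       (forall j, smooth_psh_near (closure Omega) (us j)) /\
       decreases_to E us u) /\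
  ((exists M : R, forall z, Omega z -> (u z <= M%:E)%E) ->
     exists us : nat -> Cn R n -> R,
       (forall j, smooth_psh_near (closure Omega) (us j)) /\
       decreases_to Omega us u).
Proof.
move=> [[oO O0 conO bO] [phi [pphi cphi nphi bphi]]] pu.
have [C hC] := bounded_nrm bO.
have cX : compact (closure Omega).
  have cB := @compact_closed_ball R n 0 C.
  apply: (subclosed_compact (@closed_closure _ _) cB) => z clz.
  apply: (compact_closed (@norm_hausdorff _ _) cB); apply: closureS clz.
  by move=> y Oy /=; rewrite subr0; exact: hC.
have OX : Omega `<=` closure Omega by exact: subset_closure.
have neg := max_principle oO conO cX pphi cphi nphi bphi.
have [rho crho rphi] := extend_compact cX cphi.
have rho0 z : closure Omega z -> ~ Omega z -> rho z = 0.
  by move=> Xz nO; rewrite rphi //; apply: bphi; split => // /interior_subset.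
have rhon z : Omega z -> rho z < 0 by move=> Oz; rewrite rphi ?neg //; exact: OX.
split=> [E [cE EO]|[M uM]]; last exact: (bounded_approx cX oO OX pphi cphi crho rphi rho0 rhon pu uM).
have [us [sus dus]] := compact_approx cX oO OX pphi cphi crho rphi rho0 rhon pu cE EO.
by exists us; split => // z Ez; apply: dus; exact: subset_closure.
Qed.
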